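(* Let $q_1,q_2>1$ be integers and let $\chi_1,\chi_2$ be primitive Dirichlet characters modulo $q_1$ and $q_2$ respectively such that $\chi_1\chi_2(-1)=1$. Let $S_{\chi_1,\chi_2}:\Gamma_0(q_1q_2)\to\mathbb{C}$ be the associated newform Dedekind sum and let $F_{\chi_1,\chi_2}$ be the smallest number field containing all values of $\chi_1$ and $\chi_2$. Then the image $S_{\chi_1,\chi_2}(\Gamma_1(q_1q_2))$ is a lattice of full rank inside $F_{\chi_1,\chi_2}$; that is, it is a subgroup of $(F_{\chi_1,\chi_2},+)$ which is a free abelian group of rank exactly $[F_{\chi_1,\chi_2}:\mathbb{Q}]$.
   Context: $\Gamma_0(N)=\{\begin{pmatrix}a&b\\c&d\end{pmatrix}\in SL_2(\mathbb{Z}): N\mid c\}$, and $\Gamma_1(N)$ is the subgroup of those matrices in $\Gamma_0(N)$ with $a\equiv d\equiv 1\pmod N$. $B_1(x)=0$ if $x\in\mathbb{Z}$ and $B_1(x)=x-\lfloor x\rfloor-\tfrac12$ otherwise. Newform Dedekind sum: put $\psi=\chi_1\overline{\chi_2}$ (a Dirichlet character modulo $q_1q_2$), $\psi(\gamma)=\psi(d)$ for $\gamma=\begin{pmatrix}a&b\\c&d\end{pmatrix}\in\Gamma_0(q_1q_2)$, and, for $z$ in the upper half plane, $f_{\chi_1,\chi_2}(z)=\sum_{n\ge1}\Big(\sum_{ab=n}\frac{\chi_1(a)\overline{\chi_2}(b)}{a}\Big)e^{2\pi i n z}$. Then $S_{\chi_1,\chi_2}(\gamma)=\frac{\tau(\overline{\chi_1})}{\pi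 i}\big(f_{\chi_1,\chi_2}(\gamma z)-\psi(\gamma)f_{\chi_1,\chi_2}(z)\big)$, where $\tau$ denotes the Gauss sum; this is independent of $z$. Equivalently (known result): if $\gamma=\begin{pmatrix}h&*\\k&l\end{pmatrix}\in\Gamma_0(q_1q_2)$ with $k\ge1$, then $$S_{\chi_1,\chi_2}(\gamma)=\sum_{j \bmod k}\ \sum_{n \bmod q_1}\overline{\chi_2}(j)\,\overline{\chi_1}(n)\,B_1\!\left(\tfrac{j}{k}\right)B_1\!\left(\tfrac{n}{q_1}+\tfrac{hj}{k}\right);$$ moreover $S_{\chi_1,\chi_2}(-\gamma)=S_{\chi_1,\chi_2}(\gamma)$, and $S_{\chi_1,\chi_2}(\gamma)=0$ if $k=0$. *)

(* Defs.v *)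
From mathcomp Require Import all_boot all_order all_algebra all_field.
From mathcomp Require Import all_classical all_reals all_analysis.
From mathcomp Require Import complex.

Set Implicit Arguments.
Unset Strict Implicit.
Unset Printing Implicit Defensive.

Import Order.TTheory GRing.Theory Num.Theory numFieldNormedType.Exports.

Local Open Scope classical_set_scope.
Local Open Scope ring_scope.

Section DirichletCharacters.
Variable R : realType.
Implicit Types (q : nat) (chi : int -> R[i]).

(* Characters are extended by zero to integers that are not coprime to q. *)
Definition dirichlet_character q chi : Prop :=
  [/\ forall m n, chi (m * n) = chi m * chi n,
      forall m, chi (m + q%:Z) = chi m
    & forall m, (chi m != 0) = coprimez m q%:Z].

(* d is an induced modulus of chi when chi is trivial on the units mod q that
   are 1 mod d; chi is primitive when it has no induced modulus d < q. *)
Definition induced_modulus q chi (d : nat) : Prop :=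
  forall m : int, coprimez m q%:Z -> (m = 1 %[mod d%:Z])%Z -> chi m = 1.

Definition primitive_character q chi : Prop :=
  dirichlet_character q chi /\
  forall d : nat, (d %| q)%N -> (d < q)%N -> ~ induced_modulus q chi d.

End DirichletCharacters.

(* A matrix g : 'M[int]_2 has entries a = g 0 0, b = g 0 1, c = g 1 0 and
   d = g 1 1. *)
Definition Gamma0 (N : nat) : set 'M[int]_2 :=
  [set g | \det g = 1 /\ (N%:Z %| (g 1 0)%R)%Z].

Definition Gamma1 (N : nat) : set 'M[int]_2 :=
  [set g | [/\ Gamma0 N g, ((g 0 0)%R = 1 %[mod N%:Z])%Z
             & ((g 1 1)%R = 1 %[mod N%:Z])%Z]].

Section NewformDedekindSum.
Variable R : realType.
Implicit Types (z : R[i]) (chi : int -> R[i]).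

Definition cexp z : R[i] :=
  (expR (complex.Re z))%:C%C * (cos (complex.Im z) +i* sin (complex.Im z))%C.

Definition two_pi_i : R[i] := (0 +i* (2 * pi))%C.

Definition moebius (g : 'M[int]_2) z : R[i] :=
  ((g 0 0)%:~R * z + (g 0 1)%:~R) / ((g 1 0)%:~R * z + (g 1 1)%:~R).

Definition gauss_sum (q : nat) chi : R[i] :=
  \sum_(n < q) chi n%:Z * cexp (two_pi_i * (n%:R / q%:R)).

Definition eisenstein_coef chi1 chi2 (n : nat) : R[i] :=
  \sum_(a <- divisors n) chi1 a%:Z * (chi2 (n %/ a)%N%:Z)^* / a%:R.

(* R[i]^o carries the topology of R[i] given by the modulus. *)
Definition eisenstein_f chi1 chi2 z : R[i]^o :=
  limn (fun N => \sum_(1 <= n < N)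
    eisenstein_coef chi1 chi2 n * cexp (two_pi_i * n%:R * z) : R[i]^o).

Definition psi chi1 chi2 (g : 'M[int]_2) : R[i] :=
  chi1 (g 1 1) * (chi2 (g 1 1))^*.

(* For g in Gamma0 (q1 * q2) the value is the same at every point z of the
   upper half plane; z is kept as a parameter. *)
Definition newform_dedekind_sum (q1 : nat) chi1 chi2 z (g : 'M[int]_2) : R[i] :=
  gauss_sum q1 (fun n => (chi1 n)^*) / (pi%:C%C * 'i%C) *
    (eisenstein_f chi1 chi2 (moebius g z)
       - psi chi1 chi2 g * eisenstein_f chi1 chi2 z).

End NewformDedekindSum.

(* A number field inside C is given by a finite extension F of rat together
   with an embedding iota of F into C. *)
Definition smallest_number_field (R : realType) (X : set R[i])
    (F : fieldExtType rat) (iota : {rmorphism F -> R[i]}) : Prop :=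
  X `<=` range iota /\
  forall (K : fieldExtType rat) (kappa : {rmorphism K -> R[i]}),
    X `<=` range kappa -> range iota `<=` range kappa.

Definition int_comb (V : zmodType) (r : nat) (e : 'I_r -> V)
    (m : {ffun 'I_r -> int}) : V := \sum_(i < r) e i *~ m i.

Definition free_abelian_of_rank (V : zmodType) (L : set V) (r : nat) : Prop :=
  exists2 e : 'I_r -> V, injective (int_comb e) & range (int_comb e) = L.

Definition full_rank_lattice (R : realType) (F : fieldExtType rat)
    (iota : {rmorphism F -> R[i]}) (L : set R[i]) : Prop :=
  [/\ L `<=` range iota, zmod_closed [pred x in L]
    & free_abelian_of_rank L (\dim {:F})].

(* Main.v *)
Require Import Defs.
From mathcomp Require Import all_boot all_order all_algebra all_field.
From mathcomp Require Import all_classical all_reals all_analysis.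
From mathcomp Require Import complex.
From mathcomp Require cyclic.
From mathcomp Require Import ring lra zify.

Set Implicit Arguments.
Unset Strict Implicit.
Unset Printing Implicit Defensive.

Import Order.TTheory GRing.Theory Num.Theory numFieldNormedType.Exports.

Local Open Scope classical_set_scope.
Local Open Scope ring_scope.

(** Write e(w) = exp(2 pi i w), N = q1 q2 and S for the Dedekind sum at a
    fixed z.  By the partial fractions of the cotangent, f(z) is a constant
    times the sum, over nonzero a and all n, of
    chi1(a) chi2(n) / (a (q2 a z + n)), suitably ordered.  A substitution
    adapted to the matrix g turns the terms for g z into those for z plus
    terms proportional to 1 / (a a'); in a symmetric window of a and a' the
    last sum tends to a finite double sum of cotangents, and finite Fourier
    analysis identifies it with the Bernoulli form of S(g).  Hence S is
    independent of z, additive on Gamma_1(N), and has values in F.  As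
    Gamma_1(N) is finitely generated, the image is a finitely generated
    subgroup of F.

    It spans F over Q: at the parabolic element with lower row
    (N x^2, 1 + N x y), where x = q2 u and u, y are coprime, S equals
    C chi1(u) chi2(y).  The constant C is a product of nonzero factors with
    the sum over t mod N of chi1(t) chi2(t) / sin^2(pi t / N), in which the
    terms t = 1, -1 outweigh all the others.  The values chi1(u) chi2(y) span
    F, and so do their multiples by C, an element of F.  A finitely generated
    group that spans F is a lattice of full rank. *)

(** The double series converges only conditionally, and the substitution (a, n) -> (a', n') does not
    respect the order that defines f. The way out is to index both sides by the pair (a, a'): for
    fixed a the admissible a' run through row a of f(g z), for fixed a' the admissible a run through
    row a' of f(z), so one finite sum over a square window serves both. A row cut off by the window
    differs from the full row by O(1/M), uniformly in the row; with the weights 1/|a| the errors add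
    up to O((log M)/M).

    Independence of z is not proved analytically but read off the finite formula, and additivity
    then follows because S is a difference of values of f.

    The parabolic elements are chosen because their two B_1 arguments differ by a constant shift
    along a progression. The sum becomes an autocorrelation of a sawtooth, which is quadratic in the
    shift, and the Fourier coefficients of this quadratic are the 1/sin^2. That t = 1, -1 dominate
    comes down to pi^2 < 12. *)

Section Modulus.
Variable R : realType.
Implicit Types x y : R[i].

(* The norm of [R[i]] takes its values in [R[i]]. *)
Definition nm x : R := complex.Re `|x|.

Lemma nmE x : (nm x)%:C%C = `|x|.
Proof. by rewrite /nm normc_def. Qed.

Lemma nm_ge0 x : 0 <= nm x.
Proof. by rewrite -ler0c nmE normr_ge0. Qed.

Lemma nm0 : nm 0 = 0.
Proof. by rewrite /nm normr0. Qed.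

Lemma nm_eq0 x : (nm x == 0) = (x == 0).
Proof. by rewrite -(inj_eq (@complexI R)) nmE normr_eq0. Qed.

Lemma nm_gt0 x : (0 < nm x) = (x != 0).
Proof. by rewrite lt_def nm_ge0 andbT nm_eq0. Qed.

Lemma nm1 : nm 1 = 1.
Proof. by rewrite /nm normr1. Qed.

Lemma nmM x y : nm (x * y) = nm x * nm y.
Proof. by apply: (@complexI R); rewrite rmorphM !nmE normrM. Qed.

Lemma nmV x : nm x^-1 = (nm x)^-1.
Proof. by apply: (@complexI R); rewrite fmorphV !nmE normfV. Qed.

Lemma nmX x n : nm (x ^+ n) = nm x ^+ n.
Proof. by apply: (@complexI R); rewrite rmorphXn !nmE normrX. Qed.

Lemma nmN x : nm (- x) = nm x.
Proof. by rewrite /nm normrN. Qed.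

Lemma nmB x y : nm (x - y) = nm (y - x).
Proof. by rewrite -nmN opprB. Qed.

Lemma nmD x y : nm (x + y) <= nm x + nm y.
Proof. by rewrite -lecR rmorphD !nmE ler_normD. Qed.

Lemma nm_leB x y : nm x - nm y <= nm (x - y).
Proof. by rewrite lerBlDr -{1}(subrK y x) nmD. Qed.

Lemma nm_sum (I : Type) (r : seq I) (P : pred I) (F : I -> R[i]) :
  nm (\sum_(i <- r | P i) F i) <= \sum_(i <- r | P i) nm (F i).
Proof.
elim/big_ind2: _ => [|u1 v1 u2 v2 h1 h2|//]; first by rewrite nm0.
by rewrite (le_trans (nmD _ _)) ?lerD.
Qed.

Lemma nm_real (a : R) : nm a%:C%C = `|a|.
Proof. by rewrite /nm normc_def /= expr0n addr0 sqrtr_sqr. Qed.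

Lemma nm_nat n : nm n%:R = n%:R.
Proof. by rewrite /nm normr_nat -(rmorph_nat (real_complex R)). Qed.

Lemma nm_int (m : int) : nm m%:~R = `|m|%:~R.
Proof. by rewrite -(rmorph_int (real_complex R)) nm_real intr_norm. Qed.

Lemma nm_conj x : nm (x^*) = nm x.
Proof. by rewrite /nm norm_conjC. Qed.

Lemma nm_sqr x : nm x ^+ 2 = complex.Re x ^+ 2 + complex.Im x ^+ 2.
Proof.
by apply: (@complexI R); rewrite rmorphXn /= nmE add_Re2_Im2.
Qed.

Lemma Re_le_nm x : `|complex.Re x| <= nm x.
Proof.
rewrite -(@ler_pXn2r _ 2) ?nnegrE ?nm_ge0 // nm_sqr real_normK ?num_real //.
by rewrite lerDl sqr_ge0.
Qed.

Lemma Im_le_nm x : `|complex.Im x| <= nm x.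
Proof.
rewrite -(@ler_pXn2r _ 2) ?nnegrE ?nm_ge0 // nm_sqr real_normK ?num_real //.
by rewrite lerDr sqr_ge0.
Qed.

Lemma nm_le_ReIm x : nm x <= `|complex.Re x| + `|complex.Im x|.
Proof.
rewrite -(@ler_pXn2r _ 2) ?nnegrE ?nm_ge0 ?addr_ge0 // nm_sqr sqrrD.
by rewrite !real_normK ?num_real // lerD2r lerDl mulrn_wge0 ?mulr_ge0.
Qed.

End Modulus.

(** * Convergence of complex sequences *)

Section Limits.
Variable R : realType.
Implicit Types (u v : nat -> R[i]) (l m : R[i]) (b : nat -> R).

(** Convergence is expressed by a real distance, so that real squeeze arguments apply; [tends_cvg]
    leads back to the topology of [R[i]^o], in which [eisenstein_f] is defined. *)
Definition tends u l := (fun n => nm (u n - l)) @ \oo --> (0 : R).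

Lemma tendsP u l : tends u l <->
  forall e : R, 0 < e -> \forall n \near \oo, nm (u n - l) < e.
Proof.
rewrite /tends; split=> [/cvgr0Pnorm_lt h e e0|h].
  by near=> n; rewrite -[nm _]ger0_norm ?nm_ge0 //; near: n; apply: h.
apply/cvgr0Pnorm_lt => e e0; near=> n.
by rewrite ger0_norm ?nm_ge0 //; near: n; apply: h.
Unshelve. all: by end_near. Qed.

Lemma tends_le u l b : (forall n, nm (u n - l) <= b n) -> b @ \oo --> (0 : R) ->
  tends u l.
Proof.
move=> h hb; apply: (squeeze_cvgr _ (cvg_cst 0) hb) => //.
by near=> n; rewrite nm_ge0 h.
Unshelve. all: by end_near. Qed.

Lemma tends_le_near u l b : (\forall n \near \oo, nm (u n - l) <= b n) ->
  b @ \oo --> (0 : R) -> tends u l.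
Proof.
move=> h hb; apply: (squeeze_cvgr _ (cvg_cst 0) hb) => //.
by near=> n; rewrite nm_ge0 /=; near: n.
Unshelve. all: by end_near. Qed.

Lemma tends_cst l : tends (fun=> l) l.
Proof. by rewrite /tends subrr nm0; apply: cvg_cst. Qed.

Lemma tendsD u v l m : tends u l -> tends v m -> tends (fun n => u n + v n) (l + m).
Proof.
move=> hu hv; apply: (@tends_le _ _ (fun n => nm (u n - l) + nm (v n - m))).
  by move=> n; rewrite opprD addrACA nmD.
by rewrite -[0 in X in _ --> X](addr0 0); apply: cvgD.
Qed.

Lemma tends_sub0 u v l : tends u l -> tends (fun n => u n - v n) 0 -> tends v l.
Proof.
move=> hu hv.
apply: (@tends_le _ _ (fun n => nm (u n - l) + nm (u n - v n - 0))).
  move=> n; rewrite subr0 (nmB (u n)) [X in _ <= X]addrC.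
  rewrite -(nmB (u n)) (nmB (u n) (v n)).
  by apply: le_trans (nmD _ _); rewrite addrA subrK.
by rewrite -[0 in X in _ --> X](addr0 0); apply: cvgD.
Qed.

Lemma tendsMl l u m : tends u m -> tends (fun n => l * u n) (l * m).
Proof.
move=> hu; apply: (@tends_le _ _ (fun n => nm l * nm (u n - m))).
  by move=> n; rewrite -mulrBr nmM.
by rewrite -[0 in X in _ --> X](mulr0 (nm l)); apply: cvgMr.
Qed.

Lemma tendsB u v l m : tends u l -> tends v m -> tends (fun n => u n - v n) (l - m).
Proof.
move=> hu hv; apply: tendsD => //.
rewrite -mulN1r; have := tendsMl (-1) hv; congr (tends _ _).
by apply/funext => n; rewrite mulN1r.
Qed.

Lemma tendsM u v l m : tends u l -> tends v m -> tends (fun n => u n * v n) (l * m).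
Proof.
move=> hu hv; apply: (@tends_le _ _
  (fun n => nm (u n - l) * nm (v n - m) +
            (nm l * nm (v n - m) + nm m * nm (u n - l)))).
  move=> n; rewrite -!nmM.
  have -> : u n * v n - l * m = (u n - l) * (v n - m) +
    (l * (v n - m) + m * (u n - l)) by ring.
  by apply: (le_trans (nmD _ _)); rewrite lerD2l nmD.
have -> : (0 : R) = 0 * 0 + (nm l * 0 + nm m * 0) by rewrite !mulr0 !addr0.
apply: cvgD; first exact: cvgM.
by apply: cvgD; apply: cvgMr.
Qed.

Lemma tendsV u l : l != 0 -> tends u l -> tends (fun n => (u n)^-1) l^-1.
Proof.
move=> l0 hu.
have nl : 0 < nm l by rewrite nm_gt0.
apply: (@tends_le_near _ _ (fun n => 2 / nm l ^+ 2 * nm (u n - l))); last first.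
  by rewrite -[0 in X in _ --> X](mulr0 (2 / nm l ^+ 2)); apply: cvgMr.
near=> n.
have h : nm (u n - l) < nm l / 2.
  by near: n; apply: (proj1 (tendsP u l) hu); rewrite divr_gt0.
have hun : nm l / 2 < nm (u n).
  have := nm_leB l (u n); rewrite nmB; lra.
have un0 : u n != 0 by rewrite -nm_gt0; apply: lt_trans hun; rewrite divr_gt0.
have -> : (u n)^-1 - l^-1 = (l - u n) / (u n * l).
  by field; rewrite un0 l0.
rewrite nmM nmV nmM (nmB l) mulrC ler_wpM2r ?nm_ge0 //.
rewrite invfM expr2 invfM mulrA ler_wpM2r ?invr_ge0 ?nm_ge0 //.
rewrite -[2 / _]invrK invfM invrK lef_pV2 ?posrE ?divr_gt0 //.
- by rewrite mulrC ltW.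
- by rewrite nm_gt0.
- by rewrite mulrC divr_gt0.
Unshelve. all: by end_near. Qed.

Lemma tends_sum (I : Type) (r : seq I) (P : pred I) (F : I -> nat -> R[i])
    (L : I -> R[i]) :
  (forall i, P i -> tends (F i) (L i)) ->
  tends (fun n => \sum_(i <- r | P i) F i n) (\sum_(i <- r | P i) L i).
Proof.
move=> h; elim: r => [|i r IH].
  have -> : (fun n => \sum_(i <- [::] | P i) F i n) = fun=> 0.
    by apply/funext => n; rewrite big_nil.
  by rewrite big_nil; apply: tends_cst.
have -> : (fun n => \sum_(i <- i :: r | P i) F i n) =
  (fun n => if P i then F i n + \sum_(i <- r | P i) F i n
            else \sum_(i <- r | P i) F i n).
  by apply/funext => n; rewrite big_cons.
by rewrite big_cons; case: ifP => // Pi; apply: tendsD => //; apply: h.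
Qed.

Lemma tends_uniq u l m : tends u l -> tends u m -> l = m.
Proof.
move=> hl hm; apply/eqP/contraT; rewrite -subr_eq0 -nm_gt0 => h.
have h2 : 0 < nm (l - m) / 2 by rewrite divr_gt0.
near \oo => n.
have h3 : nm (u n - l) < nm (l - m) / 2.
  by near: n; apply: (proj1 (tendsP u l) hl).
have h4 : nm (u n - m) < nm (l - m) / 2.
  by near: n; apply: (proj1 (tendsP u m) hm).
have := nmD (l - u n) (u n - m); rewrite addrA subrK (nmB l); lra.
Unshelve. all: by end_near. Qed.

Lemma tends_comp u l (f : nat -> nat) : tends u l ->
  (forall n, (n <= f n)%N) -> tends (fun n => u (f n)) l.
Proof.
move=> hu hf; apply/tendsP => e e0.
have [k _ hk] := proj1 (tendsP u l) hu e e0.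
by exists k => //= n kn; apply: hk => /=; apply: leq_trans kn (hf n).
Qed.

Lemma tends_shift u l k : tends (fun n => u (n + k)%N) l -> tends u l.
Proof. by rewrite /tends (cvg_shiftn k (fun n => nm (u n - l))). Qed.

Lemma tends_cvg u l : tends u l -> ((u : nat -> R[i]^o) @ \oo --> (l : R[i]^o)).
Proof.
move=> /tendsP h; apply/cvgrPdist_lt => e e0.
have e1 : 0 < complex.Re e by move: e0; rewrite ltcE /= => /andP[].
have eE : (complex.Re e)%:C%C = e by apply: RRe_real; apply: gtr0_real.
near=> n; rewrite -[X in X < _]nmE -eE ltcR nmB; near: n; exact: h.
Unshelve. all: by end_near. Qed.

Lemma tends_ReIm u l : (fun n => complex.Re (u n)) @ \oo --> complex.Re l ->
  (fun n => complex.Im (u n)) @ \oo --> complex.Im l -> tends u l.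
Proof.
move=> hr hi; apply: (@tends_le _ _ (fun n =>
  `|complex.Re (u n) - complex.Re l| + `|complex.Im (u n) - complex.Im l|)).
  move=> n; apply: le_trans (nm_le_ReIm _) _.
  by case: (u n) (l) => [a b] [c d].
rewrite -[0 in X in _ --> X](addr0 0); apply: cvgD;
  by apply/norm_cvg0P; apply/subr_cvg0.
Qed.

Lemma tends_real b (x : R) : b @ \oo --> x -> tends (fun n => (b n)%:C%C) x%:C%C.
Proof. by move=> h; apply: tends_ReIm => //=; apply: cvg_cst. Qed.

End Limits.

(** * The exponential e(w) and bounds for the sine *)

Section Exponential.
Variable R : realType.
Implicit Types v w : R[i].

Lemma cexpD v w : cexp (v + w) = cexp v * cexp w.
Proof.
case: v w => [a b] [c d]; rewrite /cexp /= expRD cosD sinD.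
by apply/eqP; rewrite eq_complex /=; apply/andP; split; apply/eqP; ring.
Qed.

Lemma cexp0 : cexp 0 = 1 :> R[i].
Proof. by rewrite /cexp /= expR0 cos0 sin0 mul1r. Qed.

Lemma nm_cexp w : nm (cexp w) = expR (complex.Re w).
Proof.
rewrite /cexp nmM nm_real ger0_norm ?expR_ge0 //.
suff -> : nm (cos (complex.Im w) +i* sin (complex.Im w))%C = 1 by rewrite mulr1.
apply/eqP; rewrite -(@eqrXn2 _ 2) ?nm_ge0 // nm_sqr /= cos2Dsin2 expr1n //.
Qed.

Definition ex w : R[i] := cexp (two_pi_i R * w).

Lemma exD v w : ex (v + w) = ex v * ex w.
Proof. by rewrite /ex mulrDr cexpD. Qed.

Lemma ex0 : ex 0 = 1.
Proof. by rewrite /ex mulr0 cexp0. Qed.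

Lemma ex_neq0 w : ex w != 0.
Proof. by rewrite -nm_gt0 nm_cexp expR_gt0. Qed.

Lemma exN w : ex (- w) = (ex w)^-1.
Proof.
by apply: (mulfI (ex_neq0 w)); rewrite -exD subrr ex0 divff ?ex_neq0.
Qed.

Lemma exMn n w : ex (n%:R * w) = ex w ^+ n.
Proof.
elim: n => [|n IH]; first by rewrite mul0r ex0 expr0.
by rewrite -natr1 mulrDl mul1r exD IH exprSr.
Qed.

Lemma nm_ex w : nm (ex w) = expR (- (2 * pi * complex.Im w)).
Proof. by rewrite nm_cexp; case: w => a b /=; rewrite mul0r sub0r. Qed.

Lemma ex_realE (t : R) : ex t%:C%C = (cos (2 * pi * t) +i* sin (2 * pi * t))%C.
Proof. rewrite /ex /cexp.
have -> : two_pi_i R * t%:C%C = (0 +i* (2 * pi * t))%C by rewrite /two_pi_i; simpc.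
by rewrite /= expR0 mul1r. Qed.

Lemma ex1 : ex 1 = 1.
Proof.
have := ex_realE 1; rewrite mulr1 rmorph1 => ->.
by rewrite !(mulr_natl pi 2) cos2pi sin2pi.
Qed.

Lemma ex_int (m : int) : ex m%:~R = 1.
Proof.
have h n : ex n%:R = 1 by rewrite -[n%:R]mulr1 exMn ex1 expr1n.
by case: m => n; rewrite ?NegzE ?mulrNz ?exN -?pmulrn h ?invr1.
Qed.

Lemma ex_real_neq1 (t : R) : 0 < t < 1 -> ex t%:C%C != 1.
Proof.
move=> /andP[t0 t1]; rewrite ex_realE eq_complex /=; apply/negP => /andP[/eqP c _].
have : sin (pi * t) = 0.
  apply/eqP; rewrite -(sqrf_eq0 (sin _)) sin2cos2.
  have := cos_mulr2n (pi * t); rewrite -mulrnAl -mulr_natl c => hc.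
  by apply/eqP; move: hc; rewrite -(mulr_natl (_ ^+ 2)); lra.
apply/eqP; rewrite gt_eqF // sin_gt0_pi // mulr_gt0 ?pi_gt0 //=.
by rewrite -[ltRHS]mulr1 ltr_pM2l ?pi_gt0.
Qed.

Lemma ex_prim n : (0 < n)%N -> n.-primitive_root (ex n%:R^-1).
Proof.
move=> n0; have nn : (n%:R : R[i]) != 0 by rewrite pnatr_eq0 -lt0n.
apply/andP; split=> //; apply/forallP => i; rewrite unity_rootE -exMn.
case: (eqVneq i.+1 n) => [->|ne]; first by rewrite divff // ex1 eqxx.
have lt : (i.+1 < n)%N by rewrite ltn_neqAle ne ltn_ord.
have -> : (i.+1%:R / n%:R : R[i]) = (i.+1%:R / n%:R : R)%:C%C.
  by rewrite rmorphM fmorphV !rmorph_nat.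
apply/eqP/negbTE; apply: ex_real_neq1.
by rewrite divr_gt0 ?ltr0n //= ltr_pdivrMr ?ltr0n // mul1r ltr_nat.
Qed.

Lemma ex_upper_neq1 w : 0 < complex.Im w -> ex w != 1.
Proof.
move=> h; apply/eqP => h1; have := nm_ex w; rewrite h1 nm1 => /esym/eqP.
by rewrite lt_eqF // expR_lt1 oppr_lt0 !mulr_gt0 ?pi_gt0.
Qed.

Lemma is_derive_cvgn (g : R -> R) (d : R) : is_derive (0 : R) 1 g d ->
  (fun n => n.+1%:R * (g n.+1%:R^-1 - g 0)) @ \oo --> d.
Proof.
move=> [h <-]; have {}h : h^-1 *: ((g \o shift 0) (h *: 1) - g 0) @[h --> 0^'] -->
  'D_1 g 0 by exact: h.
have : (harmonic : nat -> R) @ \oo --> (0 : R)^'.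
  move=> A [e /= e0 hA]; have /cvgrPdist_lt /(_ e e0) [N _ hN] := @cvg_harmonic R.
  by exists N => // n Nn; apply: hA; [exact: hN|rewrite /= gt_eqF ?harmonic_gt0].
move=> hh; apply: cvg_trans (cvg_comp _ _ hh h); apply: near_eq_cvg.
by near=> n; rewrite /= /harmonic invrK addr0 /GRing.scale /= mulr1.
Unshelve. all: by end_near. Qed.

(** This is the derivative at 0 of t -> e(t w), sampled at t = 1/(n+1). Real and imaginary parts are
    treated separately, so that real derivatives suffice. *)
Lemma ex_derive0 w :
  tends (fun n => n.+1%:R * (ex (w / n.+1%:R) - 1)) (two_pi_i R * w).
Proof.
set u := two_pi_i R * w; pose a := complex.Re u; pose b := complex.Im u.
have E n : ex (w / n.+1%:R) =
  (expR (a * n.+1%:R^-1) * cos (b * n.+1%:R^-1) +i*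
   (expR (a * n.+1%:R^-1) * sin (b * n.+1%:R^-1)))%C.
  rewrite /ex mulrA -/u.
  have -> : u / n.+1%:R = (a / n.+1%:R +i* (b / n.+1%:R))%C.
    rewrite -(rmorph_nat (real_complex R)) -fmorphV /a /b; case: (u) => x y /=.
    by simpc.
  by rewrite /cexp /=; simpc.
have M n (x y : R) : n.+1%:R * ((x +i* y)%C - 1) =
   (n.+1%:R * (x - 1) +i* (n.+1%:R * (y - 0)))%C :> R[i].
  rewrite -(rmorph_nat (real_complex R)); simpc; by rewrite ?subr0.
apply: tends_ReIm.
  have := @is_derive_cvgn (fun t => expR (a * t) * cos (b * t)) a.
  rewrite !mulr0 expR0 cos0 mulr1 => h.
  apply: cvg_trans (h _); last first.
    apply: is_derive_eq; rewrite !mulr0 expR0 cos0 sin0 /GRing.scale /=; ring.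
  by apply: near_eq_cvg; near=> n; rewrite E M.
have := @is_derive_cvgn (fun t => expR (a * t) * sin (b * t)) b.
rewrite !mulr0 expR0 sin0 mulr0 => h.
apply: cvg_trans (h _); last first.
  apply: is_derive_eq; rewrite !mulr0 expR0 cos0 sin0 /GRing.scale /=; ring.
by apply: near_eq_cvg; near=> n; rewrite E M.
Unshelve. all: by end_near. Qed.

Lemma tends_inv_nat : tends (fun n => n.+1%:R^-1) (0 : R[i]).
Proof.
have := tends_real (@cvg_harmonic R); congr (tends _ _).
by apply/funext => n; rewrite /harmonic /= fmorphV rmorph_nat.
Qed.

Lemma ex_cvg1 w : tends (fun n => ex (w / n.+1%:R)) 1.
Proof.
have := tendsD (tends_cst 1) (tendsM tends_inv_nat (ex_derive0 w)).
rewrite mul0r addr0; congr (tends _ _); apply/funext => n.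
by rewrite mulKf ?pnatr_eq0 // addrC subrK.
Qed.

(** The function sin t - t cos t vanishes at 0 and has derivative t sin t, nonnegative up to pi; the
    second alternative only records that range. *)
Lemma sin_ge_cos (y : R) : 0 <= y -> y * cos y <= sin y \/ pi < y.
Proof.
move=> y0; case: (lerP y pi) => ypi; [left|by right].
case: (eqVneq y 0) => [->|yn]; first by rewrite mul0r sin0.
have yp : 0 < y by rewrite lt_def yn.
pose g (t : R) := sin t - t * cos t.
have dg (x : R) : is_derive x 1 g (x * sin x).
  by apply: is_derive_eq; rewrite /GRing.scale /=; ring.
have [x|x /[!in_itv]/= /andP[x0 xy]] := @MVT _ g (fun x => x * sin x) _ _ yp (fun x _ => dg x).
  apply: continuous_subspaceT => {}x; apply/differentiable_continuous.
  by apply/derivable1_diffP; case: (dg x).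
rewrite /g sin0 mul0r !subr0 => h; rewrite -subr_ge0 h !mulr_ge0 // ?ltW //.
by rewrite sin_gt0_pi // x0 (lt_le_trans xy).
Qed.

(** Applied at y/2, the previous bound gives sin y = 2 sin(y/2) cos(y/2) >= y cos^2(y/2) = y (1 +
    cos y)/2, and cos y >= 0 on this range. *)
Lemma sin_ge_half (y : R) : 0 <= y -> y <= pi / 2 -> y / 2 <= sin y.
Proof.
move=> y0 y1; have p0 := pi_gt0 R.
have c1 : 0 <= cos y by apply: cos_ge0_pihalf; lra.
have c2 : 0 <= cos (y / 2) by apply: cos_ge0_pihalf; lra.
have [|h|h] := @sin_ge_cos (y / 2); [lra| |lra].
have := sin_mulr2n (y / 2); have := cos_mulr2n (y / 2).
have -> : (y / 2) *+ 2 = y by rewrite -mulr_natl; lra.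
rewrite (mulr2n (_ ^+ 2)) (mulr2n (_ * _)) => hc hs.
have h1 : cos (y / 2) * (y / 2 * cos (y / 2)) <= cos (y / 2) * sin (y / 2).
  by rewrite ler_wpM2l.
have h2 : cos (y / 2) * (y / 2 * cos (y / 2)) = y / 2 * (cos (y / 2) ^+ 2) by ring.
have h3 : cos (y / 2) ^+ 2 = (1 + cos y) / 2 by lra.
rewrite h3 in h2.
have h4 : 0 <= y * cos y by apply: mulr_ge0.
lra.
Qed.

End Exponential.

(** * Partial fractions of the cotangent *)

Lemma sum_unity (F : fieldType) n (z : F) : z ^+ n = 1 ->
  \sum_(j < n) z ^+ j = if z == 1 then n%:R else 0.
Proof.
move=> zn; case: eqP => [->|/eqP z1].
  by under eq_bigr do rewrite expr1n; rewrite sumr_const card_ord.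
have := subrX1 z n; rewrite zn subrr => /esym/eqP.
by rewrite mulf_eq0 subr_eq0 (negPf z1) => /eqP.
Qed.

(** Telescoping from 1/(a+1)^2 <= 1/a - 1/(a+1); the induction carries the sharper bound 1/K -
    1/(M-1). *)
Lemma sum_inv_sqr (R : realFieldType) K M : (0 < K)%N ->
  \sum_(K.+1 <= j < M) (j%:R ^- 2 : R) <= K%:R^-1.
Proof.
move=> K0; case: (leqP M K) => [h|h].
  by rewrite big_geq ?invr_ge0 // (leq_trans h).
suff : \sum_(K.+1 <= j < M) (j%:R ^- 2 : R) <= K%:R^-1 - M.-1%:R^-1.
  by move/le_trans; apply; rewrite gerBl invr_ge0.
rewrite -(subnKC h); elim: (M - K.+1)%N => [|m IH].
  by rewrite addn0 big_geq // subrr.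
rewrite addnS big_nat_recr ?leq_addr //=.
apply: le_trans (lerD IH (lexx _)) _.
rewrite addSn /=; set a : R := (K + m)%:R.
have a0 : 0 < a by rewrite ltr0n addn_gt0 K0.
have -> : (K + m).+1%:R = a + 1 :> R by rewrite -natr1.
rewrite -addrA lerD2l -subr_ge0.
have -> : - (a + 1)^-1 - (- a^-1 + (a + 1) ^- 2) = a^-1 * (a + 1) ^- 2.
  have an : a != 0 by rewrite gt_eqF.
  have an1 : a + 1 != 0 by rewrite gt_eqF ?addr_gt0.
  by move: a an an1 {a0 IH}; clear => a an an1; field; rewrite an1 an.
by rewrite mulr_ge0 ?invr_ge0 ?exprn_ge0 ?addr_ge0 // ltW.
Qed.

Section PartialFractions.
Variable R : realType.
Implicit Types w x : R[i].

(** Dominated convergence for sums whose length grows with n: the limits inherit the bound B/j^2, so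
    both tails are small together, and the head has a fixed number of terms. The conclusion concerns
    differences, which avoids proving that the series of limits converges. *)
Lemma tannery (t : nat -> nat -> R[i]) (L : nat -> R[i]) (B : R) (j0 : nat) :
  (forall j, tends (fun n => t n j) (L j)) ->
  (\forall n \near \oo, forall j, (j0 <= j <= n)%N -> nm (t n j) <= B * j%:R ^- 2) ->
  tends (fun n => \sum_(1 <= j < n.+1) (t n j - L j)) 0.
Proof.
move=> ht hB.
have hL j : (j0 <= j)%N -> nm (L j) <= B * j%:R ^- 2.
  move=> hj; apply/ler_addgt0Pr => e e0; near \oo => n.
  have h1 : nm (t n j - L j) < e by near: n; apply: (proj1 (tendsP _ _) (ht j)).
  have h2 : nm (t n j) <= B * j%:R ^- 2.
    have jn : (j <= n)%N by near: n; exists j.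
    have h : forall j, (j0 <= j <= n)%N -> nm (t n j) <= B * j%:R ^- 2.
      by near: n.
    by apply: h; rewrite hj jn.
  have := nm_leB (L j) (t n j); rewrite nmB; lra.
have B0 : 0 <= B.
  have := le_trans (nm_ge0 _) (hL j0.+1 (leqnSn _)).
  by rewrite pmulr_lge0 // invr_gt0 exprn_gt0.
apply/tendsP => e e0.
have [K hK] : exists K : nat, 4 * B / e < K%:R.
  by exists (Num.bound (4 * B / e)); apply: archi_boundP; rewrite divr_ge0 ?mulr_ge0 // ltW.
pose K' := (maxn K j0).+1.
have hK' : 2 * B / K'%:R < e / 2.
  have : 4 * B / e < K'%:R.
    by apply: lt_le_trans hK _; rewrite ler_nat /K' ltnW // ltnS leq_maxl.
  rewrite ltr_pdivrMr // ltr_pdivrMr ?ltr0n //; lra.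
have hs : tends (fun n => \sum_(1 <= j < K'.+1) (t n j - L j)) 0.
  rewrite [X in tends _ X](_ : 0 = \sum_(1 <= j < K'.+1) (L j - L j)); last by rewrite big1 // => j _; rewrite subrr.
  by apply: tends_sum => j _; apply: tendsB (ht j) (tends_cst _).
near=> n.
have nK : (K' <= n)%N by near: n; exists K'.
rewrite subr0 (@big_cat_nat _ _ _ K'.+1) //=.
apply: le_lt_trans (nmD _ _) _.
have h1 : nm (\sum_(1 <= j < K'.+1) (t n j - L j)) < e / 2.
  by rewrite -[X in nm X]subr0; near: n; apply: (proj1 (tendsP _ _) hs); rewrite divr_gt0.
have h2 : nm (\sum_(K'.+1 <= j < n.+1) (t n j - L j)) <= 2 * B / K'%:R.
  apply: le_trans (nm_sum _ _ _) _.
  apply: (@le_trans _ _ (\sum_(K'.+1 <= j < n.+1) 2 * B * j%:R ^- 2)).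
    rewrite big_nat_cond [X in _ <= X]big_nat_cond; apply: ler_sum => j /andP[/andP[a b] _].
    have hj : (j0 <= j)%N.
      by apply: leq_trans (ltnW a); rewrite /K' ltnW // ltnS leq_maxr.
    apply: le_trans (nmD _ _) _; rewrite nmN -mulrA mulr_natl mulr2n.
    have h3 := hL j hj.
    have h4 : nm (t n j) <= B * j%:R ^- 2.
      have h : forall j, (j0 <= j <= n)%N -> nm (t n j) <= B * j%:R ^- 2.
        by near: n.
      by apply: h; rewrite hj -ltnS.
    exact: lerD.
  by rewrite -mulr_sumr ler_wpM2l ?mulr_ge0 // sum_inv_sqr.
lra.
Unshelve. all: by end_near. Qed.

(* [cayley (ex w)] is [i * cot (pi * w)]. *)
Definition cayley x : R[i] := (1 + x) / (1 - x).

Lemma cayleyE x : x != 1 -> cayley x = 2 / (1 - x) - 1.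
Proof. by move=> h; rewrite /cayley; field; rewrite subr_eq0 eq_sym. Qed.

(** The distribution relation: cot(pi n w) is the mean of the n translates cot(pi (w + j/n)). Every
    y = z^j x has y^n = x^n, so 1/(1 - y) is the sum of the y^i, i < n, over 1 - x^n, and summing
    over j keeps only i = 0. *)
Lemma cayley_split n (z : R[i]) x : n.-primitive_root z -> x ^+ n != 1 ->
  \sum_(j < n) cayley (z ^+ j * x) = n%:R * cayley (x ^+ n).
Proof.
move=> pz xn.
have yn j : (z ^+ j * x) ^+ n = x ^+ n.
  by rewrite exprMn exprAC (prim_expr_order pz) expr1n mul1r.
have y1 j : z ^+ j * x != 1.
  by apply: contraNneq xn => h; rewrite -(yn j) h expr1n.
have n1 : 1 - x ^+ n != 0 by rewrite subr_eq0 eq_sym.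
under eq_bigr do rewrite cayleyE //.
rewrite cayleyE // sumrB sumr_const card_ord mulrBr mulr1; congr (_ - _).
rewrite -mulr_sumr mulrCA; congr (_ * _).
apply: (mulIf n1); rewrite mulfVK // mulr_suml.
transitivity (\sum_(j < n) \sum_(i < n) x ^+ i * (z ^+ i) ^+ j).
  apply: eq_bigr => j _; apply: (mulfI (_ : 1 - z ^+ j * x != 0)).
    by rewrite subr_eq0 eq_sym.
  rewrite mulVKf ?subr_eq0 1?eq_sym //.
  rewrite -{1}(yn j) -opprB subrX1 -mulNr opprB; congr (_ * _).
  by apply: eq_bigr => i _; rewrite exprMn -!exprM mulrC mulnC.
rewrite exchange_big /=.
have n0 := prim_order_gt0 pz.
transitivity (\sum_(i < n) (if i == Ordinal n0 then n%:R else 0) * x ^+ i).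
  apply: eq_bigr => i _.
  rewrite -mulr_sumr mulrC sum_unity; last by rewrite exprAC (prim_expr_order pz) expr1n.
  rewrite -(prim_order_dvd pz).
  suff -> : (n %| i)%N = (i == Ordinal n0) by [].
  apply/idP/eqP => [h|->]; last exact: dvdn0.
  apply/val_inj => /=; apply/eqP; move: h; apply: contraTT; rewrite -lt0n => i0.
  by rewrite gtnNdvd.
rewrite (bigD1 (Ordinal n0)) //= expr0 mulr1 big1 ?addr0 // => i /negPf ->.
by rewrite mul0r.
Qed.

(** Pairing a root of unity with its inverse produces 2 - z - 1/z, which is 4 sin^2 and supplies the
    decay in 1/j^2 that single terms lack. *)
Lemma cayley_pair z x : z != 0 -> z * x != 1 -> z^-1 * x != 1 ->
  cayley (z * x) + cayley (z^-1 * x) =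
    2 * (1 + x) * (1 - x) / ((1 - x) ^+ 2 + x * (2 - z - z^-1)).
Proof.
move=> z0 h1 h2.
have d1 : 1 - z * x != 0 by rewrite subr_eq0 eq_sym.
have d2 : z - x != 0.
  by rewrite subr_eq0; apply: contraNneq h2 => <-; rewrite mulVf.
have -> : (1 - x) ^+ 2 + x * (2 - z - z^-1) = (1 - z * x) * (z - x) / z.
  by field.
by rewrite /cayley; field; rewrite z0 d1 d2.
Qed.

Lemma ex_eq1N w j : ex w != 1 -> w + j%:R != 0 /\ w - j%:R != 0.
Proof.
move=> h; split; apply: contraNneq h => h.
  by rewrite (_ : w = - j%:R) ?exN ?(ex_int _ j%:Z) ?invr1 //; apply/eqP; rewrite -addr_eq0 h.
by rewrite (_ : w = j%:R) ?(ex_int _ j%:Z) //; apply/eqP; rewrite -subr_eq0 h.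
Qed.

Lemma two_pi_i_neq0 : two_pi_i R != 0.
Proof. by rewrite eq_complex /= eqxx /= mulf_neq0 ?gt_eqF ?pi_gt0. Qed.

(** The order n = 2J + 1 is odd so that the nonzero residues are exactly j and -j for 1 <= j <=
    J. *)
Lemma cayley_fin w J : ex w != 1 -> let n := J.*2.+1 in let x := ex (w / n%:R) in
  n%:R * cayley (ex w) = cayley x +
   \sum_(1 <= j < J.+1) (cayley (ex (j%:R / n%:R) * x) + cayley ((ex (j%:R / n%:R))^-1 * x)).
Proof.
move=> h n x; have n0 : (n%:R : R[i]) != 0 by rewrite pnatr_eq0.
have xn : x ^+ n = ex w by rewrite -exMn mulrC mulfVK.
rewrite -xn -(cayley_split (ex_prim R (ltn0Sn _))) ?xn //.
rewrite -(big_mkord xpredT (fun j => cayley (ex n%:R^-1 ^+ j * x))) big_nat_recl //=.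
rewrite expr0 mul1r; congr (_ + _).
rewrite (@big_cat_nat _ _ _ J) //=; last by rewrite -addnn leq_addr.
rewrite big_split /= !big_add1 /=; congr (_ + _).
  by apply: eq_bigr => j _; rewrite exMn.
rewrite big_nat_rev /= -{1}(add0n J) big_addn -addnn addnK.
rewrite big_nat_cond [RHS]big_nat_cond; apply: eq_bigr => j /andP[/andP[_ jJ] _].
congr (cayley (_ * x)); rewrite -exMn -exN.
have -> : (J + (J + J) - (j + J).+1).+1 = (n - j.+1)%N.
  by rewrite /n -addnn; lia.
rewrite natrB ?mulrBl ?divff //; last by rewrite /n -addnn; lia.
by rewrite exD ex1 mul1r.
Qed.

(** The finite identity [cayley_fin], divided by n, tends term by term to the partial fractions as n
    = 2J + 1 grows, and [tannery] permits the limit under the sum. *)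
Lemma cot_partial_fractions w : ex w != 1 ->
  tends (fun J => w^-1 + \sum_(1 <= j < J.+1) ((w + j%:R)^-1 + (w - j%:R)^-1))
    (- (two_pi_i R / 2) * cayley (ex w)).
Proof.
move=> w1; set tau := two_pi_i R.
have tau0 : tau != 0 := two_pi_i_neq0.
have w0 : w != 0 by have [] := ex_eq1N 0 w1; rewrite addr0.
pose n J := J.*2.+1; pose x J := ex (w / (n J)%:R).
(* Numerators and denominators are scaled by powers of n so that each has a limit: [A] that of n (1
   - x), and [s] that of n^2 (2 - z - 1/z). Then [t] is a paired term divided by n. *)
pose A J := (n J)%:R * (1 - x J).
pose z J j : R[i] := ex (j%:R / (n J)%:R).
pose s J j := (n J)%:R ^+ 2 * (2 - z J j - (z J j)^-1).
pose t J j := 2 * (1 + x J) * A J / (A J ^+ 2 + x J * s J j).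
pose L j := 4 * (- (tau * w)) / ((tau * w) ^+ 2 - (tau * j%:R) ^+ 2).
have le2 J : (J <= J.*2)%N by rewrite -addnn leq_addr.
have nJ0 J : ((n J)%:R : R[i]) != 0 by rewrite pnatr_eq0.
have xn J : x J ^+ n J = ex w by rewrite -exMn mulrC mulfVK.
have zn J j : z J j ^+ n J = 1 by rewrite -exMn mulrC mulfVK ?(ex_int _ j%:Z).
have z0 J j : z J j != 0 := ex_neq0 _.
have zx J j : z J j * x J != 1.
  have e : (z J j * x J) ^+ n J = ex w by rewrite exprMn zn mul1r xn.
  by apply: contraNneq w1 => h; rewrite -e h expr1n.
have zVx J j : (z J j)^-1 * x J != 1.
  have e : ((z J j)^-1 * x J) ^+ n J = ex w by rewrite exprMn exprVn zn invr1 mul1r xn.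
  by apply: contraNneq w1 => h; rewrite -e h expr1n.
have hx : tends x 1.
  exact: (tends_comp (ex_cvg1 w) le2).
have hA : tends A (- (tau * w)).
  have := tends_comp (tendsMl (-1) (ex_derive0 w)) le2; rewrite mulN1r; congr (tends _ _).
  by apply/funext => J; rewrite /A /x /n; ring.
have hz j : tends (fun J => z J j) 1.
  exact: (tends_comp (ex_cvg1 (j%:R : R[i])) le2).
(* From 2 - z - 1/z = -(z - 1)^2 / z, with n (z - 1) tending to 2 pi i j and z to 1. *)
have hs j : tends (fun J => s J j) (- (tau * j%:R) ^+ 2).
  have h1 := tends_comp (ex_derive0 (j%:R : R[i])) le2.
  have := tendsMl (-1) (tendsM (tendsM h1 h1) (tendsV (oner_neq0 _) (hz j))).
  rewrite invr1 mulr1 mulN1r -expr2; congr (tends _ _).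
  apply/funext => J; rewrite /s -[J.*2.+1]/(n J) -[ex _]/(z J j).
  by have := z0 J j => zz; field.
have D0 j : (tau * w) ^+ 2 - (tau * j%:R) ^+ 2 != 0.
  rewrite !exprMn -mulrBr mulf_neq0 ?expf_neq0 // subr_sqr.
  by have [h1 h2] := ex_eq1N j w1; rewrite mulf_neq0.
have ht j : tends (fun J => t J j) (L j).
  have hD : tends (fun J => A J ^+ 2 + x J * s J j) ((tau * w) ^+ 2 - (tau * j%:R) ^+ 2).
    have := tendsD (tendsM hA hA) (tendsM hx (hs j)).
    by rewrite mulrNN mul1r -expr2.
  have := tendsM (tendsM (tendsMl 2 (tendsD (tends_cst 1) hx)) hA) (tendsV (D0 j) hD).
  have -> : 2 * (1 + 1) = 4 :> R[i] by ring.
  exact.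
(* Eventually |A| <= a, |1 + x| <= 3 and |x| >= 1/2, while |s| >= 4 j^2 by [sin_ge_half]. For j > a
   the product x s, of size at least 2 j^2, dominates A^2 <= j^2, which leaves a denominator of size
   at least j^2 and the constant 6 a. *)
pose a := nm (tau * w) + 1.
have a0 : 0 < a by rewrite ltr_pwDr ?nm_ge0.
have hbound : \forall J \near \oo, forall j,
    (Num.bound a <= j <= J)%N -> nm (t J j) <= (6 * a) * j%:R ^- 2.
  near=> J => j /andP[aj jJ].
  have ja : a < j%:R.
    by apply: lt_le_trans (archi_boundP (ltW a0)) _; rewrite ler_nat.
  have hAJ : nm (A J) <= a.
    have : nm (A J - - (tau * w)) < 1 by near: J; apply: (proj1 (tendsP _ _) hA).
    have := nm_leB (A J) (- (tau * w)); rewrite nmN /a; lra.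
  have hx1 : nm (x J - 1) < 1 / 2.
    by near: J; apply: (proj1 (tendsP _ _) hx); rewrite divr_gt0.
  have hx2 : 1 / 2 <= nm (x J).
    have := nm_leB 1 (x J); rewrite nmB nm1; lra.
  have hx3 : nm (1 + x J) <= 3.
    have := nmD 2 (x J - 1); rewrite nm_nat.
    have -> : 2 + (x J - 1) = 1 + x J by ring.
    lra.
  have nR0 : 0 < (n J)%:R :> R by rewrite ltr0n.
  have sE : s J j = (4 * (n J)%:R ^+ 2 * sin (pi * (j%:R / (n J)%:R)) ^+ 2)%:C%C.
    rewrite /s /z -exN.
    have -> : (j%:R / (n J)%:R : R[i]) = (j%:R / (n J)%:R : R)%:C%C.
      by rewrite rmorphM fmorphV !rmorph_nat.
    rewrite -rmorphN !ex_realE !mulrN cosN sinN -mulrA mulr_natl cos_mulr2n cos2sin2.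
    rewrite -(rmorph_nat (real_complex R)) -rmorphXn -[2](rmorph_nat (real_complex R)).
    by apply/eqP; rewrite eq_complex /=; apply/andP; split; apply/eqP; ring.
  have hs1 : 4 * j%:R ^+ 2 <= nm (s J j).
    rewrite sE nm_real (ger0_norm (mulr_ge0 (mulr_ge0 _ _) _)) ?sqr_ge0 //.
    have hy : pi * (j%:R / (n J)%:R) / 2 <= sin (pi * (j%:R / (n J)%:R)) :> R.
      apply: sin_ge_half; first by rewrite mulr_ge0 ?pi_ge0 ?divr_ge0.
      rewrite ler_wpM2l ?pi_ge0 // ler_pdivrMr //.
      have : (j%:R <= J%:R :> R) by rewrite ler_nat.
      have -> : (n J)%:R = J%:R * 2 + 1 :> R by rewrite /n -natr1 -muln2 natrM.
      lra.
    have hy2 : j%:R / (n J)%:R <= sin (pi * (j%:R / (n J)%:R)) :> R.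
      apply: le_trans hy; rewrite mulrAC ler_peMl ?divr_ge0 //.
      by have := pi_ge2 R; lra.
    have -> : 4 * j%:R ^+ 2 = 4 * (n J)%:R ^+ 2 * (j%:R / (n J)%:R) ^+ 2 :> R.
      by field; rewrite gt_eqF.
    by rewrite ler_wpM2l ?mulr_ge0 ?sqr_ge0 // ler_pXn2r ?nnegrE ?divr_ge0 // (le_trans _ hy2) ?divr_ge0.
  have hD : j%:R ^+ 2 <= nm (A J ^+ 2 + x J * s J j).
    have h1 := nm_leB (x J * s J j) (- A J ^+ 2); rewrite nmN nmM nmX opprK in h1.
    rewrite addrC; apply: le_trans h1.
    have h2 : nm (A J) ^+ 2 <= j%:R ^+ 2.
      rewrite ler_pXn2r ?nnegrE ?nm_ge0 //; apply: le_trans hAJ (ltW ja).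
    have h3 : 1 / 2 * (4 * j%:R ^+ 2) <= nm (x J) * nm (s J j).
      by rewrite ler_pM ?mulr_ge0 ?sqr_ge0.
    lra.
  rewrite /t nmM nmV (nmM _ (A J)) (nmM 2) nm_nat.
  have j0 : 0 < (j%:R : R) by apply: lt_trans ja.
  rewrite ler_pM ?mulr_ge0 ?nm_ge0 ?invr_ge0 ?nm_ge0 //.
    have : nm (1 + x J) * nm (A J) <= 3 * a by rewrite ler_pM ?nm_ge0.
    lra.
  by rewrite lef_pV2 ?posrE ?exprn_gt0 // (lt_le_trans _ hD) ?exprn_gt0.
have hT := tannery ht hbound.
have h0 : tends (fun J => (1 + x J) / A J) (2 / - (tau * w)).
  have Aw : - (tau * w) != 0 by rewrite oppr_eq0 mulf_neq0.
  by have := tendsM (tendsD (tends_cst 1) hx) (tendsV Aw hA).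
have ccw J : cayley (ex w) = (1 + x J) / A J + \sum_(1 <= j < J.+1) t J j.
  apply: (mulfI (nJ0 J)); rewrite cayley_fin // mulrDr mulr_sumr; congr (_ + _).
    rewrite /cayley /A -/(x J); field.
    by rewrite nJ0 andbT subr_eq0 eq_sym; have := zx J 0%N; rewrite /z mul0r ex0 mul1r.
  apply: eq_bigr => j _; rewrite -/(z J j) -/(x J) cayley_pair // /t /A /s.
  set D := (1 - x J) ^+ 2 + _.
  have -> : ((n J)%:R * (1 - x J)) ^+ 2 +
    x J * ((n J)%:R ^+ 2 * (2 - z J j - (z J j)^-1)) = (n J)%:R ^+ 2 * D.
    by rewrite /D; ring.
  have [->|Dn] := eqVneq D 0; first by rewrite !mulr0 !invr0 !mulr0.
  clearbody D; have nn := nJ0 J; field; by rewrite ?nn ?Dn.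
have := tendsB (tends_cst (- (tau / 2) * cayley (ex w)))
   (tendsMl (- (tau / 2)) (tendsD (tendsB h0 (tends_cst (2 / - (tau * w)))) hT)).
rewrite subrr addr0 mulr0 subr0; congr (tends _ _); apply/funext => J.
rewrite {1}(ccw J) -mulrBr sumrB.
have -> : (1 + x J) / A J + \sum_(1 <= j < J.+1) t J j -
   ((1 + x J) / A J - 2 / - (tau * w) +
    (\sum_(1 <= j < J.+1) t J j - \sum_(1 <= j < J.+1) L j)) =
  2 / - (tau * w) + \sum_(1 <= j < J.+1) L j by ring.
rewrite mulrDr; congr (_ + _).
  by field; rewrite w0 tau0.
rewrite mulr_sumr; apply: eq_bigr => j _; rewrite /L.
have [h1 h2] := ex_eq1N j w1.
have := D0 j; rewrite !exprMn -mulrBr mulf_eq0 negb_or => /andP[_ h3].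
by field; rewrite h1 h2 h3 tau0.
Unshelve. all: by end_near. Qed.

End PartialFractions.

(** * Dirichlet characters and Gauss sums *)

Lemma big_ord_mul (V : nmodType) (q D : nat) (F : nat -> V) :
  \sum_(a < q * D) F a = \sum_(i < D) \sum_(r < q) F (r + q * i)%N.
Proof.
elim: D => [|D IH]; first by rewrite muln0 !big_ord0.
rewrite big_ord_recr /= -IH -!(big_mkord xpredT F) mulnS addnC.
rewrite (@big_cat_nat _ _ _ (q * D)) ?leq_addr //=; congr (_ + _).
rewrite -{1}(add0n (q * D)%N) big_addn addnC addnK big_mkord.
by apply: eq_bigr.
Qed.

Lemma sum_mod_bij (V : nmodType) (q : nat) (F : int -> V) (g : int -> int) :
  (forall m, F (m + q%:Z) = F m) ->
  (forall i j, (i < q)%N -> (j < q)%N -> (g i%:Z = g j%:Z %[mod q%:Z])%Z -> i = j) ->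
  \sum_(r < q) F (g r%:Z) = \sum_(r < q) F r%:Z.
Proof.
case: q => [|q] hF hg; first by rewrite !big_ord0.
have per (n : nat) m : F (m + n%:Z * q.+1%:Z) = F m.
  elim: n m => [|n IH] m; first by rewrite mul0r addr0.
  by rewrite intS mulrDl mul1r addrA IH hF.
have perz (n m : int) : F (m + n * q.+1%:Z) = F m.
  case: n => n; first exact: per.
  by rewrite NegzE mulNr -[in LHS](per n.+1) subrK.
have hmod m : F m = F (m %% q.+1)%Z by rewrite {1}(divz_eq m q.+1%:Z) addrC perz.
have gt0 : (q.+1%:Z != 0) by [].
have lt m : (`|(m %% q.+1)%Z|%N < q.+1)%N.
  by rewrite -ltz_nat gez0_abs ?modz_ge0 // ltz_mod.
pose h (r : 'I_q.+1) : 'I_q.+1 := Ordinal (lt (g r%:Z)).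
have h_inj : injective h.
  move=> i j /(congr1 val) /= e; apply/val_inj/hg; rewrite ?ltn_ord //.
  by rewrite -[LHS]gez0_abs ?modz_ge0 // e gez0_abs ?modz_ge0.
rewrite [RHS](reindex_inj h_inj) /=; apply: eq_bigr => r _.
by rewrite gez0_abs ?modz_ge0 // -hmod.
Qed.

Lemma modz_nat_exists (j : int) k : (0 < k)%N ->
  exists2 d : nat, (d < k)%N & (j %% k%:Z)%Z = d%:Z.
Proof.
move=> k0; have kn : k%:Z != 0 by rewrite eqz_nat -lt0n.
exists `|(j %% k%:Z)%Z|%N; last by rewrite gez0_abs ?modz_ge0.
by rewrite -ltz_nat gez0_abs ?modz_ge0 // ltz_mod.
Qed.

Section Characters.
Variable R : realType.
Implicit Types (q k : nat) (chi : int -> R[i]).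

Definition ek k (t : int) : R[i] := ex (t%:~R / k%:R).

Lemma ekD k s t : ek k (s + t) = ek k s * ek k t.
Proof. by rewrite /ek intrD mulrDl exD. Qed.

Lemma ek0 k : ek k 0 = 1.
Proof. by rewrite /ek mul0r ex0. Qed.

Lemma ekN k t : ek k (- t) = (ek k t)^-1.
Proof. by rewrite /ek intrN mulNr exN. Qed.

Lemma ekM k (n : nat) t : ek k (t * n%:Z) = ek k t ^+ n.
Proof. by rewrite /ek -exMn intrM -[n%:~R]pmulrn mulrAC [in RHS]mulrC. Qed.

Lemma ek_mull k d (t : int) : (0 < d)%N -> ek (d * k)%N (d%:Z * t) = ek k t.
Proof.
move=> d0; rewrite /ek intrM natrM -pmulrn -mulf_div divff ?mul1r //.
by rewrite pnatr_eq0 -lt0n.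
Qed.

Lemma ek_mulk k t : (0 < k)%N -> ek k (t * k%:Z) = 1.
Proof.
by move=> k0; rewrite /ek intrM -pmulrn mulfK ?ex_int // pnatr_eq0 -lt0n.
Qed.

Lemma ek_mod k s t : (0 < k)%N -> (s = t %[mod k%:Z])%Z -> ek k s = ek k t.
Proof.
move=> k0 /eqP; rewrite eqz_mod_dvd => /dvdzP[c /eqP]; rewrite subr_eq => /eqP ->.
by rewrite ekD ek_mulk // mul1r.
Qed.

Lemma ek_eq1 k t : (0 < k)%N -> (ek k t == 1) = (k%:Z %| t)%Z.
Proof.
move=> k0; have kn : k%:Z != 0 by rewrite eqz_nat -lt0n.
apply/idP/idP => [|/dvdzP[c ->]]; last by rewrite ek_mulk.
have -> : ek k t = ek k `|(t %% k)%Z|%N.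
  by apply: ek_mod => //; rewrite gez0_abs ?modz_ge0 // modz_mod.
have lt : (`|(t %% k)%Z|%N < k)%N.
  by rewrite -ltz_nat gez0_abs ?modz_ge0 // ltz_mod.
case E : `|_|%N lt => [|m] lt h; first by apply/dvdz_mod0P/eqP; rewrite -absz_eq0 E.
have /negP[] : ek k m.+1 != 1; last exact: h.
rewrite /ek -pmulrn.
have -> : (m.+1%:R / k%:R : R[i]) = (m.+1%:R / k%:R : R)%:C%C.
  by rewrite rmorphM fmorphV !rmorph_nat.
apply: ex_real_neq1.
by rewrite divr_gt0 ?ltr0n //= ltr_pdivrMr ?ltr0n // mul1r ltr_nat.
Qed.

Lemma sum_ek k t : (0 < k)%N ->
  \sum_(j < k) ek k (t * j%:Z) = if (k%:Z %| t)%Z then k%:R else 0.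
Proof.
move=> k0; under eq_bigr do rewrite ekM.
rewrite sum_unity ?ek_eq1 // -ekM; apply/eqP; rewrite ek_eq1 //.
exact: dvdz_mull.
Qed.

Section Dirichlet.
Variables (q : nat) (chi : int -> R[i]).
Hypotheses (q1 : (1 < q)%N) (hchi : dirichlet_character q chi).

Let q0 : (0 < q)%N := ltnW q1.

Lemma chiM m n : chi (m * n) = chi m * chi n.
Proof. by case: hchi. Qed.

Lemma chi_period m : chi (m + q%:Z) = chi m.
Proof. by case: hchi. Qed.

Lemma chi_neq0 m : (chi m != 0) = coprimez m q%:Z.
Proof. by case: hchi. Qed.

Lemma chi_mod m n : (m = n %[mod q%:Z])%Z -> chi m = chi n.
Proof.
have per (i : nat) l : chi (l + i%:Z * q%:Z) = chi l.
  elim: i l => [|i IH] l; first by rewrite mul0r addr0.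
  by rewrite intS mulrDl mul1r addrA IH chi_period.
move=> /eqP; rewrite eqz_mod_dvd => /dvdzP[c /eqP]; rewrite subr_eq => /eqP ->.
rewrite addrC; case: c => i; first exact: per.
by rewrite NegzE mulNr -[in LHS](per i.+1) subrK.
Qed.

Lemma chi_modD m n : chi (m + q%:Z * n) = chi m.
Proof. apply: chi_mod; apply/eqP.
by rewrite eqz_mod_dvd addrAC subrr add0r dvdz_mulr. Qed.

Lemma chi_one : chi 1 = 1.
Proof.
have h : chi 1 != 0 by rewrite chi_neq0 /coprimez /gcdz absz1 gcd1n.
by apply: (mulfI h); rewrite -chiM !mulr1.
Qed.

Lemma chi_zero m : ~~ coprimez m q%:Z -> chi m = 0.
Proof. by rewrite -chi_neq0 negbK => /eqP. Qed.

Lemma chi_dvd m : (q%:Z %| m)%Z -> chi m = 0.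
Proof.
move=> /dvdzP[c ->]; apply: chi_zero.
by rewrite /coprimez /gcdz !abszM absz_nat gcdnC gcdnMl eqz_nat gtn_eqF.
Qed.

Lemma chiX m n : chi (m ^+ n) = chi m ^+ n.
Proof.
by elim: n => [|n IH]; rewrite ?expr0 ?chi_one // !exprS chiM IH.
Qed.

Lemma chi_totient m : coprimez m q%:Z -> chi m ^+ totient q = 1.
Proof.
move=> cm; have qn : q%:Z != 0 by rewrite eqz_nat -lt0n.
have -> : chi m = chi `|(m %% q)%Z|%N.
  by apply: chi_mod; rewrite gez0_abs ?modz_ge0 // modz_mod.
set a := `|(m %% q)%Z|%N.
have ca : coprime a q.
  move: cm; rewrite /coprimez -gcdz_modl /gcdz absz_nat eqz_nat.
  by rewrite /coprime.
rewrite -chiX -[1]chi_one; apply: chi_mod.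
have := cyclic.Euler_exp_totient ca.
by rewrite -natz -rmorphXn /= !natz !modz_nat => ->.
Qed.

Lemma nm_chi m : coprimez m q%:Z -> nm (chi m) = 1.
Proof.
move=> /chi_totient h; apply/eqP.
rewrite -(@pexpr_eq1 _ _ (totient q)) ?nm_ge0 ?totient_gt0 //.
by rewrite -nmX h nm1.
Qed.

Lemma nm_chi_le m : nm (chi m) <= 1.
Proof.
case: (boolP (coprimez m q%:Z)) => h; first by rewrite nm_chi.
by rewrite chi_zero // nm0.
Qed.

Lemma conj_chi m : (chi m)^* = (chi m)^-1.
Proof.
case: (boolP (coprimez m q%:Z)) => h; last by rewrite chi_zero // conjC0 invr0.
by rewrite invC_norm -nmE nm_chi // expr1n invr1 mul1r.
Qed.

Lemma dirichlet_conj : dirichlet_character q (fun m => (chi m)^*).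
Proof.
split=> [m n|m|m]; first by rewrite chiM rmorphM.
  by rewrite chi_period.
by rewrite conjC_eq0 chi_neq0.
Qed.

Lemma chiN1_sqr : chi (-1) ^+ 2 = 1.
Proof. by rewrite -chiX sqrrN expr1n chi_one. Qed.

Lemma chiN m : chi (- m) = chi (-1) * chi m.
Proof. by rewrite -chiM mulN1r. Qed.

Lemma conj_chiN1 : (chi (-1))^* = chi (-1).
Proof.
have n0 : chi (-1) != 0 by rewrite chi_neq0 /coprimez /gcdz abszN absz1 gcd1n.
by rewrite conj_chi; apply: (mulfI n0); rewrite divff // -expr2 chiN1_sqr.
Qed.

Lemma unit_mod_inj (s : int) : coprimez s q%:Z -> forall i j, (i < q)%N ->
  (j < q)%N -> (s * i%:Z = s * j%:Z %[mod q%:Z])%Z -> i = j.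
Proof.
move=> cs i j iq jq /eqP; rewrite eqz_mod_dvd -mulrBr Gauss_dvdzr.
  by rewrite -eqz_mod_dvd !modz_nat eqz_nat !modn_small // => /eqP.
by rewrite coprimez_sym.
Qed.

End Dirichlet.

Section Primitive.
Variables (q : nat) (chi : int -> R[i]).
Hypotheses (q1 : (1 < q)%N) (pchi : primitive_character q chi).

Let q0 : (0 < q)%N := ltnW q1.
Let hchi : dirichlet_character q chi := proj1 pchi.

Lemma primitive_conj : primitive_character q (fun m => (chi m)^*).
Proof.
split; first exact: dirichlet_conj.
move=> d dq ltd h; apply: (proj2 pchi d dq ltd) => m cm hm.
by apply: (can_inj conjCK); rewrite conjC1 h.
Qed.

Lemma primitive_witness d : (d %| q)%N -> (d < q)%N ->
  exists m : int, [/\ coprimez m q%:Z, (m = 1 %[mod d%:Z])%Z & chi m != 1].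
Proof.
move=> dq ltd; apply: contra_notP (proj2 pchi d dq ltd) => h m cm hm.
by apply/eqP; apply: contra_notT h => h; exists m.
Qed.

Lemma sum_chi : \sum_(r < q) chi r%:Z = 0.
Proof.
have [m [cm _ hm]] := primitive_witness (dvd1n q) q1.
apply/eqP; have : (1 - chi m) * \sum_(r < q) chi r%:Z = 0.
  rewrite mulrBl mul1r mulr_sumr; apply/eqP; rewrite subr_eq0; apply/eqP.
  rewrite -(@sum_mod_bij _ q chi (fun r => m * r)); last exact: unit_mod_inj.
    by apply: eq_bigr => r _; rewrite (chiM hchi).
  exact: chi_period hchi.
by move/eqP; rewrite mulf_eq0 subr_eq0 eq_sym (negPf hm).
Qed.

Lemma gauss_sumE : gauss_sum q chi = \sum_(r < q) chi r%:Z * ek q r%:Z.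
Proof. by apply: eq_bigr => r _; rewrite /ek -pmulrn. Qed.

(** For s prime to q, substitute s r for r. Otherwise let g = gcd(s, q) > 1: primitivity provides m
    = 1 mod q/g with chi(m) different from 1. Replacing r by m r fixes e(s r / q) and multiplies the
    sum by chi(m), so the sum is 0. *)
Lemma gauss_sum_twist (s : int) :
  \sum_(r < q) chi r%:Z * ek q (s * r%:Z) = (chi s)^* * gauss_sum q chi.
Proof.
rewrite (conj_chi q1 hchi) gauss_sumE; set S := \sum_(r < q) _.
have per t m : chi (m + q%:Z) * ek q (t * (m + q%:Z)) = chi m * ek q (t * m).
  by rewrite (chi_period hchi) mulrDr ekD ek_mulk // mulr1.
case: (boolP (coprimez s q%:Z)) => cs.
  have c0 : chi s != 0 by rewrite (chi_neq0 hchi).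
  apply: (mulfI c0); rewrite mulVKf //.
  have := @sum_mod_bij _ q (fun m => chi m * ek q (1 * m)) (fun r => s * r) (per 1)
    (unit_mod_inj cs).
  under [in RHS]eq_bigr do rewrite mul1r.
  move <-; rewrite mulr_sumr; apply: eq_bigr => r _.
  by rewrite mul1r (chiM hchi) mulrA.
rewrite (chi_zero hchi) // invr0 mul0r.
pose g := gcdn `|s| q.
have g0 : (0 < g)%N by rewrite gcdn_gt0 q0 orbT.
have gq : (g %| q)%N := dvdn_gcdr _ _.
have g1 : (1 < g)%N.
  by rewrite ltn_neqAle g0 andbT eq_sym; move: cs; rewrite /coprimez /gcdz absz_nat eqz_nat.
have [m [cm hm hm1]] : exists m : int,
    [/\ coprimez m q%:Z, (m = 1 %[mod (q %/ g)%N%:Z])%Z & chi m != 1].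
  by apply: primitive_witness; [exact: dvdn_div|exact: ltn_Pdiv].
apply/eqP; have : (1 - chi m) * S = 0.
  rewrite mulrBl mul1r mulr_sumr; apply/eqP; rewrite subr_eq0; apply/eqP.
  rewrite {1}/S -(@sum_mod_bij _ q (fun t => chi t * ek q (s * t)) (fun r => m * r) (per s)
     (unit_mod_inj cm)).
  apply: eq_bigr => r _; rewrite (chiM hchi).
  suff e : ek q (s * (m * r%:Z)) = ek q (s * r%:Z) by rewrite e [RHS]mulrA.
  apply: ek_mod => //; apply/eqP; rewrite eqz_mod_dvd.
  have -> : s * (m * r%:Z) - s * r%:Z = (s * (m - 1)) * r%:Z by ring.
  apply: dvdz_mulr; rewrite -(divnK gq) mulnC PoszM.
  apply: dvdz_mul; first by rewrite dvdzE absz_nat dvdn_gcdl.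
  by rewrite -eqz_mod_dvd; apply/eqP.
by move/eqP; rewrite mulf_eq0 subr_eq0 eq_sym (negPf hm1).
Qed.

(** Writing a = r + q i separates a geometric sum over i mod D, which vanishes unless D divides t,
    from a twisted Gauss sum modulo q. *)
Lemma gauss_sum_induced (D : nat) (t : int) : (0 < D)%N ->
  \sum_(a < q * D) chi a%:Z * ek (q * D) (t * a%:Z) =
  if (D%:Z %| t)%Z then D%:R * ((chi (t %/ D%:Z)%Z)^* * gauss_sum q chi) else 0.
Proof.
move=> D0; rewrite (big_ord_mul _ _ (fun a => chi a%:Z * ek (q * D) (t * a%:Z))).
have -> : \sum_(i < D) \sum_(r < q) chi (r + q * i)%N * ek (q * D) (t * (r + q * i)%N) =
   (\sum_(i < D) ek D (t * i%:Z)) * \sum_(r < q) chi r%:Z * ek (q * D) (t * r%:Z).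
  rewrite mulr_suml; apply: eq_bigr => i _; rewrite mulr_sumr; apply: eq_bigr => r _.
  rewrite PoszD PoszM (chi_modD hchi) mulrDr ekD.
  by rewrite (_ : t * (q%:Z * i%:Z) = q%:Z * (t * i%:Z)) ?ek_mull //; ring.
rewrite sum_ek //; case: ifP => [/dvdzP[s ->]|_]; last by rewrite mul0r.
rewrite mulzK ?eqz_nat -?lt0n //; congr (_ * _); rewrite -gauss_sum_twist.
apply: eq_bigr => r _; congr (_ * _).
have -> : s * D%:Z * r%:Z = D%:Z * (s * r%:Z) by ring.
by rewrite mulnC ek_mull.
Qed.

(** [gauss_sum_twist] absorbs the conjugate character into the second Gauss sum; orthogonality in n
    then keeps only a = -1, that is a = q - 1. *)
Lemma gauss_sum_mul :
  gauss_sum q (fun m => (chi m)^*) * gauss_sum q chi = chi (-1) * q%:R.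
Proof.
have -> : gauss_sum q (fun m => (chi m)^*) * gauss_sum q chi =
   \sum_(n < q) \sum_(a < q) chi a%:Z * ek q ((1 + a%:Z) * n%:Z).
  rewrite {1}/gauss_sum mulr_suml; apply: eq_bigr => n _.
  rewrite mulrAC -gauss_sum_twist mulr_suml; apply: eq_bigr => a _.
  rewrite -mulrA; congr (_ * _).
  have -> : cexp (two_pi_i R * (n%:R / q%:R)) = ek q n%:Z by rewrite /ek -pmulrn.
  by rewrite -ekD; congr ek; ring.
rewrite exchange_big /=.
have h : (q.-1 < q)%N by rewrite ltn_predL.
have hq : q.-1%:Z = -1 + q%:Z by rewrite -{2}(prednK q0) intS addrA addNr add0r.
rewrite (bigD1 (Ordinal h)) //= -mulr_sumr sum_ek // hq addrA subrr add0r dvdzz.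
rewrite (chi_period hchi) big1 ?addr0 // => a ne; rewrite -mulr_sumr sum_ek //.
case: ifP; last by rewrite mulr0.
rewrite dvdzE absz_nat -intS absz_nat => /dvdn_leq => /(_ isT) h1.
have := ltn_ord a; rewrite -(leq_add2r 0) addn0 => h2.
case/negP: ne; apply/eqP/val_inj => /=; apply/eqP; rewrite eqn_leq; lia.
Qed.

Lemma gauss_sum_neq0 : gauss_sum q chi != 0.
Proof.
have := gauss_sum_mul; apply: contra_eqN => /eqP ->; rewrite mulr0 eq_sym mulf_neq0 //.
  by rewrite (chi_neq0 hchi) /coprimez /gcdz abszN absz1 gcd1n.
by rewrite pnatr_eq0 -lt0n.
Qed.

End Primitive.
End Characters.

(** * Sums over windows of consecutive integers *)

Section IntegerRanges.
Variable V : nmodType.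
Implicit Types (m : int) (L : nat) (F : int -> V).

Definition isum m L F : V := \sum_(i < L) F (m + i%:Z).

Lemma isum_cat m L1 L2 F :
  isum m (L1 + L2) F = isum m L1 F + isum (m + L1%:Z) L2 F.
Proof.
rewrite /isum big_split_ord /=; congr (_ + _).
by apply: eq_bigr => i _; rewrite PoszD addrA.
Qed.

Lemma eq_isum m L F G : F =1 G -> isum m L F = isum m L G.
Proof. by move=> h; apply: eq_bigr => i _; rewrite h. Qed.

(** The window from -kM to kM + k - 1 is exactly the set of r + k m with 0 <= r < k and |m| <= M.
    This accounts for the slightly lopsided windows of length k (2M + 1) used throughout: each
    residue class receives a symmetric sum. *)
Lemma isum_residues k M F :
  isum (- (k * M)%N%:Z) (k * M.*2.+1) F =
  \sum_(r < k) isum (- M%:Z) M.*2.+1 (fun m => F (r%:Z + k%:Z * m)).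
Proof.
rewrite /isum (big_ord_mul _ _ (fun i => F (- (k * M)%N%:Z + i%:Z))) exchange_big /=.
apply: eq_bigr => r _; apply: eq_bigr => m _; congr F.
by rewrite PoszD !PoszM; ring.
Qed.

Lemma isum_sym M F :
  isum (- M%:Z) M.*2.+1 F = F 0 + \sum_(1 <= j < M.+1) (F j%:Z + F (- j%:Z)).
Proof.
rewrite /isum -(big_mkord xpredT (fun i => F (- M%:Z + i%:Z))).
rewrite (@big_cat_nat _ _ _ M) //=; last by rewrite ltnW // ltnS -addnn leq_addr.
have -> : \sum_(M <= i < M.*2.+1) F (- M%:Z + i%:Z) = \sum_(0 <= i < M.+1) F i%:Z.
  rewrite -{1}(add0n M) big_addn subSn -addnn ?leq_addr // addnK.
  by apply: eq_bigr => i _; congr F; rewrite PoszD; ring.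
rewrite [X in _ + X = _]big_nat_recl //=.
rewrite addrCA; congr (_ + _).
rewrite big_split /= addrC !big_add1 /=; congr (_ + _).
rewrite big_nat_rev /= big_nat_cond [RHS]big_nat_cond.
apply: eq_bigr => i /andP[/andP[_ iM] _]; congr F.
by rewrite add0n -subzn //; ring.
Qed.

End IntegerRanges.

(** * Limits over symmetric windows and summation by parts *)

Section Analysis.
Variable R : realType.
Implicit Types w z : R[i].

(** The case w = 0 rests on the convention 1/0 = 0: the term m = 0 disappears, the others cancel in
    pairs, and [cayley 1] is 2/0 = 0. It covers the residue class 0 in the double sum of
    cotangents. *)
Lemma cayley_lim w : ex w != 1 \/ w = 0 ->
  tends (fun M => isum (- M%:Z) M.*2.+1 (fun m => (w + m%:~R)^-1))
    (- (two_pi_i R / 2) * cayley (ex w)).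
Proof.
have E v M : isum (- M%:Z) M.*2.+1 (fun m => (v + m%:~R)^-1) =
    v^-1 + \sum_(1 <= j < M.+1) ((v + j%:R)^-1 + (v - j%:R)^-1).
  by rewrite isum_sym addr0; congr (_ + _); apply: eq_bigr => j _; rewrite mulrNz -pmulrn.
case=> [h|->].
  by under eq_fun do rewrite E; apply: cot_partial_fractions.
rewrite /cayley ex0 subrr invr0 !mulr0.
rewrite (_ : (fun M => _) = fun=> 0); first exact: tends_cst.
apply/funext => M; rewrite E invr0 add0r big1 // => j _.
by rewrite add0r sub0r invrN subrr.
Qed.

Lemma periodic_lim k (G : int -> R[i]) w : (0 < k)%N ->
  (forall m n, G (m + k%:Z * n) = G m) ->
  (forall r, (r < k)%N -> ex (w + r%:R / k%:R) != 1 \/ w + r%:R / k%:R = 0) ->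
  tends (fun M => isum (- (k * M)%N%:Z) (k * M.*2.+1) (fun n => G n / (k%:R * w + n%:~R)))
    (k%:R^-1 * \sum_(r < k) G r%:Z * (- (two_pi_i R / 2) * cayley (ex (w + r%:R / k%:R)))).
Proof.
move=> k0 hG hw; have kn : (k%:R : R[i]) != 0 by rewrite pnatr_eq0 -lt0n.
rewrite mulr_sumr.
rewrite (_ : (fun M => _) = fun M => \sum_(r < k) k%:R^-1 * (G r%:Z *
   isum (- M%:Z) M.*2.+1 (fun m => (w + r%:R / k%:R + m%:~R)^-1))).
  by apply: tends_sum => r _; do 2 apply: tendsMl; apply: cayley_lim; apply: hw.
apply/funext => M; rewrite isum_residues; apply: eq_bigr => r _.
rewrite /isum !mulr_sumr; apply: eq_bigr => i _.
rewrite hG mulrCA -invfM; congr (_ * _^-1).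
by rewrite intrD intrM -!pmulrn (mulrDr _ (w + _)) mulrDr (mulrCA k%:R) divff // mulr1 addrA.
Qed.

(** Summation by parts. With t_i = t0 + k i, the increments of 1/y are at most d^-2 (1/t_i -
    1/t_(i+1)), because |y_(i+1) - y_i| <= 1 <= k, and they telescope. The bound does not depend on
    the length [L], so it controls infinite tails. *)
Lemma abel_tail (g y : nat -> R[i]) (Q d k t0 : R) L :
  (forall n, nm (\sum_(i < n) g i) <= Q) -> 0 < d -> 0 < t0 -> 1 <= k ->
  (forall i, d * (t0 + k * i%:R) <= nm (y i)) ->
  (forall i, nm (y i.+1 - y i) <= 1) ->
  nm (\sum_(i < L) g i / y i) <= Q * (d^-1 + d ^- 2) / t0.
Proof.
move=> hQ d0 t00 k1 hy hd.
have Q0 : 0 <= Q by apply: le_trans (hQ 0%N); rewrite nm_ge0.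
have k0 : 0 < k by apply: lt_le_trans k1.
pose t i := t0 + k * i%:R.
have tt i : t0 <= t i by rewrite lerDl mulr_ge0 // ltW.
have tp i : 0 < t i by apply: lt_le_trans (tt i).
have yp i : 0 < nm (y i) by apply: lt_le_trans (hy i); rewrite mulr_gt0 // tp.
have yn i : y i != 0 by rewrite -nm_gt0.
have yV i : nm (y i)^-1 <= d^-1 / t i.
  by rewrite nmV -invfM lef_pV2 ?posrE ?hy ?mulr_gt0.
pose S n := \sum_(i < n) g i.
have E : \sum_(i < L) g i / y i =
    S L / y L + \sum_(i < L) S i.+1 * ((y i)^-1 - (y i.+1)^-1).
  elim: (L) => [|n IH]; first by rewrite /S !big_ord0 mul0r addr0.
  by rewrite !big_ord_recr /= IH /S big_ord_recr /=; ring.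
have D i : nm ((y i)^-1 - (y i.+1)^-1) <= d ^- 2 * ((t i)^-1 - (t i.+1)^-1).
  have -> : (y i)^-1 - (y i.+1)^-1 = (y i.+1 - y i) * ((y i)^-1 * (y i.+1)^-1).
    by field; rewrite !yn.
  have -> : d ^- 2 * ((t i)^-1 - (t i.+1)^-1) = k * ((d^-1 / t i) * (d^-1 / t i.+1)).
    have e : t i.+1 = t i + k by rewrite /t -natr1; ring.
    have h1 := lt0r_neq0 (tp i); have h2 := lt0r_neq0 (tp i.+1).
    have h3 := lt0r_neq0 d0; rewrite e in h2 *; move: (t i) h1 h2 => s h1 h2.
    by field; rewrite h1 h2 h3.
  by rewrite !nmM ler_pM ?mulr_ge0 ?nm_ge0 ?ler_pM ?nm_ge0 // (le_trans (hd i)).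
rewrite E; apply: le_trans (nmD _ _) _; rewrite mulrDr mulrDl lerD //.
  rewrite nmM -mulrA ler_pM ?nm_ge0 ?hQ //; apply: le_trans (yV L) _.
  by rewrite ler_pM2l ?invr_gt0 // lef_pV2 ?posrE.
apply: le_trans (nm_sum _ _ _) _.
apply: (@le_trans _ _ (\sum_(i < L) Q * (d ^- 2 * ((t i)^-1 - (t i.+1)^-1)))).
  by apply: ler_sum => i _; rewrite nmM ler_pM ?nm_ge0 // hQ.
rewrite -!mulr_sumr -mulrA ler_wpM2l // ler_wpM2l ?invr_ge0 ?sqr_ge0 //.
have -> : \sum_(i < L) ((t i)^-1 - (t i.+1)^-1) = (t 0%N)^-1 - (t L)^-1.
  elim: (L) => [|n IH]; first by rewrite big_ord0 subrr.
  by rewrite big_ord_recr /= IH; ring.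
by rewrite /t mulr0 addr0 gerBl invr_ge0 ltW // tp.
Qed.

Lemma geom_cvg (u : nat -> R[i]) (K r : R) : 0 <= r < 1 ->
  (forall n, nm (u n) <= K * r ^+ n) ->
  exists l, tends (fun n => \sum_(i < n) u i) l.
Proof.
move=> /andP[r0 r1] hu.
have aux (h : R[i] -> R) : (forall x, `|h x| <= nm x) ->
   cvgn (series (fun n => h (u n))).
  move=> hh; apply: normed_cvg.
  apply: (@series_le_cvg _ _ (fun n => K * r ^+ n)) => [n|n|n|].
  - exact: normr_ge0.
  - exact: le_trans (nm_ge0 _) (hu n).
  - exact: le_trans (hh _) (hu n).
  - by apply: is_cvg_geometric_series; rewrite ger0_norm.
have /cvg_ex[a ha] := aux (@complex.Re R) (@Re_le_nm R).
have /cvg_ex[b hb] := aux (@complex.Im R) (@Im_le_nm R).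
exists (a +i* b)%C; apply: tends_ReIm.
  apply: cvg_trans ha; apply: near_eq_cvg; near=> n.
  by rewrite /series /= big_mkord (raddf_sum (@complex.Re R : Rcomplex R -> R)).
apply: cvg_trans hb; apply: near_eq_cvg; near=> n.
by rewrite /series /= big_mkord (raddf_sum (@complex.Im R : Rcomplex R -> R)).
Unshelve. all: by end_near. Qed.

(** The inequality exp(x) >= x^3/6 at x = c n leaves a factor 1/n. *)
Lemma cvg_sqr_expR (c : R) : 0 < c ->
  (fun n : nat => n%:R ^+ 2 * expR (- c) ^+ n) @ \oo --> (0 : R).
Proof.
move=> c0.
apply: (squeeze_cvgr (f := fun=> 0) (h := fun n => 6 / c ^+ 3 * n%:R^-1)).
- near=> n; have n0 : 0 < n%:R :> R by rewrite ltr0n; near: n; exists 1%N.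
  rewrite mulr_ge0 ?sqr_ge0 ?exprn_ge0 ?expR_ge0 //=.
  rewrite -expRM_natr mulNr expRN.
  have cn : 0 < c * n%:R by rewrite mulr_gt0.
  have := expR_ge1Dxn 2 (ltW cn); rewrite -[3`!]/6%N => h.
  have h2 : (c * n%:R) ^+ 3 / 6 <= expR (c * n%:R) by lra.
  have h3 : 0 < (c * n%:R) ^+ 3 / 6 by rewrite divr_gt0 ?exprn_gt0.
  have h4 : (expR (c * n%:R))^-1 <= ((c * n%:R) ^+ 3 / 6)^-1.
    by rewrite lef_pV2 ?posrE ?expR_gt0.
  apply: (@le_trans _ _ (n%:R ^+ 2 * ((c * n%:R) ^+ 3 / 6)^-1)).
    by rewrite ler_wpM2l ?sqr_ge0.
  have cn0 := lt0r_neq0 c0; have nn0 := lt0r_neq0 n0.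
  rewrite le_eqVlt; apply/orP; left; apply/eqP; move: (n%:R) nn0 => x nn0.
  by field; rewrite cn0 nn0.
- exact: cvg_cst.
- rewrite -[0 in X in _ --> X](mulr0 (6 / c ^+ 3)); apply: cvgMr.
  rewrite -(cvg_shiftS (fun n : nat => n%:R^-1 : R)); exact: cvg_harmonic.
Unshelve. all: by end_near. Qed.

End Analysis.

(** * The series f as a sum of cotangent rows *)

Section EisensteinLimit.
Variable R : realType.
Variables (q1 q2 : nat) (chi1 chi2 : int -> R[i]).
Hypotheses (q1_gt1 : (1 < q1)%N) (q2_gt1 : (1 < q2)%N).
Hypotheses (p1 : primitive_character q1 chi1) (p2 : primitive_character q2 chi2).
Hypothesis parity : chi1 (-1) * chi2 (-1) = 1.
Implicit Types w z : R[i].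

Let h1 := proj1 p1.
Let h2 := proj1 p2.
Let q2_gt0 : (0 < q2)%N := ltnW q2_gt1.
Let q2n : (q2%:R : R[i]) != 0.
Proof. by rewrite pnatr_eq0 -lt0n. Qed.

Local Notation tau := (two_pi_i R).
Local Notation g2 := (gauss_sum q2 chi2).

(* The closed form of Sum_{n in Z} chi2(n) / (q2 w + n). *)
Definition twisted_cot w : R[i] :=
  - (tau / (2 * q2%:R)) * \sum_(r < q2) chi2 r%:Z * cayley (ex (w + r%:R / q2%:R)).

Lemma Im_addr w (r : nat) : complex.Im (w + r%:R / q2%:R) = complex.Im w.
Proof.
have -> : (r%:R / q2%:R : R[i]) = (r%:R / q2%:R : R)%:C%C.
  by rewrite rmorphM fmorphV !rmorph_nat.
by case: w => a b /=; rewrite addr0.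
Qed.

Lemma ex_neq1 w : complex.Im w != 0 -> ex w != 1.
Proof.
move=> h; case: (ltrP 0 (complex.Im w)) => h0; first exact: ex_upper_neq1.
have : 0 < complex.Im (- w) by case: (w) h h0 => a b /= h h0; rewrite oppr_gt0 lt_def eq_sym h.
move=> /ex_upper_neq1; rewrite exN; apply: contraNneq => ->.
by rewrite invr1.
Qed.

Lemma twisted_cot_lim w : complex.Im w != 0 ->
  tends (fun M => isum (- (q2 * M)%N%:Z) (q2 * M.*2.+1)
    (fun n => chi2 n / (q2%:R * w + n%:~R))) (twisted_cot w).
Proof.
move=> hw; have := @periodic_lim R q2 chi2 w q2_gt0 (chi_modD h2).
have -> : q2%:R^-1 * (\sum_(r < q2) chi2 r * (- (tau / 2) * cayley (ex (w + r%:R / q2%:R)))) = twisted_cot w.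
  rewrite /twisted_cot !mulr_sumr; apply: eq_bigr => r _.
  by rewrite mulrCA [RHS]mulrCA; congr (_ * _); rewrite mulrA; congr (_ * _); field.
by apply=> r _; left; apply: ex_neq1; rewrite Im_addr.
Qed.

Lemma cayley_inv (x : R[i]) : x != 0 -> x != 1 -> cayley x^-1 = - cayley x.
Proof.
move=> x0 x1; have d1 : 1 - x != 0 by rewrite subr_eq0 eq_sym.
have d2 : x - 1 != 0 by rewrite subr_eq0.
by rewrite /cayley; field; rewrite x0 d1 d2.
Qed.

Lemma twisted_cot_odd w : complex.Im w != 0 -> twisted_cot (- w) = - (chi2 (-1) * twisted_cot w).
Proof.
move=> hw; rewrite /twisted_cot; set c := - (tau / _).
rewrite (mulrCA _ c) -mulrN; congr (c * _).
pose F (r : int) := chi2 r * cayley (ex (- w + r%:~R / q2%:R)).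
have per m : F (m + q2%:Z) = F m.
  rewrite /F (chi_period h2) intrD mulrDl -pmulrn divff // addrA.
  by rewrite exD ex1 mulr1.
have inj (i j : nat) : (i < q2)%N -> (j < q2)%N ->
    (- i%:Z = - j%:Z %[mod q2%:Z])%Z -> i = j.
  move=> iq jq; rewrite -[- i%:Z]mulN1r -[- j%:Z]mulN1r; apply: unit_mod_inj iq jq.
  by rewrite /coprimez /gcdz abszN absz1 gcd1n.
transitivity (\sum_(r < q2) F r%:Z); first by apply: eq_bigr => r _; rewrite /F -pmulrn.
rewrite -(sum_mod_bij per inj) mulr_sumr -sumrN; apply: eq_bigr => r _.
rewrite /F (chiN h2) -mulrA -mulrN; congr (_ * _); rewrite -mulrN; congr (_ * _).
rewrite intrN mulNr -opprD exN -pmulrn cayley_inv ?ex_neq0 // ex_neq1 //.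
by rewrite Im_addr.
Qed.

Definition twisted_geom B w := \sum_(1 <= b < B.+1) (chi2 b%:Z)^* * ex (b%:R * w).

(** Lipschitz's formula with an error term. The Gauss sum turns conj chi2(b) into a combination of
    the e(b r / q2), so the sum over b is made of geometric series in x_r = e(w + r/q2). Their
    limits are x/(1 - x) = ([cayley x] - 1)/2, whose constant part drops out since chi2 has sum 0;
    the error is the geometric tail. *)
Lemma twisted_geom_bound B w : 0 < complex.Im w ->
  nm (twisted_geom B w - (- (q2%:R / (tau * g2))) * twisted_cot w) <=
    q2%:R / nm g2 * (nm (ex w) ^+ B.+1 / (1 - nm (ex w))).
Proof.
move=> hw; have g0 : g2 != 0 := gauss_sum_neq0 q2_gt1 p2.
have t0 := @two_pi_i_neq0 R.
pose x (r : nat) := ex (w + r%:R / q2%:R).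
have nx r : nm (x r) = nm (ex w) by rewrite !nm_ex Im_addr.
have rho1 : nm (ex w) < 1.
  by rewrite nm_ex expR_lt1 oppr_lt0 !mulr_gt0 ?pi_gt0.
have x1 r : x r != 1 by apply: ex_upper_neq1; rewrite Im_addr.
have d1 r : 1 - x r != 0 by rewrite subr_eq0 eq_sym.
have E1 : - (q2%:R / (tau * g2)) * twisted_cot w =
    g2^-1 * \sum_(r < q2) chi2 r%:Z * (x r / (1 - x r)).
  have -> : \sum_(r < q2) chi2 r%:Z * (x r / (1 - x r)) =
      2^-1 * \sum_(r < q2) chi2 r%:Z * cayley (x r).
    rewrite mulr_sumr.
    have -> : \sum_(r < q2) chi2 r * (x r / (1 - x r)) =
       \sum_(r < q2) (2^-1 * (chi2 r * cayley (x r)) - 2^-1 * chi2 r).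
      apply: eq_bigr => r _; have := d1 r; rewrite /cayley; move: (x r) => y hy.
      by field.
    by rewrite sumrB -[X in _ - X]mulr_sumr (sum_chi q2_gt1 p2) mulr0 subr0.
  rewrite /twisted_cot -/x; set S := \sum_(r < q2) _.
  by field; rewrite g0 t0 q2n.
have E2 : twisted_geom B w = g2^-1 * \sum_(r < q2) chi2 r%:Z * \sum_(1 <= b < B.+1) x r ^+ b.
  apply: (mulfI g0); rewrite mulVKf // /twisted_geom mulr_sumr.
  under [RHS]eq_bigr do rewrite mulr_sumr.
  rewrite exchange_big /=; apply: eq_bigr => b _.
  rewrite mulrA (mulrC g2) -(gauss_sum_twist q2_gt1 p2) mulr_suml; apply: eq_bigr => r _.
  rewrite -mulrA; congr (_ * _); rewrite -exMn mulrDr exD mulrC; congr (_ * _).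
  by rewrite /ek intrM -!pmulrn mulrA.
have E3 r : \sum_(1 <= b < B.+1) x r ^+ b - x r / (1 - x r) = - (x r ^+ B.+1 / (1 - x r)).
  have -> : \sum_(1 <= b < B.+1) x r ^+ b = (x r - x r ^+ B.+1) / (1 - x r).
    apply: (mulIf (d1 r)); rewrite mulfVK //.
    clear E2; elim: B => [|B IH]; first by rewrite big_geq // expr1 subrr mul0r.
    by rewrite big_nat_recr //= mulrDl IH [in RHS]exprS; ring.
  by rewrite mulrBl addrAC subrr sub0r.
rewrite E1 E2 -mulrBr -sumrB nmM nmV.
rewrite -mulrA [X in _ <= X]mulrC -mulrA ler_wpM2l ?invr_ge0 ?nm_ge0 //.
apply: le_trans (nm_sum _ _ _) _.
apply: (@le_trans _ _ (\sum_(r < q2) nm (ex w) ^+ B.+1 / (1 - nm (ex w)))).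
  apply: ler_sum => r _; rewrite -mulrBr E3 nmM nmN nmM nmV nmX nx.
  rewrite -[X in _ <= X]mul1r ler_pM ?mulr_ge0 ?nm_ge0 ?invr_ge0 ?exprn_ge0 ?nm_ge0 ?nm_chi_le //.
    exact: (nm_chi_le q2_gt1 h2).
  rewrite ler_wpM2l ?exprn_ge0 ?nm_ge0 // lef_pV2 ?posrE ?nm_gt0 // ?subr_gt0 //.
  by have := nm_leB 1 (x r); rewrite nm1 nx.
by rewrite sumr_const card_ord -[X in X <= _]mulr_natr.
Qed.

(** The factor in Lipschitz's formula: for Im w > 0, the sum over b >= 1 of conj chi2(b) e(b w) is
    this constant times the sum over n of chi2(n)/(q2 w + n). *)
Definition fourier_const : R[i] := - (q2%:R / (tau * g2)).

Definition eisenstein_rows z Y := \sum_(1 <= a < Y.+1) chi1 a%:Z / a%:R * (fourier_const * twisted_cot (a%:R * z)).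

Lemma nm_ex_mul z (a : nat) : nm (ex (a%:R * z)) = nm (ex z) ^+ a.
Proof. by rewrite exMn nmX. Qed.

Lemma Im_mul z (a : nat) : complex.Im (a%:R * z) = a%:R * complex.Im z.
Proof.
by rewrite -(rmorph_nat (real_complex R)); case: z => x y /=; rewrite mul0r addr0.
Qed.

(** This is [twisted_geom_bound] at B = 0: the finite sum is empty, so the error bound becomes a
    bound for the row itself. *)
Lemma eisenstein_row_bound z a : 0 < complex.Im z ->
  nm (chi1 a.+1%:Z / a.+1%:R * (fourier_const * twisted_cot (a.+1%:R * z))) <=
   (q2%:R / nm g2 * (nm (ex z) / (1 - nm (ex z)))) * nm (ex z) ^+ a.
Proof.
move=> hz; have rho0 := nm_ge0 (ex z).
have rho1 : nm (ex z) < 1.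
  by rewrite nm_ex expR_lt1 oppr_lt0 !mulr_gt0 ?pi_gt0.
have hI : 0 < complex.Im (a.+1%:R * z) by rewrite Im_mul mulr_gt0.
have := twisted_geom_bound 0 hI; rewrite /twisted_geom big_geq // sub0r nmN -/fourier_const expr1 => h.
rewrite nmM -[X in _ <= X]mul1r ler_pM ?nm_ge0 //.
  rewrite nmM nmV nm_nat -[X in _ <= X]mulr1 ler_pM ?nm_ge0 ?invr_ge0 //.
    exact: (nm_chi_le q1_gt1 h1).
  by rewrite invf_le1 ?ltr0n // ler1n.
apply: le_trans h _; rewrite nm_ex_mul -!mulrA ler_wpM2l // ler_wpM2l ?invr_ge0 ?nm_ge0 //.
rewrite exprS -mulrA ler_wpM2l // mulrC ler_wpM2r ?exprn_ge0 //.
rewrite lef_pV2 ?posrE ?subr_gt0 //; last by rewrite -exprS exprn_ilt1.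
by rewrite lerD2l lerN2 ler_piMr // exprn_ile1 // ltW.
Qed.

Lemma eisenstein_square (h : nat -> nat -> R[i]) Y :
  \sum_(1 <= n < Y.+1) \sum_(a <- divisors n) h a (n %/ a)%N =
  \sum_(1 <= a < Y.+1) \sum_(1 <= b < Y.+1) (if (a * b <= Y)%N then h a b else 0).
Proof.
transitivity (\sum_(1 <= n < Y.+1) \sum_(1 <= a < Y.+1) \sum_(1 <= b < Y.+1)
    (if n == (a * b)%N then h a b else 0)).
  apply: eq_big_nat => n /andP[n1 nY].
  have -> : \sum_(a <- divisors n) h a (n %/ a)%N =
      \sum_(1 <= a < Y.+1 | (a %| n)%N) h a (n %/ a)%N.
    rewrite -[RHS]big_filter; apply: perm_big; apply: uniq_perm.
    - exact: divisors_uniq.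
    - by rewrite filter_uniq // iota_uniq.
    - move=> a; rewrite mem_filter mem_index_iota -dvdn_divisors //.
      case: (boolP (a %| n)%N) => //= an; rewrite (dvdn_gt0 n1 an) /=.
      by rewrite (leq_trans _ nY) // ltnS dvdn_leq.
  rewrite big_mkcond; apply: eq_big_nat => a /andP[a1 aY].
  case: (boolP (a %| n)%N) => an; last first.
    apply/esym/big1 => b _; case: eqP => // e.
    by rewrite e dvdn_mulr in an.
  have nb : (n %/ a)%N \in index_iota 1 Y.+1.
    rewrite mem_index_iota divn_gt0 // dvdn_leq //= (leq_ltn_trans _ nY) //.
    exact: leq_div.
  rewrite (bigD1_seq _ nb) ?iota_uniq //= mulnC divnK // eqxx.
  rewrite big1 ?addr0 // => b nbb; case: eqP => // e.
  by case/eqP: nbb; rewrite e mulnC mulnK.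
rewrite exchange_big /=; apply: eq_big_nat => a /andP[a1 aY].
rewrite exchange_big /=; apply: eq_big_nat => b /andP[b1 bY].
case: leqP => ab.
  have nb : (a * b)%N \in index_iota 1 Y.+1 by rewrite mem_index_iota muln_gt0 a1 b1 ltnS.
  rewrite (bigD1_seq _ nb) ?iota_uniq //= eqxx big1 ?addr0 // => n nn.
  by rewrite (negPf nn).
rewrite big_seq big1 // => n; rewrite mem_index_iota => /andP[_ nY].
by case: eqP => // e; move: ab; rewrite -e ltnNge -ltnS nY.
Qed.

(** The definition of f orders the pairs (a, b) by the product ab, while the cotangent needs
    complete rows. Up to Y, the two sums differ by the tails b > Y of Y rows and by the pairs of the
    square with ab > Y; each tail is at most K rho^Y and each pair at most rho^Y, where rho = |e(z)|
    < 1, so the difference is O(Y^2 rho^Y). *)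
Lemma eisenstein_f_lim z : 0 < complex.Im z ->
  tends (eisenstein_rows z) (eisenstein_f chi1 chi2 z).
Proof.
move=> hz; set c : R := 2 * pi * complex.Im z.
have c0 : 0 < c by rewrite !mulr_gt0 ?pi_gt0.
have rhoE : nm (ex z) = expR (- c) by rewrite nm_ex.
have rho0 : 0 <= nm (ex z) := nm_ge0 _.
have rho1 : nm (ex z) < 1 by rewrite rhoE expR_lt1 oppr_lt0.
have [l hl] : exists l, tends (eisenstein_rows z) l.
  have r01 : 0 <= nm (ex z) < 1 by rewrite rho0.
  have [l hl] := @geom_cvg R _ _ _ r01 (fun a => eisenstein_row_bound a hz).
  exists l; move: hl; congr (tends _ _); apply/funext => Y.
  by rewrite /eisenstein_rows big_add1 /= big_mkord.
suff hf : tends (fun N => \sum_(1 <= n < N)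
    eisenstein_coef chi1 chi2 n * cexp (tau * n%:R * z)) l.
  have -> : eisenstein_f chi1 chi2 z = l; last exact: hl.
  rewrite /eisenstein_f; apply: (cvg_lim (@norm_hausdorff _ _)).
  exact: tends_cvg hf.
apply: (tends_shift (k := 1)); rewrite (_ : (fun n => _) = fun Y =>
  \sum_(1 <= n < Y.+1) eisenstein_coef chi1 chi2 n * cexp (tau * n%:R * z)); last first.
  by apply/funext => n; rewrite addn1.
apply: tends_sub0 hl _.
pose h a b : R[i] := chi1 a%:Z * (chi2 b%:Z)^* / a%:R * ex ((a * b)%N%:R * z).
have EF Y : \sum_(1 <= n < Y.+1) eisenstein_coef chi1 chi2 n * cexp (tau * n%:R * z) =
    \sum_(1 <= a < Y.+1) \sum_(1 <= b < Y.+1) (if (a * b <= Y)%N then h a b else 0).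
  rewrite -eisenstein_square; apply: eq_big_nat => n /andP[n1 nY].
  rewrite /eisenstein_coef mulr_suml big_seq [RHS]big_seq; apply: eq_bigr => a.
  rewrite -dvdn_divisors // => an; rewrite /h /ex mulnC divnK // mulrA //.
pose D Y := \sum_(1 <= a < Y.+1) (chi1 a%:Z / a%:R * (fourier_const * twisted_cot (a%:R * z)) -
   \sum_(1 <= b < Y.+1) (if (a * b <= Y)%N then h a b else 0)).
rewrite (_ : (fun n => _) = D); last by apply/funext => Y; rewrite EF /D sumrB.
pose K : R := q2%:R / nm g2 * (nm (ex z) / (1 - nm (ex z))).
apply: (@tends_le_near _ _ _ (fun Y => (K + 1) * (Y%:R ^+ 2 * expR (- c) ^+ Y))); last first.
  by rewrite -[0 in X in _ --> X](mulr0 (K + 1)); apply: cvgMr; apply: cvg_sqr_expR.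
near=> Y; have Y1 : (1 <= Y)%N by near: Y; exists 1%N.
rewrite subr0; apply: le_trans (nm_sum _ _ _) _.
have K0 : 0 <= K.
  by rewrite !mulr_ge0 ?invr_ge0 ?nm_ge0 // subr_ge0 ltW.
apply: (@le_trans _ _ (\sum_(1 <= a < Y.+1) (K + 1) * (Y%:R * nm (ex z) ^+ Y))); last first.
  rewrite sumr_const_nat subn1 /= -rhoE expr2 -[X in X <= _]mulr_natr.
  by rewrite le_eqVlt; apply/orP; left; apply/eqP; ring.
rewrite big_nat_cond [X in _ <= X]big_nat_cond; apply: ler_sum => a /andP[/andP[a1 aY] _].
have hI : 0 < complex.Im (a%:R * z) by rewrite Im_mul mulr_gt0 // ltr0n.
have na : nm (chi1 a%:Z / a%:R) <= 1.
  rewrite nmM nmV nm_nat -[X in _ <= X]mulr1 ler_pM ?nm_ge0 ?invr_ge0 //.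
    exact: (nm_chi_le q1_gt1 h1).
  by rewrite invf_le1 ?ltr0n // ler1n.
have hc b : chi1 a%:Z / a%:R * ((chi2 b%:Z)^* * ex (b%:R * (a%:R * z))) = h a b.
  have -> : ex (b%:R * (a%:R * z)) = ex ((a * b)%N%:R * z).
    by rewrite natrM (mulrC a%:R b%:R) -mulrA.
  by rewrite /h [LHS]mulrA [chi1 a / _ * _]mulrAC.
have -> : chi1 a%:Z / a%:R * (fourier_const * twisted_cot (a%:R * z)) -
   \sum_(1 <= b < Y.+1) (if (a * b <= Y)%N then h a b else 0) =
   chi1 a%:Z / a%:R * (fourier_const * twisted_cot (a%:R * z) - twisted_geom Y (a%:R * z)) +
   \sum_(1 <= b < Y.+1) (if (a * b <= Y)%N then 0 else h a b).
  rewrite mulrBr -addrA; congr (_ + _).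
  rewrite /twisted_geom mulr_sumr -!sumrN -big_split /=; apply: eq_bigr => b _.
  by rewrite hc; case: ifP => _; rewrite ?addr0 // oppr0 addNr.
apply: le_trans (nmD _ _) _; rewrite mulrDl lerD //.
  rewrite nmM -[X in _ <= X]mul1r ler_pM ?nm_ge0 // nmB.
  apply: le_trans (twisted_geom_bound Y hI) _; rewrite nm_ex_mul -/fourier_const.
  rewrite /K -(mulrA (q2%:R / nm g2)) ler_wpM2l ?mulr_ge0 ?invr_ge0 ?nm_ge0 //.
  have e1 : nm (ex z) ^+ a <= nm (ex z).
    by rewrite -{2}[nm _]expr1 ler_wiXn2l // ltW.
  apply: (@le_trans _ _ (nm (ex z) ^+ Y.+1 / (1 - nm (ex z)))).
    have r1 := ltW rho1; apply: ler_pM.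
    - by rewrite !exprn_ge0.
    - by rewrite invr_ge0 subr_ge0 exprn_ile1.
    - by rewrite -exprM ler_wiXn2l // leq_pmull.
    - by rewrite lef_pV2 ?posrE ?subr_gt0 // ?lerD2l ?lerN2 // (le_lt_trans e1).
  have dr0 : 0 <= nm (ex z) / (1 - nm (ex z)) by rewrite divr_ge0 // subr_ge0 ltW.
  rewrite exprS mulrAC ler_wpM2l //.
  by rewrite ler_peMl ?exprn_ge0 // ler1n.
apply: le_trans (nm_sum _ _ _) _.
rewrite mul1r; apply: (@le_trans _ _ (\sum_(1 <= b < Y.+1) nm (ex z) ^+ Y)).
  apply: ler_sum => b _; case: leqP => ab; first by rewrite nm0 exprn_ge0.
  rewrite -hc nmM -[X in _ <= X]mul1r ler_pM ?nm_ge0 //.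
  rewrite nmM nm_conj -[X in _ <= X]mul1r ler_pM ?nm_ge0 //.
    exact: (nm_chi_le q2_gt1 h2).
  by have r1 := ltW rho1; rewrite mulrA -natrM nm_ex_mul mulnC ler_wiXn2l // ltnW.
by rewrite sumr_const_nat subn1 /= mulr_natl.
Unshelve. all: by end_near. Qed.

End EisensteinLimit.

(** * Arithmetic progressions inside windows *)

Section IntegerRangesMore.
Variable V : nmodType.

Lemma isum_rev (m : int) L (F : int -> V) :
  isum m L F = \sum_(i < L) F (m + L%:Z - 1 - i%:Z).
Proof.
rewrite /isum (reindex_inj rev_ord_inj) /=; apply: eq_bigr => i _; congr F.
by rewrite -subzn ?ltn_ord // intS; ring.
Qed.

Lemma isum_split0 A B (F : int -> V) :
  isum (- A%:Z) (A + B.+1) F =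
  F 0 + (\sum_(1 <= j < B.+1) F j%:Z + \sum_(1 <= j < A.+1) F (- j%:Z)).
Proof.
rewrite isum_cat addNr [X in X + _]isum_rev addrC.
rewrite {1}/isum big_ord_recl addr0 -addrA; congr (_ + (_ + _)).
  by rewrite big_add1 big_mkord; apply: eq_bigr => i _; rewrite add0r.
rewrite big_add1 big_mkord; apply: eq_bigr => i _; congr F.
by rewrite intS; ring.
Qed.

(** A window of length K0 L contains exactly L members b = c + K0 n of each residue class, and n
    runs through a window displaced by the quotient of c by K0. This displacement is the distortion
    caused by the substitution. *)
Lemma isum_progression (K0 L M : nat) (c : int) (F : int -> V) : (0 < K0)%N ->
  isum (- (K0 * M)%N%:Z) (K0 * L)
    (fun b => if (K0%:Z %| b - c)%Z then F ((b - c) %/ K0%:Z)%Z else 0) =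
  isum (- M%:Z - (c %/ K0%:Z)%Z) L F.
Proof.
move=> k0; have kn : K0%:Z != 0 by rewrite eqz_nat -lt0n.
pose G b := if (K0%:Z %| b - c)%Z then F ((b - c) %/ K0%:Z)%Z else 0.
rewrite /isum (big_ord_mul _ _ (fun i => G (- (K0 * M)%N%:Z + i%:Z))).
apply: eq_bigr => j _.
have lt : (`|(c %% K0)%Z|%N < K0)%N.
  by rewrite -ltz_nat gez0_abs ?modz_ge0 // ltz_mod.
have E (r : nat) : - (K0 * M)%N%:Z + (r + K0 * j)%N%:Z - c =
   (r%:Z - (c %% K0%:Z)%Z) + (j%:Z - M%:Z - (c %/ K0%:Z)%Z) * K0%:Z.
  by rewrite {1}(divz_eq c K0%:Z) PoszD !PoszM; ring.
rewrite (bigD1 (Ordinal lt)) //= /G !E gez0_abs ?modz_ge0 // subrr add0r.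
rewrite dvdz_mull // mulzK // big1 ?addr0 => [|r nr].
  by congr F; ring.
rewrite E; case: ifP => //; rewrite rpredDr ?dvdz_mull // => h.
case/eqP: nr; apply/val_inj => /=; move: h.
have -> : (c %% K0)%Z = `|(c %% K0)%Z|%N by rewrite gez0_abs ?modz_ge0.
move: `|_|%N lt => s lt; rewrite absz_nat -eqz_mod_dvd !modz_nat eqz_nat.
by rewrite !modn_small // => /eqP.
Qed.

Lemma isum_progressionN (K0 L M : nat) (c : int) (F : int -> V) : (0 < K0)%N ->
  isum (- (K0 * M)%N%:Z) (K0 * L)
    (fun b => if (K0%:Z %| c - b)%Z then F ((c - b) %/ K0%:Z)%Z else 0) =
  isum (M%:Z + (c %/ K0%:Z)%Z + 1 - L%:Z) L F.
Proof.
move=> k0; have kn : K0%:Z != 0 by rewrite eqz_nat -lt0n.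
transitivity (isum (- (K0 * M)%N%:Z) (K0 * L)
    (fun b => if (K0%:Z %| b - c)%Z then F (- ((b - c) %/ K0%:Z)%Z) else 0)).
  apply: eq_isum => b; rewrite -opprB rpredN; case: ifP => // /dvdzP[d ->].
  by rewrite -mulNr !mulzK.
rewrite (isum_progression _ _ _ (fun n => F (- n))) // isum_rev /isum.
by apply: eq_bigr => i _; congr F; ring.
Qed.

End IntegerRangesMore.

(** * Rows truncated by a displaced window *)

Section Transformation.
Variable R : realType.
Variables (q1 q2 : nat) (chi1 chi2 : int -> R[i]).
Hypotheses (q1_gt1 : (1 < q1)%N) (q2_gt1 : (1 < q2)%N).
Hypotheses (p1 : primitive_character q1 chi1) (p2 : primitive_character q2 chi2).
Hypothesis parity : chi1 (-1) * chi2 (-1) = 1.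
Implicit Types w z : R[i].

Let h1 := proj1 p1.
Let h2 := proj1 p2.
Let q1_gt0 : (0 < q1)%N := ltnW q1_gt1.
Let q2_gt0 : (0 < q2)%N := ltnW q2_gt1.

Lemma isum_chi_bound m L : nm (isum m L chi2) <= q2%:R.
Proof.
have per D n : isum n (q2 * D) chi2 = 0.
  rewrite /isum (big_ord_mul _ _ (fun i => chi2 (n + i%:Z))) big1 // => j _.
  transitivity (\sum_(r < q2) chi2 (n + r%:Z)).
    by apply: eq_bigr => r _; rewrite PoszD PoszM addrA (chi_modD h2).
  rewrite (@sum_mod_bij _ q2 chi2 (fun r => n + r)) ?(sum_chi q2_gt1 p2) //.
    exact: chi_period h2.
  move=> i j' iq jq /eqP; rewrite eqz_mod_dvd opprD addrACA subrr add0r.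
  by rewrite -eqz_mod_dvd !modz_nat eqz_nat !modn_small // => /eqP.
rewrite (divn_eq L q2) mulnC isum_cat per add0r.
apply: le_trans (nm_sum _ _ _) _.
apply: (@le_trans _ _ (\sum_(i < L %% q2) 1)).
  by apply: ler_sum => i _; apply: (nm_chi_le q2_gt1 h2).
by rewrite sumr_const card_ord ler_nat ltnW // ltn_mod.
Qed.

Local Notation term w := (fun n : int => chi2 n / (q2%:R * w + n%:~R)).

(** The window is embedded in a large symmetric one, for which the limit is known; the two leftover
    pieces have character sums bounded by q2 and denominators growing linearly away from the window,
    so [abel_tail] bounds both, whatever their lengths. *)
Lemma window_bound (s : int) L w (d t0 : R) : complex.Im w != 0 -> 0 < d -> 0 < t0 ->
  (forall i : nat, d * (t0 + i%:R) <= nm (q2%:R * w + (s + L%:Z + i%:Z)%:~R)) ->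
  (forall i : nat, d * (t0 + i%:R) <= nm (q2%:R * w + (s - 1 - i%:Z)%:~R)) ->
  nm (isum s L (term w) - twisted_cot q2 chi2 w) <= 2 * (q2%:R * (d^-1 + d ^- 2) / t0).
Proof.
move=> hw d0 t00 hr hl; set B := _ / t0.
have right n : nm (isum (s + L%:Z) n (term w)) <= B.
  apply: (@abel_tail R (fun i => chi2 (s + L%:Z + i%:Z))
    (fun i => q2%:R * w + (s + L%:Z + i%:Z)%:~R) q2%:R d 1 t0 n) => //.
  - by move=> m; apply: isum_chi_bound.
  - by move=> i; rewrite mul1r; apply: hr.
  - move=> i; rewrite opprD addrACA subrr add0r -intrB nm_int.
    by rewrite opprD addrACA subrr add0r intS addrK normr1.
have left n : nm (isum (s - n%:Z) n (term w)) <= B.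
  rewrite isum_rev subrK.
  apply: (@abel_tail R (fun i => chi2 (s - 1 - i%:Z))
    (fun i => q2%:R * w + (s - 1 - i%:Z)%:~R) q2%:R d 1 t0 n) => //.
  - move=> m; have := isum_chi_bound (s - m%:Z) m; rewrite isum_rev subrK; exact.
  - by move=> i; rewrite mul1r; apply: hl.
  - move=> i; rewrite opprD addrACA subrr add0r -intrB nm_int.
    rewrite opprD addrACA subrr add0r intS.
    by rewrite (_ : - (1 + i%:Z) - - i%:Z = -1) ?normrN1 //; ring.
apply/ler_addgt0Pr => e e0; near \oo => M.
have hM : nm (isum (- (q2 * M)%N%:Z) (q2 * M.*2.+1) (term w) - twisted_cot q2 chi2 w) < e.
  by near: M; apply: (proj1 (tendsP _ _) (twisted_cot_lim q2_gt1 p2 hw)).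
have sM : (`|s| + L <= M)%N by near: M; exists (`|s| + L)%N.
have le : (M <= q2 * M)%N by rewrite leq_pmull.
(* [A] counts the terms of the symmetric window to the left of the given one, and [C] below those to
   its right. *)
have [A hA] : exists A : nat, s = - (q2 * M)%N%:Z + A%:Z.
  exists (absz (s + (q2 * M)%N%:Z)%R); rewrite gez0_abs; first by ring.
  by move: sM le; clear; lia.
have [C hC] : exists C : nat, (q2 * M.*2.+1 = A + (L + C))%N.
  exists (q2 * M.*2.+1 - (A + L))%N; rewrite addnA subnKC //.
  rewrite -muln2 mulnS; move: sM le hA; clear; nia.
move: hM; rewrite hC !isum_cat -hA => hM.
have E1 : nm (isum (- (q2 * M)%N%:Z) A (term w)) <= B.
  by have := left A; rewrite {1}hA addrK.
have E2 := right C.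
set x := isum s L _ in hM *; set y := isum _ A _ in hM E1; set v := isum _ C _ in hM E2.
have -> : x - twisted_cot q2 chi2 w = (y + (x + v) - twisted_cot q2 chi2 w) - (y + v) by ring.
apply: le_trans (nmD _ _) _; rewrite nmN.
have := nmD y v; lra.
Unshelve. all: by end_near. Qed.

(** With X = q2 a z + n one has l a - K0 n = a (l + K0 q2 z) - K0 X, and |a| <= |X| / (q2 Im z) by
    the imaginary part. The point is that [d] serves all a and n at once, although the windows are
    centred near l a / K0 and not at 0. *)
Lemma denominator_bound z (l : int) (K0 : nat) : 0 < complex.Im z ->
  exists2 d : R, 0 < d & forall a n : int,
    d * `|l * a - K0%:Z * n|%:~R <= nm (q2%:R * (a%:~R * z) + n%:~R).
Proof.
move=> hz; have q2R : 0 < (q2%:R : R) by rewrite ltr0n.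
pose D : R := nm (l%:~R + (K0 * q2)%N%:R * z) / (q2%:R * complex.Im z) + K0%:R.
have hz' := ltW hz.
have D0 : 0 <= D by rewrite addr_ge0 ?divr_ge0 ?nm_ge0 ?mulr_ge0.
exists (D + 1)^-1 => [|a n]; first by rewrite invr_gt0 ltr_wpDl.
rewrite ler_pdivrMl ?ltr_wpDl // -nm_int.
set x := q2%:R * _ + _.
have hI : q2%:R * `|a|%:~R * complex.Im z <= nm x.
  apply: le_trans (Im_le_nm x).
  have -> : complex.Im x = q2%:R * a%:~R * complex.Im z.
    rewrite /x -(rmorph_nat (real_complex R)) -!(rmorph_int (real_complex R)).
    by case: (z) => u v /=; ring.
  by rewrite !normrM (ger0_norm (ler0n _ _)) (gtr0_norm hz) intr_norm.
have -> : (l * a - K0%:Z * n)%:~R = a%:~R * (l%:~R + (K0 * q2)%N%:R * z) - K0%:R * x :> R[i].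
  by rewrite /x intrB !intrM natrM -pmulrn; ring.
apply: le_trans (nmD _ _) _; rewrite nmN !nmM nm_nat nm_int.
have : `|a|%:~R * nm (l%:~R + (K0 * q2)%N%:R * z) <=
    nm (l%:~R + (K0 * q2)%N%:R * z) / (q2%:R * complex.Im z) * nm x.
  rewrite mulrC -mulrA ler_wpM2l ?nm_ge0 // ler_pdivlMl ?mulr_gt0 //.
  by rewrite mulrC mulrCA mulrA.
have := nm_ge0 x; rewrite /D; lra.
Qed.

(** Beyond the window |b| is at least M, and b is l a - K0 n or l a + K0 n, so [denominator_bound]
    gives the linear growth with t0 = M. The constant is uniform in a, which is what makes the sum
    over the rows possible. The two halves serve f(z) and f(g z) respectively. *)
Lemma window_lim (K0 : nat) (l : int) z : (0 < K0)%N -> 0 < complex.Im z ->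
  exists C : R, forall (M : nat) (a : int), (0 < M)%N -> a != 0 ->
   nm (isum (- (K0 * q2 * M)%N%:Z) (K0 * q2 * M.*2.+1)
     (fun b => if (K0%:Z %| l * a - b)%Z
       then term (a%:~R * z) ((l * a - b) %/ K0%:Z)%Z else 0) -
     twisted_cot q2 chi2 (a%:~R * z)) <= C / M%:R /\
   nm (isum (- (K0 * q2 * M)%N%:Z) (K0 * q2 * M.*2.+1)
     (fun b => if (K0%:Z %| b - l * a)%Z
       then term (a%:~R * z) ((b - l * a) %/ K0%:Z)%Z else 0) -
     twisted_cot q2 chi2 (a%:~R * z)) <= C / M%:R.
Proof.
move=> k0 hz; have [d d0 hd] := denominator_bound l K0 hz.
have [d' d0' hd'] := denominator_bound (- l) K0 hz.
pose C e := 2 * (q2%:R * (e^-1 + e ^- 2)) : R.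
have C0 e : 0 < e -> 0 <= C e.
  by move=> e0; have e1 := ltW e0; rewrite !mulr_ge0 ?addr_ge0 ?invr_ge0 ?sqr_ge0.
exists (C d + C d') => M a M0 a0.
have MR : 0 < (M%:R : R) by rewrite ltr0n.
have hI : complex.Im (a%:~R * z) != 0.
  rewrite -(rmorph_int (real_complex R)); case: (z) hz => u v /= hv.
  by rewrite mul0r addr0 mulf_neq0 ?intr_eq0 // gt_eqF.
have kq : (M <= K0 * (q2 * M))%N by rewrite mulnA leq_pmull // muln_gt0 k0.
have dm (m : int) := divz_eq m K0%:Z.
have dm0 (m : int) : 0 <= (m %% K0%:Z)%Z by rewrite modz_ge0 // eqz_nat -lt0n.
have dm1 (m : int) : (m %% K0%:Z)%Z < K0%:Z by rewrite ltz_mod // eqz_nat -lt0n.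
have key e (t u n : int) : 0 < e ->
    (forall a n : int, e * `|t * a - K0%:Z * n|%:~R <= nm (q2%:R * (a%:~R * z) + n%:~R)) ->
    u <= `|t * a - K0%:Z * n| -> e * u%:~R <= nm (q2%:R * (a%:~R * z) + n%:~R).
  move=> e0 he h; apply: le_trans (he a n).
  by rewrite ler_wpM2l ?(ltW e0) // ler_int.
have iE (i : nat) : M%:R + i%:R = (M%:Z + i%:Z)%:~R :> R by rewrite intrD -!pmulrn.
split.
  rewrite -!mulnA (isum_progressionN _ _ (l * a) (term (a%:~R * z))) //.
  apply: (@le_trans _ _ (2 * (q2%:R * (d^-1 + d ^- 2) / M%:R))); last first.
    by rewrite [X in X <= _]mulrA ler_pM2r ?invr_gt0 // lerDl C0.
  apply: window_bound => // i; rewrite iE; apply: (key _ l) => //.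
    move: (dm (l * a)) (dm0 (l * a)) (dm1 (l * a)) kq k0.
    set x := l * a; set y := (x %/ _)%Z; set v := (x %% _)%Z; clearbody x y v; clear => -> ? ? ? ?.
    nia.
  move: (dm (l * a)) (dm0 (l * a)) (dm1 (l * a)) kq k0.
  set x := l * a; set y := (x %/ _)%Z; set v := (x %% _)%Z; clearbody x y v; clear => -> ? ? ? ?.
  nia.
rewrite -!mulnA (isum_progression _ _ (l * a) (term (a%:~R * z))) //.
apply: (@le_trans _ _ (2 * (q2%:R * (d'^-1 + d' ^- 2) / M%:R))); last first.
  by rewrite [X in X <= _]mulrA ler_pM2r ?invr_gt0 // lerDr C0.
apply: window_bound => // i; rewrite iE; apply: (key _ (- l)) => //.
  rewrite mulNr; move: (dm (l * a)) (dm0 (l * a)) (dm1 (l * a)) kq k0.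
  set x := l * a; set y := (x %/ _)%Z; set v := (x %% _)%Z; clearbody x y v; clear => -> ? ? ? ?.
  nia.
rewrite mulNr; move: (dm (l * a)) (dm0 (l * a)) (dm1 (l * a)) kq k0.
set x := l * a; set y := (x %/ _)%Z; set v := (x %% _)%Z; clearbody x y v; clear => -> ? ? ? ?.
nia.
Qed.

End Transformation.

(** * The transformation formula *)

Section TransformationFormula.
Variable R : realType.
Variables (q1 q2 : nat) (chi1 chi2 : int -> R[i]).
Hypotheses (q1_gt1 : (1 < q1)%N) (q2_gt1 : (1 < q2)%N).
Hypotheses (p1 : primitive_character q1 chi1) (p2 : primitive_character q2 chi2).
Hypothesis parity : chi1 (-1) * chi2 (-1) = 1.
Implicit Types w z : R[i].

Let h1 := proj1 p1.
Let h2 := proj1 p2.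
Let q1_gt0 : (0 < q1)%N := ltnW q1_gt1.
Let q2_gt0 : (0 < q2)%N := ltnW q2_gt1.

Local Notation tau := (two_pi_i R).
Local Notation g2 := (gauss_sum q2 chi2).

(** Cesaro means of the null sequence 1/j tend to 0; this takes the place of the estimate (log
    M)/M. *)
Lemma harmonic_mean0 (k : nat) : (0 < k)%N ->
  (fun M : nat => (\sum_(1 <= j < (k * M.+1).+1) (j%:R^-1 : R)) / M%:R) @ \oo --> (0 : R).
Proof.
move=> k0.
have hc := cesaro (@cvg_harmonic R).
have hf : (fun M => (k * M.+1).-1) @ \oo --> \oo.
  apply/cvgnyPge => A; near=> M.
  have : (A <= M)%N by near: M; exists A.
  move=> AM; rewrite -ltnS prednK ?muln_gt0 ?k0 //.
  by apply: leq_ltn_trans AM _; rewrite leq_pmull.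
have h := cvg_comp _ _ hf hc.
apply: (squeeze_cvgr (f := fun=> 0)
  (h := fun M => (2 * k%:R) * arithmetic_mean (@harmonic R) (k * M.+1).-1)).
- near=> M; have M0 : (0 < M)%N by near: M; exists 1%N.
  have MR : 0 < (M%:R : R) by rewrite ltr0n.
  have S0 : 0 <= \sum_(1 <= j < (k * M.+1).+1) (j%:R^-1 : R).
    by apply: sumr_ge0 => j _; rewrite invr_ge0.
  rewrite divr_ge0 ?ler0n //= /arithmetic_mean /series /= prednK ?muln_gt0 ?k0 //.
  have -> : \sum_(0 <= i < k * M.+1) harmonic i = \sum_(1 <= j < (k * M.+1).+1) (j%:R^-1 : R).
    by rewrite big_add1.
  rewrite mulrA mulrC ler_wpM2r // natrM invfM mulrA.
  have kR : (k%:R : R) != 0 by rewrite pnatr_eq0 -lt0n.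
  rewrite mulfK // ler_pdivlMr ?ltr0n // -ler_pdivlMl ?invr_gt0 // invrK.
  by rewrite mulrC -natrM ler_nat; move: M0; clear; lia.
- exact: cvg_cst.
- by rewrite -[0 in X in _ --> X](mulr0 (2 * k%:R)); apply: cvgMr.
Unshelve. all: by end_near. Qed.

(** Here parity enters: the signs from chi1(-a), from the twisted cotangent and from 1/(-a) multiply
    to 1, so negative a double the positive ones instead of cancelling them. *)
Lemma twisted_cot_mulN z (a : nat) : 0 < complex.Im z -> (0 < a)%N ->
  chi1 (- a%:Z) / (- a%:Z)%:~R * twisted_cot q2 chi2 ((- a%:Z)%:~R * z) =
  chi1 a%:Z / a%:R * twisted_cot q2 chi2 (a%:R * z).
Proof.
move=> hz a0; have hI : complex.Im (a%:R * z) != 0.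
  by rewrite Im_mul mulf_neq0 ?gt_eqF // ltr0n.
have e : (- a%:Z)%:~R = - a%:R :> R[i] by rewrite intrN -pmulrn.
rewrite e mulNr (twisted_cot_odd q2_gt1 p2 hI) (chiN h1) invrN.
set X := twisted_cot _ _ _.
transitivity (chi1 (-1) * chi2 (-1) * (chi1 a%:Z / a%:R * X)); first by ring.
by rewrite parity mul1r.
Qed.

(** An error C/M in every row, weighted by 1/|a|, sums to a multiple of (1/M) times a harmonic sum
    and vanishes in the limit. The factor 2 counts a and -a; the extra terms on the positive side of
    the window are harmless since each half converges by itself. *)
Lemma weighted_lim (K0 : nat) z (W : nat -> int -> R[i]) (C : R) : (0 < K0)%N ->
  0 < complex.Im z ->
  (forall (M : nat) (a : int), (0 < M)%N -> a != 0 ->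
     nm (W M a - twisted_cot q2 chi2 (a%:~R * z)) <= C / M%:R) ->
  tends (fun M => isum (- (K0 * q2 * M)%N%:Z) (K0 * q2 * M.*2.+1)
     (fun a => chi1 a / a%:~R * W M a))
   (2 / fourier_const q2 chi2 * eisenstein_f chi1 chi2 z).
Proof.
move=> K00 hz hW; set k := (K0 * q2)%N.
have k0 : (0 < k)%N by rewrite muln_gt0 K00.
have g0 : g2 != 0 := gauss_sum_neq0 q2_gt1 p2.
have c0 : fourier_const q2 chi2 != 0.
  by rewrite oppr_eq0 mulf_neq0 ?invr_eq0 ?mulf_neq0 ?two_pi_i_neq0 // pnatr_eq0 -lt0n.
have hk M : (k * M.*2.+1 = k * M + (k * M.+1).-1.+1)%N.
  rewrite prednK; last by rewrite muln_gt0 k0.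
  by rewrite -mulnDr addnS addnn.
pose T (V : int -> R[i]) M := isum (- (k * M)%N%:Z) (k * M.*2.+1) (fun a => chi1 a / a%:~R * V a).
have chi10 : chi1 0 = 0 by rewrite (chi_dvd q1_gt1 h1) // dvdz0.
have TE V M : T V M = \sum_(1 <= j < (k * M.+1).-1.+1) (chi1 j%:Z / j%:R * V j%:Z) +
    \sum_(1 <= j < (k * M).+1) (chi1 (- j%:Z) / (- j%:Z)%:~R * V (- j%:Z)).
  by rewrite /T hk isum_split0 chi10 !mul0r add0r.
have hG := eisenstein_f_lim q1_gt1 q2_gt1 p1 p2 hz.
have hT : tends (T (fun a => twisted_cot q2 chi2 (a%:~R * z))) (2 / fourier_const q2 chi2 * eisenstein_f chi1 chi2 z).
  have le1 M : (M <= (k * M.+1).-1)%N.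
    have kM : (0 < k * M.+1)%N by rewrite muln_gt0 k0.
    by rewrite -ltnS (prednK kM) leq_pmull.
  have le2 M : (M <= k * M)%N by rewrite leq_pmull.
  have := tendsMl (fourier_const q2 chi2)^-1 (tendsD (tends_comp hG le1) (tends_comp hG le2)).
  rewrite (_ : (fourier_const q2 chi2)^-1 * _ = 2 / fourier_const q2 chi2 * eisenstein_f chi1 chi2 z); last by ring.
  congr (tends _ _); apply/funext => M; rewrite TE mulrDr /eisenstein_rows !mulr_sumr.
  congr (_ + _); apply: eq_big_nat => j /andP[j0 _].
    by rewrite -pmulrn mulrCA mulKf.
  by rewrite twisted_cot_mulN // mulrCA mulKf.
apply: (tends_sub0 hT).
apply: (@tends_le_near _ _ _ (fun M => `|C| * 2 *
   ((\sum_(1 <= j < (k * M.+1).+1) (j%:R^-1 : R)) / M%:R))); last first.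
  by rewrite -[0 in X in _ --> X](mulr0 (`|C| * 2)); apply: cvgMr; apply: harmonic_mean0.
near=> M; have M0 : (0 < M)%N by near: M; exists 1%N.
have -> : isum (- (k * M)%N%:Z) (k * M.*2.+1) (fun a => chi1 a / a%:~R * W M a) = T (W M) M by [].
rewrite subr0 !TE opprD addrACA -!sumrB.
have CM : C / M%:R <= `|C| / M%:R by rewrite ler_wpM2r ?invr_ge0 // ler_norm.
have bnd (a : int) (j : nat) : a = j%:Z \/ a = - j%:Z -> (0 < j)%N ->
   nm (chi1 a / a%:~R * twisted_cot q2 chi2 (a%:~R * z) - chi1 a / a%:~R * W M a) <=
   `|C| / M%:R * j%:R^-1.
  move=> ha j0; have an : a != 0 by case: ha => ->; rewrite ?oppr_eq0 eqz_nat -lt0n.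
  have aj : nm a%:~R = j%:R :> R.
    rewrite nm_int; case: ha => ->; rewrite ?normrN ger0_norm ?ler0z //.
  rewrite -mulrBr nmM nmM nmV aj nmB mulrC ler_pM ?mulr_ge0 ?nm_ge0 ?invr_ge0 //.
    by apply: le_trans (hW _ _ M0 an) CM.
  by rewrite ler_piMl ?invr_ge0 // (nm_chi_le q1_gt1 h1).
have sumb n (F : nat -> R[i]) : (n <= k * M.+1)%N ->
   (forall j, (0 < j)%N -> nm (F j) <= `|C| / M%:R * j%:R^-1) ->
   nm (\sum_(1 <= j < n.+1) F j) <=
     `|C| / M%:R * \sum_(1 <= j < (k * M.+1).+1) (j%:R^-1 : R).
  move=> hn hF; apply: le_trans (nm_sum _ _ _) _.
  rewrite mulr_sumr (@big_cat_nat _ _ _ n.+1 1 (k * M.+1).+1) //= -[X in X <= _]addr0 lerD //.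
    rewrite big_nat_cond [X in _ <= X]big_nat_cond; apply: ler_sum => j /andP[/andP[j0 _] _].
    exact: hF.
  by apply: sumr_ge0 => j _; rewrite mulr_ge0 ?divr_ge0 ?invr_ge0.
apply: le_trans (nmD _ _) _.
rewrite (_ : `|C| * 2 * _ = `|C| / M%:R * \sum_(1 <= j < (k * M.+1).+1) (j%:R^-1 : R) +
    `|C| / M%:R * \sum_(1 <= j < (k * M.+1).+1) (j%:R^-1 : R)); last by ring.
rewrite lerD //.
  by apply: sumb => [|j j0]; [exact: leq_pred|apply: bnd => //; left].
apply: sumb => [|j j0]; first by rewrite leq_mul2l leqnSn orbT.
by apply: bnd => //; right.
Unshelve. all: by end_near. Qed.

Section Matrix.
Variables (h b l : int) (k K0 : nat).
Hypotheses (k_gt0 : (0 < k)%N) (kE : k = (K0 * q2)%N) (qK : (q1 %| K0)%N).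
Hypothesis hdet : h * l - b * k%:Z = 1.

Let K0_gt0 : (0 < K0)%N.
Proof. by move: k_gt0; rewrite kE muln_gt0 => /andP[]. Qed.

Let hl1 : h * l = 1 + b * k%:Z.
Proof. by rewrite -hdet subrK. Qed.

(** The coefficient of 1/(a' a) in the correction: chi1(a') chi2(n') on the pairs with a = l a' - K0
    n', and 0 elsewhere. It is periodic modulo k in both variables. *)
Definition Theta (a' a : int) : R[i] :=
  if (K0%:Z %| l * a' - a)%Z then chi1 a' * chi2 ((l * a' - a) %/ K0%:Z)%Z else 0.

Definition cot_sum : R[i] :=
  \sum_(r' < k) \sum_(r < k) Theta r'%:Z r%:Z * (cayley (ek R k r'%:Z) * cayley (ek R k r%:Z)).

Definition psi0 : R[i] := chi1 l * (chi2 l)^*.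

(** Put n = (a' - h a)/K0 and n' = (l a' - a)/K0; the determinant makes both integral or neither.
    With X = q2 a' z + n', the denominator for g z is X/(k z + l), and k z + l = (K0 X + a)/a'.
    Hence (k z + l)/(a X) = K0/(a a') + 1/(a' X). The factor [psi0] comes from chi1(a) = chi1(l)
    chi1(a') and chi2(n) = conj chi2(l) chi2(n'). *)
Lemma term_transformation z (a a' : int) : 0 < complex.Im z ->
  chi1 a / a%:~R * (if (K0%:Z %| a' - h * a)%Z then
    chi2 ((a' - h * a) %/ K0%:Z)%Z / (q2%:R * (a%:~R *
      ((h%:~R * z + b%:~R) / (k%:R * z + l%:~R))) + ((a' - h * a) %/ K0%:Z)%Z%:~R) else 0) =
  psi0 * (K0%:R * (Theta a' a / (a'%:~R * a%:~R)) +
    chi1 a' / a'%:~R * (if (K0%:Z %| l * a' - a)%Z then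
      chi2 ((l * a' - a) %/ K0%:Z)%Z / (q2%:R * (a'%:~R * z) +
        ((l * a' - a) %/ K0%:Z)%Z%:~R) else 0)).
Proof.
move=> hz; have Kn : K0%:Z != 0 by rewrite eqz_nat -lt0n.
have kZ : k%:Z = K0%:Z * q2%:Z by rewrite kE PoszM.
have dv : (K0%:Z %| l * a' - a)%Z = (K0%:Z %| a' - h * a)%Z.
  apply/idP/idP => /dvdzP[n e]; apply/dvdzP.
    exists (h * n - b * q2%:Z * a').
    have e2 : h * l * a' - h * a = h * n * K0%:Z by rewrite -[RHS]mulrA -e; ring.
    by rewrite mulrBl -e2 hl1 kZ; ring.
  exists (l * n + b * q2%:Z * a).
  have e2 : l * a' - h * l * a = l * n * K0%:Z by rewrite -[RHS]mulrA -e; ring.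
  by rewrite mulrDl -e2 hl1 kZ; ring.
rewrite /Theta dv; case: ifP => hd; last by rewrite !mul0r !mulr0 addr0 mulr0.
have [n e] := dvdzP hd; have nE : ((a' - h * a) %/ K0%:Z)%Z = n by rewrite e mulzK.
have e' : l * a' - a = (l * n + b * q2%:Z * a) * K0%:Z.
  have e2 : l * a' - h * l * a = l * n * K0%:Z by rewrite -[RHS]mulrA -e; ring.
  by rewrite mulrDl -e2 hl1 kZ; ring.
rewrite nE e' mulzK //; set n' := l * n + _.
have qK' : (q1%:Z %| K0%:Z)%Z by rewrite dvdzE !absz_nat.
have [s sE] := dvdzP qK'.
have chia : chi1 a = chi1 l * chi1 a'.
  rewrite -(chiM h1); apply/esym/(chi_mod h1)/eqP; rewrite eqz_mod_dvd e' sE.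
  by rewrite mulrA dvdz_mull.
have cl2 : coprimez l q2%:Z.
  apply/coprimezP; exists (h, - b * K0%:Z) => /=; move: hdet; rewrite kZ => <-; ring.
have chin : chi2 n = (chi2 l)^* * chi2 n'.
  rewrite (conj_chi q2_gt1 h2) /n'; apply: (mulfI (_ : chi2 l != 0)).
    by rewrite (chi_neq0 h2).
  rewrite mulVKf ?(chi_neq0 h2) // -(chiM h2); apply: (chi_mod h2); apply/eqP.
  rewrite eqz_mod_dvd opprD addrA subrr sub0r rpredN mulrAC dvdz_mull //.
(* If chi1(a') = 0 both sides vanish. Otherwise a and a' are nonzero, since chi1(0) = 0 and chi1(l)
   is not 0, and all divisions below are genuine. *)
case: (eqVneq (chi1 a') 0) => [c0|c0].
  by rewrite chia c0 !mulr0 !mul0r mulr0 addr0 mulr0.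
have chi10 : chi1 0 = 0 by rewrite (chi_dvd q1_gt1 h1) // dvdz0.
have a'0 : a' != 0 by apply: contraNneq c0 => ->; rewrite chi10.
have a0 : a != 0.
  apply/eqP => a0; move: chia; rewrite a0 chi10 => /esym/eqP; rewrite mulf_eq0 (negPf c0) orbF.
  apply/negP; rewrite (chi_neq0 h1).
  apply/coprimezP; exists (h, - b * s * q2%:Z) => /=.
  by move: hdet; rewrite kZ sE => <-; ring.
have nz : k%:R * z + l%:~R != 0.
  apply/eqP => /(congr1 (@complex.Im R)).
  rewrite -(rmorph_int (real_complex R)) -(rmorph_nat (real_complex R)).
  case: (z) hz => u v /= hv; rewrite mul0r addr0 addr0 => /eqP.
  by rewrite mulf_eq0 pnatr_eq0 -leqn0 leqNgt k_gt0 /= gt_eqF.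
have nz' : q2%:R * (a'%:~R * z) + n'%:~R != 0.
  apply/eqP => /(congr1 (@complex.Im R)).
  rewrite -!(rmorph_int (real_complex R)) -(rmorph_nat (real_complex R)).
  case: (z) hz => u v /= hv; rewrite !mul0r !addr0 => /eqP.
  by rewrite !mulf_eq0 pnatr_eq0 -leqn0 leqNgt q2_gt0 intr_eq0 (negPf a'0) /= gt_eqF.
have -> : q2%:R * (a%:~R * ((h%:~R * z + b%:~R) / (k%:R * z + l%:~R))) + n%:~R =
   (q2%:R * (a'%:~R * z) + n'%:~R) / (k%:R * z + l%:~R).
  apply: (mulIf nz); rewrite mulfVK // mulrDl -!mulrA mulVf // mulr1.
  have -> : a' = h * a + n * K0%:Z by rewrite -e addrC subrK.
  by rewrite /n' kE natrM !intrD !intrM -!pmulrn; ring.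
rewrite invf_div chia chin /psi0.
have E : k%:R * z + l%:~R = (K0%:R * (q2%:R * (a'%:~R * z) + n'%:~R) + a%:~R) / a'%:~R.
  apply: (mulIf (_ : a'%:~R != 0 :> R[i])); first by rewrite intr_eq0.
  rewrite mulfVK ?intr_eq0 //.
  have -> : a = l * a' - n' * K0%:Z by rewrite -e'; ring.
  by rewrite kE natrM intrB !intrM -!pmulrn; ring.
rewrite E; set D := _ + n'%:~R in nz' *.
have aR : a%:~R != 0 :> R[i] by rewrite intr_eq0.
have aR' : a'%:~R != 0 :> R[i] by rewrite intr_eq0.
clearbody D; move: (a%:~R) (a'%:~R) aR aR' => x x' x0 x'0.
by field; rewrite x0 x'0 nz'.
Qed.

Lemma Theta_periodl a' a m : Theta (a' + k%:Z * m) a = Theta a' a.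
Proof.
rewrite /Theta (_ : l * (a' + k%:Z * m) - a = l * a' - a + (q2%:Z * (l * m)) * K0%:Z); last first.
  by rewrite kE PoszM; ring.
rewrite rpredDr ?dvdz_mull //; case: ifP => // /dvdzP[n ->].
have Kn : K0%:Z != 0 by rewrite eqz_nat -lt0n.
rewrite -mulrDl !mulzK // (chi_modD h2); congr (_ * _).
have [s sE] := dvdnP qK.
rewrite kE sE -(chi_modD h1 a' (s%:Z * q2%:Z * m)); congr chi1.
by rewrite !PoszM; ring.
Qed.

Lemma Theta_periodr a' a m : Theta a' (a + k%:Z * m) = Theta a' a.
Proof.
rewrite /Theta (_ : l * a' - (a + k%:Z * m) = l * a' - a + (q2%:Z * - m) * K0%:Z); last first.
  by rewrite kE PoszM; ring.
rewrite rpredDr ?dvdz_mull //; case: ifP => // /dvdzP[n ->].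
have Kn : K0%:Z != 0 by rewrite eqz_nat -lt0n.
by rewrite -mulrDl !mulzK // (chi_modD h2).
Qed.

(** Periodicity factors the double sum over each pair of residue classes into two one-dimensional
    symmetric sums, whose limits are cotangents. *)
Lemma theta_lim :
  tends (fun M => isum (- (k * M)%N%:Z) (k * M.*2.+1) (fun a' =>
     isum (- (k * M)%N%:Z) (k * M.*2.+1) (fun a => Theta a' a / (a'%:~R * a%:~R))))
   ((tau / (2 * k%:R)) ^+ 2 * cot_sum).
Proof.
have kn : (k%:R : R[i]) != 0 by rewrite pnatr_eq0 -lt0n.
pose s M (r : nat) := isum (- M%:Z) M.*2.+1 (fun m => (r%:Z + k%:Z * m)%:~R^-1 : R[i]).
have hs r : (r < k)%N -> tends (fun M => s M r) (- (tau / (2 * k%:R)) * cayley (ek R k r%:Z)).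
  move=> rk.
  have hw : ex (r%:R / k%:R : R[i]) != 1 \/ (r%:R / k%:R : R[i]) = 0.
    case: (posnP r) => [->|r0]; first by right; rewrite mul0r.
    left; have := ek_eq1 R r%:Z k_gt0; rewrite /ek -pmulrn => ->.
    by rewrite dvdzE !absz_nat gtnNdvd.
  have := tendsMl k%:R^-1 (cayley_lim hw).
  rewrite (_ : k%:R^-1 * _ = - (tau / (2 * k%:R)) * cayley (ek R k r%:Z)); last first.
    have -> : ek R k r = ex (r%:R / k%:R) by rewrite /ek -pmulrn.
    by field.
  congr (tends _ _); apply/funext => M; rewrite /s /isum mulr_sumr; apply: eq_bigr => i _.
  rewrite -invfM; congr (_^-1).
  by rewrite [in RHS]intrD [in RHS]intrM -!pmulrn mulrDr (mulrCA k%:R) divff // mulr1.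
have -> : (tau / (2 * k%:R)) ^+ 2 * cot_sum = \sum_(r' < k) \sum_(r < k)
   Theta r'%:Z r%:Z * ((- (tau / (2 * k%:R)) * cayley (ek R k r'%:Z)) *
                       (- (tau / (2 * k%:R)) * cayley (ek R k r%:Z))).
  rewrite /cot_sum mulr_sumr; apply: eq_bigr => r' _.
  by rewrite mulr_sumr; apply: eq_bigr => r _; ring.
rewrite (_ : (fun M => _) = fun M => \sum_(r' < k) \sum_(r < k)
   Theta r'%:Z r%:Z * (s M r' * s M r)).
  apply: tends_sum => r' _; apply: tends_sum => r _; apply: tendsMl.
  by apply: tendsM; apply: hs.
apply/funext => M; rewrite isum_residues; apply: eq_bigr => r' _.
transitivity (isum (- M%:Z) M.*2.+1 (fun m' => \sum_(r < k)
    Theta r'%:Z r%:Z * ((r'%:Z + k%:Z * m')%:~R^-1 * s M r))).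
  apply: eq_isum => m'; rewrite isum_residues; apply: eq_bigr => r _.
  rewrite /s /isum !mulr_sumr; apply: eq_bigr => i _.
  by rewrite Theta_periodl Theta_periodr -invfM.
rewrite /isum exchange_big /=; apply: eq_bigr => r _.
by rewrite /s /isum mulr_suml mulr_sumr.
Qed.

(** The same finite sum over the square of pairs (a, a') has two limits: summed by rows a it yields
    f at the image point, and after [term_transformation], summed by rows a', it yields [psi0] times
    f(z) plus the correction. Uniqueness of limits equates them. *)
Lemma transformation z : 0 < complex.Im z ->
  eisenstein_f chi1 chi2 ((h%:~R * z + b%:~R) / (k%:R * z + l%:~R)) -
    psi0 * eisenstein_f chi1 chi2 z =
  psi0 * (fourier_const q2 chi2 / 2 * K0%:R * (tau / (2 * k%:R)) ^+ 2 * cot_sum).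
Proof.
move=> hz; set z' := _ / _.
have g0 : g2 != 0 := gauss_sum_neq0 q2_gt1 p2.
have c0 : fourier_const q2 chi2 != 0.
  by rewrite oppr_eq0 mulf_neq0 ?invr_eq0 ?mulf_neq0 ?two_pi_i_neq0 // pnatr_eq0 -lt0n.
have hz' : 0 < complex.Im z'.
  have nz : k%:R * z + l%:~R != 0.
    apply/eqP => /(congr1 (@complex.Im R)).
    rewrite -(rmorph_int (real_complex R)) -(rmorph_nat (real_complex R)).
    case: (z) hz => u v /= hv; rewrite mul0r addr0 addr0 => /eqP.
    by rewrite mulf_eq0 pnatr_eq0 -leqn0 leqNgt k_gt0 /= gt_eqF.
  have -> : complex.Im z' = complex.Im z / nm (k%:R * z + l%:~R) ^+ 2.
    have hd : (h%:~R * l%:~R - b%:~R * k%:R : R) = 1.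
      by rewrite (pmulrn 1 k) -!intrM -intrB hdet.
    rewrite nm_sqr /z' -!(rmorph_int (real_complex R)) -(rmorph_nat (real_complex R)).
    case: (z) => u v /=.
    rewrite !mul0r !subr0 !addr0 !mulrN.
    set D := (_ + _ ^+ 2)^-1.
    transitivity ((h%:~R * l%:~R - b%:~R * k%:R) * v * D); first by ring.
    by rewrite hd mul1r.
  by rewrite divr_gt0 // exprn_gt0 // nm_gt0.
have [C hC] := window_lim q2_gt1 p2 l K0_gt0 hz.
have [C' hC'] := window_lim q2_gt1 p2 h K0_gt0 hz'.
have L1 := weighted_lim K0_gt0 hz (fun M a M0 a0 => proj1 (hC M a M0 a0)).
have L2 := weighted_lim K0_gt0 hz' (fun M a M0 a0 => proj2 (hC' M a M0 a0)).
have L3 := tendsMl psi0 (tendsD (tendsMl K0%:R theta_lim) L1).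
have L2' := L2; rewrite (_ : (fun M => _) = (fun M => psi0 *
   (K0%:R * isum (- (k * M)%N%:Z) (k * M.*2.+1) (fun a' =>
     isum (- (k * M)%N%:Z) (k * M.*2.+1) (fun a => Theta a' a / (a'%:~R * a%:~R))) +
    isum (- (K0 * q2 * M)%N%:Z) (K0 * q2 * M.*2.+1) (fun a => chi1 a / a%:~R *
     isum (- (K0 * q2 * M)%N%:Z) (K0 * q2 * M.*2.+1)
     (fun b => if (K0%:Z %| l * a - b)%Z
       then chi2 ((l * a - b) %/ K0%:Z)%Z / (q2%:R * (a%:~R * z) + ((l * a - b) %/ K0%:Z)%Z%:~R)
       else 0))))) in L2'; last first.
  apply/funext => M; rewrite -kE /isum !mulr_sumr -big_split /= mulr_sumr.
  under eq_bigr do rewrite mulr_sumr.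
  rewrite exchange_big /=; apply: eq_bigr => i' _.
  rewrite !mulr_sumr -big_split /= mulr_sumr; apply: eq_bigr => i _.
  exact: term_transformation.
have := tends_uniq L2' L3; set f1 := eisenstein_f _ _ z'; set f := eisenstein_f _ _ z.
move=> /(congr1 (fun x => fourier_const q2 chi2 / 2 * x)).
have -> : fourier_const q2 chi2 / 2 * (2 / fourier_const q2 chi2 * f1) = f1 by field.
move=> ->; move: f cot_sum (tau / _) => f cs t.
by field; rewrite c0.
Qed.

End Matrix.
End TransformationFormula.

(** * The Bernoulli function and its finite Fourier transform *)

Lemma det22 (A : comRingType) (M : 'M[A]_2) :
  \det M = M 0 0 * M 1 1 - M 0 1 * M 1 0.
Proof.
rewrite (expand_det_row _ 0) !big_ord_recl big_ord0 addr0 /cofactor !det_mx11 !mxE /=.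
rewrite expr0 expr1 mul1r mulN1r mulrN; congr (_ * M _ _ - M _ _ * M _ _);
  exact/val_inj.
Qed.

Section Bernoulli.
Variable F : numFieldType.

Definition bern1 (j : int) (k : nat) : F :=
  if (k%:Z %| j)%Z then 0 else (j %% k%:Z)%Z%:~R / k%:R - 2^-1.

Lemma bern1_mod k i j : (i = j %[mod k%:Z])%Z -> bern1 i k = bern1 j k.
Proof.
move=> h; rewrite /bern1 h; suff -> : (k%:Z %| i)%Z = (k%:Z %| j)%Z by [].
by apply/dvdz_mod0P/dvdz_mod0P; rewrite h.
Qed.

Lemma bern1_period k (j n : int) : bern1 (j + k%:Z * n) k = bern1 j k.
Proof.
by apply/bern1_mod/eqP; rewrite eqz_mod_dvd addrAC subrr add0r dvdz_mulr.
Qed.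

Lemma bern1_small k j : (0 < j < k)%N -> bern1 j%:Z k = j%:R / k%:R - 2^-1.
Proof.
move=> /andP[j0 jk]; rewrite /bern1 dvdzE !absz_nat gtnNdvd //.
by rewrite modz_nat modn_small // -pmulrn.
Qed.

Lemma bern1_zero k : bern1 0 k = 0.
Proof. by rewrite /bern1 dvdz0. Qed.

Lemma sum_mul_exp (x : F) k :
  (x - 1) * (\sum_(j < k) j%:R * x ^+ j) = k%:R * x ^+ k - x * \sum_(j < k) x ^+ j.
Proof.
elim: k => [|k IH]; first by rewrite !big_ord0 !mulr0 mul0r subr0.
rewrite !big_ord_recr /= !mulrDr IH -[k.+1%:R]natr1 exprS; ring.
Qed.

(** Eisenstein's transform of the sawtooth. At x = 1 the right side is 0 by the convention 1/0 = 0,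
    which is the correct value because B_1 is odd. *)
Lemma bern1_fourier (x : F) k : (0 < k)%N -> x ^+ k = 1 ->
  \sum_(j < k) bern1 j%:Z k * x ^+ j = - ((1 + x) / (1 - x)) / 2.
Proof.
case: k => // k _ xk; have kn : k.+1%:R != 0 :> F by rewrite pnatr_eq0.
(* The last 1/2 corrects the term j = 0, where B_1 is 0 and not -1/2. *)
have E : \sum_(j < k.+1) bern1 j%:Z k.+1 * x ^+ j =
    k.+1%:R^-1 * (\sum_(j < k.+1) j%:R * x ^+ j) - 2^-1 * (\sum_(j < k.+1) x ^+ j) + 2^-1.
  rewrite !mulr_sumr -sumrB !big_ord_recl /= bern1_zero !mul0r mulr0 expr0 mulr1 sub0r.
  rewrite addrAC addNr; congr (_ + _); apply: eq_bigr => j _.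
  rewrite bern1_small; last by rewrite /bump /= add1n ltnS ltn_ord.
  by rewrite /bump /=; field.
rewrite E (sum_unity xk); case: eqP => [x1|/eqP x1].
  rewrite x1 subrr invr0 mulr0 oppr0 mul0r.
  have -> : \sum_(j < k.+1) (j%:R : F) * 1 ^+ j = k.+1%:R * k%:R / 2.
    elim: (k) => [|n IH]; first by rewrite big_ord_recl big_ord0 mul0r mulr0 mul0r addr0.
    rewrite big_ord_recr /= IH expr1n -[n.+2%:R]natr1 -[n.+1%:R]natr1.
    by move: (n%:R) => y; field.
  by rewrite -[in X in _ - X](natr1) -[in X in _ * X / 2](addrK 1 k%:R) natr1; field.
have d1 : x - 1 != 0 by rewrite subr_eq0.
have -> : \sum_(j < k.+1) j%:R * x ^+ j = k.+1%:R / (x - 1).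
  apply: (mulfI d1); rewrite sum_mul_exp xk mulr1 sum_unity // (negPf x1) mulr0 subr0.
  by rewrite mulrCA divff ?mulr1.
have d2 : 1 - x != 0 by rewrite subr_eq0 eq_sym.
by rewrite mulr0 subr0 mulKf //; field; rewrite d1 d2.
Qed.

End Bernoulli.

Lemma isum_period (V : nmodType) (q : nat) (F : int -> V) (c : int) :
  (forall m n, F (m + q%:Z * n) = F m) -> isum c q F = \sum_(r < q) F r%:Z.
Proof.
move=> hF; rewrite /isum (@sum_mod_bij _ q F (fun r => c + r)) //.
  by move=> m; have := hF m 1; rewrite mulr1.
move=> i j iq jq /eqP; rewrite eqz_mod_dvd opprD addrACA subrr add0r.
by rewrite -eqz_mod_dvd !modz_nat eqz_nat !modn_small // => /eqP.
Qed.

(** * From cotangents to the Bernoulli form *)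

Section FiniteFormula.
Variable R : realType.
Variables (q1 q2 : nat) (chi1 chi2 : int -> R[i]).
Hypotheses (q1_gt1 : (1 < q1)%N) (q2_gt1 : (1 < q2)%N).
Hypotheses (p1 : primitive_character q1 chi1) (p2 : primitive_character q2 chi2).
Hypothesis parity : chi1 (-1) * chi2 (-1) = 1.

Let h1 := proj1 p1.
Let h2 := proj1 p2.
Let q1_gt0 : (0 < q1)%N := ltnW q1_gt1.
Let q2_gt0 : (0 < q2)%N := ltnW q2_gt1.

Local Notation tau := (two_pi_i R).
Local Notation g1 := (gauss_sum q1 chi1).
Local Notation g2 := (gauss_sum q2 chi2).
Local Notation B := (@bern1 R[i]).

(* [bern1 j k] is B_1(j / k); as [q1 %| k], the second factor is
   B_1(n / q1 - l j / k). *)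
Definition dedekind_sum (k : nat) (l : int) : R[i] :=
  \sum_(j < k) \sum_(n < q1) (chi2 j%:Z)^* * (chi1 n%:Z)^* *
    (B j%:Z k * B (n%:Z * (k %/ q1)%N%:Z - l * j%:Z) k).

Lemma cayley_bern1 (k r : nat) : (0 < k)%N ->
  cayley (ek R k r%:Z) = - 2 * \sum_(j < k) B j%:Z k * ek R k (j%:Z * r%:Z).
Proof.
move=> k0; have h : ek R k r%:Z ^+ k = 1 by rewrite -ekM ek_mulk.
have -> : \sum_(j < k) B j%:Z k * ek R k (j%:Z * r%:Z) =
   \sum_(j < k) B j%:Z k * ek R k r%:Z ^+ j.
  by apply: eq_bigr => j _; rewrite -ekM; congr (_ * ek R k _); exact: mulrC.
by rewrite bern1_fourier // -/(cayley _); move: (cayley _) => y; field.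
Qed.

Variables (k K0 : nat) (l : int).
Hypotheses (k_gt0 : (0 < k)%N) (kE : k = (K0 * q2)%N) (qK : (q1 %| K0)%N).

Let K0_gt0 : (0 < K0)%N.
Proof. by move: k_gt0; rewrite kE muln_gt0 => /andP[]. Qed.

Let D := (k %/ q1)%N.

Let kD : k = (q1 * D)%N.
Proof. by rewrite mulnC divnK // kE dvdn_mulr. Qed.

Let D_gt0 : (0 < D)%N.
Proof. by move: k_gt0; rewrite kD muln_gt0 => /andP[]. Qed.

(** The r that contribute are l a' - K0 t with t modulo q2, so the sum is a twisted Gauss sum of
    chi2 in t. *)
Lemma theta_sum_r (a' j : int) :
  \sum_(r < k) Theta chi1 chi2 l K0 a' r%:Z * ek R k (j * r%:Z) =
  chi1 a' * ek R k (j * l * a') * ((chi2 (- j))^* * g2).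
Proof.
pose F t := chi2 t * ek R k (j * (l * a' - K0%:Z * t)).
have E : \sum_(r < k) Theta chi1 chi2 l K0 a' r%:Z * ek R k (j * r%:Z) = chi1 a' *
    isum (- (K0 * 0)%N%:Z) (K0 * q2)
     (fun b => if (K0%:Z %| l * a' - b)%Z then F ((l * a' - b) %/ K0%:Z)%Z else 0).
  rewrite /isum -kE mulr_sumr; apply: eq_bigr => r _.
  rewrite muln0 oppr0 add0r /Theta; case: ifP => hd; last by rewrite mul0r mulr0.
  rewrite /F -mulrA; congr (_ * (_ * ek _ _ (_ * _))).
  by rewrite [K0%:Z * _]mulrC divzK //; ring.
rewrite E isum_progressionN // isum_period.
  rewrite -mulrA; congr (_ * _); rewrite -(gauss_sum_twist q2_gt1 p2) mulr_sumr.
  apply: eq_bigr => t _; rewrite /F [RHS]mulrCA; congr (_ * _).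
  have -> : j * (l * a' - K0%:Z * t%:Z) = j * l * a' + K0%:Z * (- j * t%:Z) by ring.
  by rewrite ekD kE ek_mull.
move=> m n; rewrite /F (chi_modD h2); congr (_ * _).
have -> : j * (l * a' - K0%:Z * (m + q2%:Z * n)) =
   j * (l * a' - K0%:Z * m) + (- (j * n)) * k%:Z by rewrite kE PoszM; ring.
by rewrite ekD ek_mulk // mulr1.
Qed.

(** After the sum over r, the sum over r' is a Gauss sum of chi1 induced to the modulus k = q1 D; it
    forces D to divide j' + l j. *)
Lemma theta_sum (j' j : int) :
  \sum_(r' < k) \sum_(r < k) Theta chi1 chi2 l K0 r'%:Z r%:Z *
     (ek R k (j' * r'%:Z) * ek R k (j * r%:Z)) =
  (if (D%:Z %| j' - - (l * j))%Z then (chi1 ((j' - - (l * j)) %/ D%:Z)%Z)^* else 0) *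
    (D%:R * g1 * ((chi2 (- j))^* * g2)).
Proof.
transitivity ((\sum_(r' < k) chi1 r'%:Z * ek R k ((j' - - (l * j)) * r'%:Z)) *
    ((chi2 (- j))^* * g2)).
  rewrite mulr_suml; apply: eq_bigr => r' _.
  have -> : ek R k ((j' - - (l * j)) * r'%:Z) = ek R k (j' * r'%:Z) * ek R k (j * l * r'%:Z).
    by rewrite -ekD; congr (ek R k _); ring.
  transitivity (ek R k (j' * r'%:Z) *
    (chi1 r'%:Z * ek R k (j * l * r'%:Z) * ((chi2 (- j))^* * g2))); last by ring.
  rewrite -theta_sum_r mulr_sumr.
  by apply: eq_bigr => r _; ring.
rewrite kD (gauss_sum_induced q1_gt1 p1) //; case: ifP => _; last by rewrite !mul0r.
by ring.
Qed.

(** Both cotangents are expanded in values of B_1, whence 4 = (-2)^2, and the sums over r and r' are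
    carried out. The surviving j' are n D - l j with n modulo q1, which creates the second summation
    variable. *)
Lemma cot_sumE : cot_sum chi1 chi2 l k K0 =
  4 * D%:R * g1 * g2 * chi2 (-1) * dedekind_sum k l.
Proof.
have -> : cot_sum chi1 chi2 l k K0 = \sum_(j < k) \sum_(j' < k) 4 * (B j'%:Z k * B j%:Z k) *
   \sum_(r' < k) \sum_(r < k) Theta chi1 chi2 l K0 r'%:Z r%:Z *
     (ek R k (j'%:Z * r'%:Z) * ek R k (j%:Z * r%:Z)).
  transitivity (\sum_(r' < k) \sum_(r < k) \sum_(j < k) \sum_(j' < k)
     4 * (B j'%:Z k * B j%:Z k) * (Theta chi1 chi2 l K0 r'%:Z r%:Z *
     (ek R k (j'%:Z * r'%:Z) * ek R k (j%:Z * r%:Z)))).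
    apply: eq_bigr => r' _; apply: eq_bigr => r _.
    rewrite !cayley_bern1 //; 
    set S1 := \sum_(j < k) B j%:Z k * ek R k (j%:Z * r'%:Z).
    set S2 := \sum_(j < k) B j%:Z k * ek R k (j%:Z * r%:Z).
    transitivity (4 * Theta chi1 chi2 l K0 r'%:Z r%:Z * (S2 * S1)); first by ring.
    rewrite big_distrlr /= mulr_sumr; apply: eq_bigr => j _.
    by rewrite mulr_sumr; apply: eq_bigr => j' _; ring.
  under eq_bigr do rewrite exchange_big /=.
  rewrite exchange_big /=; apply: eq_bigr => j _.
  under eq_bigr do rewrite exchange_big /=.
  rewrite exchange_big /=; apply: eq_bigr => j' _.
  by rewrite mulr_sumr; apply: eq_bigr => r' _; rewrite mulr_sumr.
rewrite /dedekind_sum mulr_sumr; apply: eq_bigr => j _.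
pose c : int := - (l * j%:Z).
pose F n := (chi1 n)^* * B (n * D%:Z + c) k.
have per m n : F (m + q1%:Z * n) = F m.
  rewrite /F (chi_modD h1); congr (_ * _).
  have kZ : k%:Z = q1%:Z * D%:Z by rewrite -PoszM -kD.
  have -> : (m + q1%:Z * n) * D%:Z + c = m * D%:Z + c + k%:Z * n by rewrite kZ; ring.
  by rewrite bern1_period.
have E : \sum_(j' < k) (if (D%:Z %| j'%:Z - c)%Z then
     (chi1 ((j'%:Z - c) %/ D%:Z)%Z)^* * B j'%:Z k else 0) =
   \sum_(n < q1) (chi1 n%:Z)^* * B (n%:Z * D%:Z - l * j%:Z) k.
  transitivity (isum (- (D * 0)%N%:Z) (D * q1) (fun b =>
     if (D%:Z %| b - c)%Z then F ((b - c) %/ D%:Z)%Z else 0)).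
    rewrite /isum mulnC -kD; apply: eq_bigr => j' _; rewrite muln0 oppr0 add0r.
    by case: ifP => hd //; rewrite /F divzK // subrK.
  by rewrite isum_progression // isum_period.
have c2 := conj_chiN1 q2_gt1 h2.
transitivity (4 * D%:R * g1 * g2 * chi2 (-1) * ((chi2 j%:Z)^* * B j%:Z k) *
    \sum_(j' < k) (if (D%:Z %| j'%:Z - c)%Z then
     (chi1 ((j'%:Z - c) %/ D%:Z)%Z)^* * B j'%:Z k else 0)).
  rewrite mulr_sumr; apply: eq_bigr => j' _; rewrite theta_sum (chiN h2) rmorphM /= c2.
  by case: ifP => _; [ring|rewrite !(mul0r, mulr0)].
rewrite E -mulrA; congr (_ * _); rewrite mulr_sumr; apply: eq_bigr => n _.
by rewrite -!mulrA; congr (_ * _); rewrite mulrCA.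
Qed.

End FiniteFormula.

Section NewformFormula.
Variable R : realType.
Variables (q1 q2 : nat) (chi1 chi2 : int -> R[i]).
Hypotheses (q1_gt1 : (1 < q1)%N) (q2_gt1 : (1 < q2)%N).
Hypotheses (p1 : primitive_character q1 chi1) (p2 : primitive_character q2 chi2).
Hypothesis parity : chi1 (-1) * chi2 (-1) = 1.

(** Only constants remain to be collected: the Gauss sums of chi1 and its conjugate multiply to
    chi1(-1) q1, that of chi2 cancels against [fourier_const], and parity removes the last sign.
    Compared with the classical finite form, the upper left entry is traded for the lower right one
    at the price of the factor -psi(g). *)
Lemma newform_formula (z : R[i]) (g : 'M[int]_2) (k : nat) : 0 < complex.Im z ->
  Gamma0 (q1 * q2) g -> (0 < k)%N -> g 1 0 = k%:Z ->
  newform_dedekind_sum q1 chi1 chi2 z g =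
    - psi chi1 chi2 g * dedekind_sum q1 chi1 chi2 k (g 1 1).
Proof.
move=> hz [hdet hN] k0 gk; pose K0 := (k %/ q2)%N.
have Nk : (q1 * q2 %| k)%N by move: hN; rewrite gk dvdzE !absz_nat.
have kE : k = (K0 * q2)%N by rewrite divnK // (dvdn_trans _ Nk) // dvdn_mull.
have qK : (q1 %| K0)%N.
  by move: Nk; rewrite {1}kE dvdn_pmul2r // ltnW.
have hd : g 0 0 * g 1 1 - g 0 1 * k%:Z = 1 by rewrite -gk -det22.
have := transformation q1_gt1 q2_gt1 p1 p2 parity k0 kE qK hd hz.
rewrite /newform_dedekind_sum /moebius gk -pmulrn => ->.
rewrite (cot_sumE q1_gt1 q2_gt1 p1 p2) // /psi -/(psi0 chi1 chi2 (g 1 1)).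
set P := psi0 _ _ _; set S := dedekind_sum _ _ _ _ _.
have pE : (pi%:C%C * 'i%C : R[i]) = two_pi_i R / 2.
  apply: (mulIf (_ : 2 != 0 :> R[i])); first by rewrite pnatr_eq0.
  rewrite mulfVK ?pnatr_eq0 // /two_pi_i mulrC -(rmorph_nat (real_complex R)).
  by simpc.
rewrite pE /fourier_const.
have g0 : gauss_sum q2 chi2 != 0 := gauss_sum_neq0 q2_gt1 p2.
have t0 := @two_pi_i_neq0 R.
have gg := gauss_sum_mul q1_gt1 p1.
have kR : (k%:R : R[i]) != 0 by rewrite pnatr_eq0 -lt0n.
set D := (k %/ q1)%N.
have kD : (k%:R = q1%:R * D%:R :> R[i]).
  by rewrite -natrM mulnC divnK // (dvdn_trans _ Nk) // dvdn_mulr.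
have kK : (k%:R = K0%:R * q2%:R :> R[i]) by rewrite -natrM -kE.
transitivity (- P * S * (chi1 (-1) * chi2 (-1)) * (q1%:R * D%:R) * (K0%:R * q2%:R) / k%:R ^+ 2).
  transitivity (- P * S * ((gauss_sum q1 (fun n => (chi1 n)^*) * gauss_sum q1 chi1) *
     chi2 (-1)) * D%:R * (K0%:R * q2%:R) / k%:R ^+ 2); last by rewrite gg; ring.
  move: (gauss_sum q1 _) (gauss_sum q1 chi1) => u v.
  move: (K0%:R) (D%:R) (q2%:R) (k%:R) kR (gauss_sum q2 chi2) g0 (two_pi_i R) t0.
  move=> K D' q k' kn g2 gn t tn; field.
  by rewrite kn gn tn.
rewrite parity -kD -kK; move: (k%:R) kR => k' kn; field.
exact: kn.
Qed.

End NewformFormula.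

(** * Integer matrices of determinant 1 *)

Lemma mulz_eq1_cases (x y : int) : x * y = 1 ->
  (x = 1 /\ y = 1) \/ (x = -1 /\ y = -1).
Proof.
move=> h; have := congr1 absz h; rewrite abszM => /eqP; rewrite muln_eq1 => /andP[/eqP hx _].
have [e|e] : x = 1 \/ x = -1 by move: hx; clear; lia.
  by left; split=> //; move: h; rewrite e mul1r.
by right; split=> //; move: h; rewrite e mulN1r => /(congr1 -%R); rewrite opprK.
Qed.

Section Matrices.
Implicit Types g : 'M[int]_2.

Definition mx2 (a b c d : int) : 'M[int]_2 :=
  \matrix_(i, j) if i == 0 then (if j == 0 then a else b) else (if j == 0 then c else d).

Lemma mx2E g : g = mx2 (g 0 0) (g 0 1) (g 1 0) (g 1 1).
Proof.
apply/matrixP => i j; rewrite mxE.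
by case: i j => [[|[|//]] hi] [[|[|//]] hj] /=; congr (g _ _); apply/val_inj.
Qed.

Lemma mx2_00 a b c d : mx2 a b c d 0 0 = a. Proof. by rewrite mxE. Qed.
Lemma mx2_01 a b c d : mx2 a b c d 0 1 = b. Proof. by rewrite mxE. Qed.
Lemma mx2_10 a b c d : mx2 a b c d 1 0 = c. Proof. by rewrite mxE. Qed.
Lemma mx2_11 a b c d : mx2 a b c d 1 1 = d. Proof. by rewrite mxE. Qed.
Definition mx2_entries := (mx2_00, mx2_01, mx2_10, mx2_11).

Lemma mul_mx2 a b c d a' b' c' d' : mx2 a b c d *m mx2 a' b' c' d' =
  mx2 (a * a' + b * c') (a * b' + b * d') (c * a' + d * c') (c * b' + d * d').
Proof.
rewrite [LHS]mx2E; congr mx2; rewrite !mxE !big_ord_recl big_ord0 addr0 !mxE //=.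
Qed.

Lemma det_mx2 a b c d : \det (mx2 a b c d) = a * d - b * c.
Proof. by rewrite det22 !mx2_entries. Qed.

Lemma mx2_1 : mx2 1 0 0 1 = 1%:M.
Proof. by rewrite [RHS]mx2E !mxE. Qed.

(** The adjugate, which is the inverse in determinant 1. *)
Definition inv2 g := mx2 (g 1 1) (- g 0 1) (- g 1 0) (g 0 0).

Lemma mul_inv2 g : \det g = 1 -> g *m inv2 g = 1%:M.
Proof.
rewrite det22 => h; rewrite {1}[g]mx2E /inv2 mul_mx2 -mx2_1.
by congr mx2; rewrite ?mulrN -?h; ring.
Qed.

Lemma inv2_mul g : \det g = 1 -> inv2 g *m g = 1%:M.
Proof.
rewrite det22 => h; rewrite [X in _ *m X]mx2E /inv2 mul_mx2 -mx2_1.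
by congr mx2; rewrite ?mulrN -?h; ring.
Qed.

Lemma det_inv2 g : \det (inv2 g) = \det g.
Proof. by rewrite det_mx2 det22; ring. Qed.

(** Euclid's algorithm on the first column: a power of the translation followed by the inversion
    replaces the lower left entry c by the remainder of a modulo c. When c = 0 the matrix is a
    translation up to sign, and the sign is the square of the inversion. *)
Lemma SL2_generation (P : 'M[int]_2 -> Prop) :
  (forall g g', \det g = 1 -> \det g' = 1 -> P g -> P g' -> P (g *m g')) ->
  (forall g, \det g = 1 -> P g -> P (inv2 g)) ->
  P (mx2 0 (-1) 1 0) -> P (mx2 1 1 0 1) -> forall g, \det g = 1 -> P g.
Proof.
move=> PM PV PS PT; pose T n := mx2 1 n 0 1; pose J := mx2 0 (-1) 1 0.
have dT n : \det (T n) = 1 by rewrite det_mx2; ring.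
have dJ : \det J = 1 by rewrite det_mx2; ring.
have TD m n : T m *m T n = T (m + n) by rewrite mul_mx2; congr mx2; ring.
have P1 : P 1%:M by rewrite -(mul_inv2 dJ); apply: PM; rewrite ?det_inv2 //; apply: PV.
have PTn (n : nat) : P (T n%:Z).
  elim: n => [|n IH]; first by rewrite /T mx2_1.
  by rewrite intS -TD; apply: PM.
have PTz n : P (T n).
  case: n => n; first exact: PTn.
  have -> : T (Negz n) = inv2 (T n.+1%:Z) by rewrite /inv2 /T !mx2_entries NegzE oppr0.
  by apply: PV.
have PN : P (mx2 (-1) 0 0 (-1)).
  have -> : mx2 (-1) 0 0 (-1) = J *m J by rewrite mul_mx2; congr mx2; ring.
  exact: PM.
suff main n g : \det g = 1 -> (`|(g 1 0)%R|%N < n)%N -> P g by move=> g hg; apply: main hg (leqnn _).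
elim: n g => // n IH g hg hn.
case: (eqVneq (g 1 0) 0) => c0.
  have h : g 0 0 * g 1 1 = 1 by move: hg; rewrite det22 c0 mulr0 subr0.
  have [[h1 h2]|[h1 h2]] : (g 0 0 = 1 /\ g 1 1 = 1) \/ (g 0 0 = -1 /\ g 1 1 = -1).
    exact: mulz_eq1_cases.
    by rewrite [g]mx2E c0 h1 h2; apply: PTz.
  have -> : g = mx2 (-1) 0 0 (-1) *m T (- g 0 1).
    by rewrite {1}[g]mx2E c0 h1 h2 mul_mx2; congr mx2; ring.
  by apply: (PM) => //; rewrite det_mx2; ring.
pose q := ((g 0 0)%R %/ (g 1 0)%R)%Z.
pose g' := J *m (T (- q) *m g).
have dg' : \det g' = 1 by rewrite !det_mulmx dJ dT hg.
have -> : g = T q *m (inv2 J *m g').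
  rewrite /g' (mulmxA (inv2 J)) inv2_mul // mul1mx mulmxA TD subrr.
  by rewrite /T mx2_1 mul1mx.
apply: (PM) => //; first by rewrite det_mulmx det_inv2 dJ dg'.
apply: (PM) => //; rewrite ?det_inv2 //; first exact: PV.
apply: (IH) => //.
have -> : g' 1 0 = ((g 0 0)%R %% (g 1 0)%R)%Z.
  rewrite /g' [X in J *m (_ *m X)]mx2E /J /T !mul_mx2 !mx2_entries /modz -/q.
  by ring.
by apply: leq_trans (_ : (`|(g 1 0)%R|%N <= n)%N) => //; rewrite -ltz_nat abszE ger0_norm ?modz_ge0 // ltz_mod.
Qed.

End Matrices.

(** * Gamma_1 and the finite generation of its image *)

Section Gamma1Group.
Variable N : nat.
Hypothesis N_gt0 : (0 < N)%N.
Implicit Types g : 'M[int]_2.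

Definition cong g g' := forall i j, ((g i j)%R = (g' i j)%R %[mod N%:Z])%Z.

Lemma modz_mul2 (a b a' b' : int) : (a = a' %[mod N%:Z])%Z -> (b = b' %[mod N%:Z])%Z ->
  (a * b = a' * b' %[mod N%:Z])%Z.
Proof. by move=> h1 h2; rewrite -modzMml h1 modzMml -modzMmr h2 modzMmr. Qed.

Lemma modz_add2 (a b a' b' : int) : (a = a' %[mod N%:Z])%Z -> (b = b' %[mod N%:Z])%Z ->
  (a + b = a' + b' %[mod N%:Z])%Z.
Proof. by move=> h1 h2; rewrite -modzDml h1 modzDml -modzDmr h2 modzDmr. Qed.

Lemma modz_opp2 (a a' : int) : (a = a' %[mod N%:Z])%Z -> (- a = - a' %[mod N%:Z])%Z.
Proof. by move=> h1; have := modz_mul2 (erefl ((-1) %% N%:Z)%Z) h1; rewrite !mulN1r. Qed.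

Lemma cong_mul g1 g2 h1 h2 : cong g1 h1 -> cong g2 h2 -> cong (g1 *m g2) (h1 *m h2).
Proof.
move=> c1 c2 i j; rewrite !mxE !big_ord_recl !big_ord0 !addr0.
by apply: modz_add2; apply: modz_mul2.
Qed.

Lemma cong_refl g : cong g g. Proof. by []. Qed.

Lemma Gamma1E g : Gamma1 N g <-> \det g = 1 /\
  [/\ ((g 1 0)%R = 0 %[mod N%:Z])%Z, ((g 0 0)%R = 1 %[mod N%:Z])%Z & ((g 1 1)%R = 1 %[mod N%:Z])%Z].
Proof.
have E : (N%:Z %| (g 1 0)%R)%Z <-> ((g 1 0)%R = 0 %[mod N%:Z])%Z.
  by rewrite -[X in (_ %| X)%Z]subr0 -eqz_mod_dvd; split=> /eqP.
by split=> [[[hd /E]]|[hd [/E]]].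
Qed.

Lemma Gamma1_det g : Gamma1 N g -> \det g = 1.
Proof. by case=> -[]. Qed.

Lemma Gamma1_cong g h : cong g h -> \det g = 1 -> Gamma1 N h -> Gamma1 N g.
Proof. by move=> c dg /Gamma1E[_ [h1 h2 h3]]; apply/Gamma1E; rewrite !c. Qed.

Lemma Gamma1_1 : Gamma1 N 1%:M.
Proof. by apply/Gamma1E; rewrite det1 !mxE. Qed.

Lemma Gamma1_mul g h : Gamma1 N g -> Gamma1 N h -> Gamma1 N (g *m h).
Proof.
move=> /Gamma1E[dg [g1 g2 g3]] /Gamma1E[dh [h1 h2 h3]]; apply/Gamma1E.
rewrite det_mulmx dg dh [g]mx2E [h]mx2E mul_mx2 !mx2_entries; split=> //; split.
- rewrite -[X in (_ = X %[mod _])%Z](_ : 0 * h 0 0 + g 1 1 * 0 = 0); last by ring.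
  by apply: modz_add2; apply: modz_mul2.
- rewrite -[X in (_ = X %[mod _])%Z](_ : 1 * 1 + g 0 1 * 0 = 1); last by ring.
  by apply: modz_add2; apply: modz_mul2.
- rewrite -[X in (_ = X %[mod _])%Z](_ : 0 * h 0 1 + 1 * 1 = 1); last by ring.
  by apply: modz_add2; apply: modz_mul2.
Qed.

Lemma Gamma1_inv g : Gamma1 N g -> Gamma1 N (inv2 g).
Proof.
move=> /Gamma1E[dg [g1 g2 g3]]; apply/Gamma1E.
rewrite det_inv2 /inv2 !mx2_entries; split=> //; split=> //.
by rewrite -[X in (_ = X %[mod _])%Z]oppr0; apply: modz_opp2.
Qed.

Lemma cong_Gamma1 g h : cong g h -> \det g = 1 -> \det h = 1 -> Gamma1 N (g *m inv2 h).
Proof.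
move=> c dg dh; apply: (@Gamma1_cong _ (h *m inv2 h)).
- by apply: cong_mul => //; apply: cong_refl.
- by rewrite det_mulmx det_inv2 dg dh.
- by rewrite mul_inv2 //; apply: Gamma1_1.
Qed.

Section FiniteGeneration.
Variable (V : zmodType) (S : 'M[int]_2 -> V).
Hypothesis hS : forall g h, Gamma1 N g -> Gamma1 N h -> S (g *m h) = S g + S h.

Lemma hom1 : S 1%:M = 0.
Proof.
have := hS Gamma1_1 Gamma1_1; rewrite mul1mx => /eqP.
by rewrite -subr_eq0 opprD addrA subrr sub0r oppr_eq0 => /eqP.
Qed.

Lemma homV g : Gamma1 N g -> S (inv2 g) = - S g.
Proof.
move=> hg; apply/eqP; rewrite -addr_eq0 -hS //; last exact: Gamma1_inv.
by rewrite inv2_mul ?hom1 //; apply: Gamma1_det.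
Qed.

Let K : finType := 'M['I_N.-1.+1]_2.

(** The class of g modulo N as an element of a finite type, so that classes can be enumerated;
    [N.-1.+1] is N since N > 0. These classes are finer than the cosets of Gamma_1. *)
Definition key g : K := \matrix_(i, j) inord `|((g i j)%R %% N%:Z)%Z|%N.

Lemma key_cong g h : key g = key h <-> cong g h.
Proof.
have lt (m : int) : (`|(m %% N%:Z)%Z|%N < N.-1.+1)%N.
  by rewrite prednK // -ltz_nat gez0_abs ?modz_ge0 ?eqz_nat -?lt0n // ltz_mod // eqz_nat -lt0n.
split=> [/matrixP e i j|c]; last by apply/matrixP => i j; rewrite !mxE c.
have := congr1 (@nat_of_ord _) (e i j); rewrite !mxE !inordK // => /(congr1 Posz).
by rewrite !gez0_abs ?modz_ge0 ?eqz_nat -?lt0n.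
Qed.

(** A class without a matrix of determinant 1 receives the identity, so [rep_det] holds
    unconditionally. *)
Definition rep (k : K) : 'M[int]_2 := xget 1%:M [set g | \det g = 1 /\ key g = k].

Lemma rep_det k : \det (rep k) = 1.
Proof. by rewrite /rep; case: xgetP => [g _ []|_]; rewrite ?det1. Qed.

Lemma rep_cong g : \det g = 1 -> cong (rep (key g)) g.
Proof.
move=> dg; apply/key_cong; rewrite /rep; case: xgetP => [h _ []//|/(_ g)].
by case; split.
Qed.

(** Schreier's lemma, stated on the image: every set that contains the values in [W] and is closed
    under subtraction contains all values of S. *)
Lemma finite_generation : exists W : seq V,
  (forall x, x \in W -> exists2 g, Gamma1 N g & x = S g) /\
  forall A : V -> Prop, A 0 -> (forall x y, A x -> A y -> A (x - y)) ->
    (forall x, x \in W -> A x) -> forall g, Gamma1 N g -> A (S g).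
Proof.
pose J := mx2 0 (-1) 1 0; pose T := mx2 1 1 0 1.
have dJ : \det J = 1 by rewrite det_mx2; ring.
have dT : \det T = 1 by rewrite det_mx2; ring.
(* The Schreier generators, for s one of the two generators of SL_2(Z); they are congruent to the
   identity. *)
pose w s k := rep k *m s *m inv2 (rep (key (rep k *m s))).
have dw s k : \det s = 1 -> \det (rep k *m s) = 1 by move=> ds; rewrite det_mulmx ds rep_det.
have hw s k : \det s = 1 -> Gamma1 N (w s k).
  move=> ds; apply: cong_Gamma1; rewrite ?rep_det ?dw //.
  by move=> i j; apply/esym/rep_cong/dw.
(* Classes modulo N are finer than cosets of Gamma_1, so the representatives that lie in Gamma_1
   must be added to the generators; 1 fills the other places. *)
pose u k := if `[< Gamma1 N (rep k) >] then rep k else 1%:M.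
have hu k : Gamma1 N (u k) by rewrite /u; case: asboolP => // _; apply: Gamma1_1.
pose W := [seq S (w J k) | k : K] ++ ([seq S (w T k) | k : K] ++ [seq S (u k) | k : K]).
exists W; split.
  move=> x; rewrite !mem_cat => /orP[|/orP[]] /mapP[k _ ->].
  - by exists (w J k) => //; apply: hw.
  - by exists (w T k) => //; apply: hw.
  - by exists (u k).
move=> A A0 AB AW g hg.
have AN x : A x -> A (- x) by move=> Ax; rewrite -sub0r; apply: (AB).
have AD x y : A x -> A y -> A (x + y) by move=> Ax Ay; rewrite -[y]opprK; apply: (AB) => //; apply: AN.
pose t g := rep (key g).
(* [c] is S on the part of g congruent to the identity. Multiplying the argument by a generator s
   changes [c] by the value of S at one Schreier generator, so [SL2_generation] reaches every g. *)
pose c g := S (g *m inv2 (t g)).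
have ct h : \det h = 1 -> Gamma1 N (h *m inv2 (t h)).
  move=> dh; apply: cong_Gamma1; rewrite ?rep_det // => i j.
  by apply/esym/rep_cong.
have step s : \det s = 1 -> (forall k, A (S (w s k))) ->
    forall h, \det h = 1 -> A (c (h *m s) - c h).
  move=> ds As h dh.
  have dhs : \det (h *m s) = 1 by rewrite det_mulmx dh ds.
  have kk : key (rep (key h) *m s) = key (h *m s).
    by apply/key_cong; apply: cong_mul; [exact: rep_cong|exact: cong_refl].
  have -> : c (h *m s) - c h = S (w s (key h)); last exact: As.
  apply/eqP; rewrite subr_eq addrC -hS //; [|exact: ct|exact: hw].
  rewrite /c /w kk -/(t h) -/(t (h *m s)) !mulmxA.
  by rewrite -(mulmxA h (inv2 (t h)) (t h)) inv2_mul ?rep_det // mulmx1.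
have all h : \det h = 1 -> forall h0, \det h0 = 1 -> A (c (h0 *m h) - c h0).
  apply: (@SL2_generation (fun h => forall h0, \det h0 = 1 -> A (c (h0 *m h) - c h0))).
  - move=> h1 h2 d1 d2 H1 H2 h0 d0.
    have -> : c (h0 *m (h1 *m h2)) - c h0 =
      (c (h0 *m h1 *m h2) - c (h0 *m h1)) + (c (h0 *m h1) - c h0).
      by rewrite addrA subrK mulmxA.
    by apply: (AD); [apply: H2; rewrite det_mulmx d0 d1|apply: H1].
  - move=> h1 d1 H1 h0 d0.
    have := H1 (h0 *m inv2 h1); rewrite det_mulmx det_inv2 d0 d1 -mulmxA inv2_mul // mulmx1.
    by move=> /(_ erefl) /AN; rewrite opprB.
  - apply: (step) => // k; apply: (AW); rewrite mem_cat; apply/orP; left; by apply/mapP; exists k; rewrite ?mem_enum.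
  - apply: (step) => // k; apply: (AW); rewrite !mem_cat; apply/orP; right; apply/orP; left; by apply/mapP; exists k; rewrite ?mem_enum.
have dg := Gamma1_det hg.
have tG h : Gamma1 N h -> Gamma1 N (t h).
  by move=> hh; apply: (Gamma1_cong (rep_cong (Gamma1_det hh))); rewrite ?rep_det.
have At h : Gamma1 N h -> A (S (t h)).
  move=> hh; have -> : t h = u (key h) by rewrite /u; case: asboolP => //; case; exact: tG.
  by apply: (AW); rewrite !mem_cat; apply/orP; right; apply/orP; right; apply/mapP; exists (key h); rewrite ?mem_enum.
have cE h : Gamma1 N h -> S h = c h + S (t h).
  move=> hh; rewrite -hS; [|exact: ct (Gamma1_det hh)|exact: tG].
  by rewrite -mulmxA inv2_mul ?rep_det // mulmx1.
rewrite cE //; apply: (AD); last exact: At.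
have -> : c g = (c (1%:M *m g) - c 1%:M) + (0 - S (t 1%:M)).
  rewrite mul1mx addrA addr0 -addrA -opprD -cE ?hom1 ?oppr0 ?addr0 //; exact: Gamma1_1.
apply: (AD); first by apply: all; rewrite ?det1.
by apply: (AB) => //; apply: (At); exact: Gamma1_1.
Qed.

End FiniteGeneration.
End Gamma1Group.

(** * The action on the upper half plane *)

Section UpperHalfPlane.
Variable R : realType.
Implicit Types (z : R[i]) (g : 'M[int]_2).

Lemma moebius_denom_neq0 g z : \det g = 1 -> 0 < complex.Im z ->
  (g 1 0)%:~R * z + (g 1 1)%:~R != 0.
Proof.
rewrite det22 => hd hz; apply/eqP => e.
have c0 : g 1 0 = 0.
  have := congr1 (@complex.Im R) e; rewrite -!(rmorph_int (real_complex R)).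
  case: (z) hz => u v /= hv; rewrite mul0r !addr0 => /eqP.
  by rewrite mulf_eq0 intr_eq0 (gt_eqF hv) orbF => /eqP.
move: hd e; rewrite c0 mulr0 subr0 mul0r add0r => hd /eqP; rewrite intr_eq0 => /eqP d0.
by move: hd; rewrite d0 mulr0.
Qed.

Lemma Im_moebius g z : \det g = 1 ->
  complex.Im (moebius g z) = complex.Im z / nm ((g 1 0)%:~R * z + (g 1 1)%:~R) ^+ 2.
Proof.
rewrite det22 => hdet; have hd : ((g 0 0)%:~R * (g 1 1)%:~R - (g 0 1)%:~R * (g 1 0)%:~R : R) = 1.
  by rewrite -!intrM -intrB hdet.
rewrite nm_sqr /moebius -!(rmorph_int (real_complex R)).
case: z => u v /=; rewrite !mul0r !subr0 !addr0 !mulrN.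
set D := (_ + _ ^+ 2)^-1.
transitivity (((g 0 0)%:~R * (g 1 1)%:~R - (g 0 1)%:~R * (g 1 0)%:~R) * v * D); first by ring.
by rewrite hd mul1r.
Qed.

Lemma Im_moebius_gt0 g z : \det g = 1 -> 0 < complex.Im z -> 0 < complex.Im (moebius g z).
Proof.
move=> hd hz; rewrite Im_moebius // divr_gt0 // exprn_gt0 // nm_gt0.
exact: moebius_denom_neq0.
Qed.

Lemma moebius_mul g h z : \det g = 1 -> \det h = 1 -> 0 < complex.Im z ->
  moebius (g *m h) z = moebius g (moebius h z).
Proof.
move=> dg dh hz; have n1 := moebius_denom_neq0 dh hz.
have n2 := moebius_denom_neq0 dg (Im_moebius_gt0 dh hz).
have dgh : \det (g *m h) = 1 by rewrite det_mulmx dg dh.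
have n3 := moebius_denom_neq0 dgh hz.
rewrite /moebius in n2 *; set w := (g 1 0)%:~R * _ + _ in n2 *.
apply: (mulIf n3); rewrite mulfVK //; apply: (mulIf n2); rewrite mulrAC mulfVK //.
rewrite /w; move: n1 {n2 n3 w}.
rewrite [g]mx2E [h]mx2E mul_mx2 !mx2_entries !intrD !intrM => n1.
by field; exact: n1.
Qed.

Lemma moebiusN g z : moebius (- g) z = moebius g z.
Proof.
rewrite /moebius !mxE !intrN !mulNr -!opprD invrN mulrNN //.
Qed.

End UpperHalfPlane.

(** * Independence of z and additivity *)

Section Homomorphism.
Variable R : realType.
Variables (q1 q2 : nat) (chi1 chi2 : int -> R[i]).
Hypotheses (q1_gt1 : (1 < q1)%N) (q2_gt1 : (1 < q2)%N).
Hypotheses (p1 : primitive_character q1 chi1) (p2 : primitive_character q2 chi2).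
Hypothesis parity : chi1 (-1) * chi2 (-1) = 1.

Let h1 := proj1 p1.
Let h2 := proj1 p2.
Local Notation S := (newform_dedekind_sum q1 chi1 chi2).

Lemma psi_Gamma1 g : Gamma1 (q1 * q2) g -> psi chi1 chi2 g = 1.
Proof.
case=> _ _ /eqP; rewrite eqz_mod_dvd PoszM => /dvdzP[c hc].
have h : g 1 1 = 1 + q1%:Z * (q2%:Z * c) by rewrite -[LHS](subrK 1) hc; ring.
have h' : g 1 1 = 1 + q2%:Z * (q1%:Z * c) by rewrite h; ring.
rewrite /psi {1}h h' (chi_modD h1) (chi_modD h2) (chi_one h1) (chi_one h2).
by rewrite conjC1 mulr1.
Qed.

Lemma psiN g : psi chi1 chi2 (- g) = psi chi1 chi2 g.
Proof.
rewrite /psi !mxE (chiN h1) (chiN h2) rmorphM /= mulrACA.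
rewrite (conj_chiN1 q2_gt1 h2).
by rewrite parity mul1r.
Qed.

Lemma newform_sumN z g : S z (- g) = S z g.
Proof. by rewrite /newform_dedekind_sum moebiusN psiN. Qed.

Lemma eisenstein_shift z (m : int) : eisenstein_f chi1 chi2 (z + m%:~R) = eisenstein_f chi1 chi2 z.
Proof.
rewrite /eisenstein_f; congr (limn _); apply/funext => n.
apply: eq_bigr => i _; congr (_ * _).
rewrite -!mulrA -!/(ex _) mulrDr exD [X in _ * X](_ : _ = 1) ?mulr1 //.
by rewrite (pmulrn 1 i) -intrM ex_int.
Qed.

(** Every value is expressed by the lower row of g up to sign, without z; both the independence of z
    and the membership of the values in F rest on this. A vanishing lower left entry means that g
    acts as an integer translation, under which f is invariant. *)
Lemma newform_sum_values z g : 0 < complex.Im z -> Gamma1 (q1 * q2) g ->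
  S z g = 0 /\ g 1 0 = 0 \/ exists k l, [/\ (0 < k)%N, S z g = - dedekind_sum q1 chi1 chi2 k l &
     (g 1 0 = k%:Z /\ g 1 1 = l) \/ (g 1 0 = - k%:Z /\ g 1 1 = - l)].
Proof.
move=> hz hg; have hpsi := psi_Gamma1 hg; have [hG _ _] := hg; have [hd hN] := hG.
case E : (g 1 0) => [[|k]|k].
- left; split=> //.
  have h : g 0 0 * g 1 1 = 1 by move: hd; rewrite det22 E mulr0 subr0.
  have [m hm] : exists m : int, moebius g z = z + m%:~R.
    rewrite /moebius E mul0r add0r.
    case: (mulz_eq1_cases h) => -[-> ->].
      by exists (g 0 1); rewrite divr1 mul1r.
    by exists (- g 0 1); rewrite !intrN invrN invr1 mulrN mulr1 mulN1r opprD opprK.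
  by rewrite /newform_dedekind_sum hpsi hm eisenstein_shift mul1r subrr mulr0.
- right; exists k.+1, (g 1 1); split=> //; last by left.
  by rewrite (newform_formula q1_gt1 q2_gt1 p1 p2 parity hz hG _ E) // hpsi mulN1r.
- right; exists k.+1, (- g 1 1); split=> //; last by right; rewrite opprK NegzE.
  have E' : (- g) 1 0 = k.+1%:Z by rewrite mxE E NegzE opprK.
  have hG' : Gamma0 (q1 * q2) (- g).
    split; last by rewrite mxE rpredN.
    by move: hd; rewrite !det22 !mxE !mulrNN.
  rewrite -newform_sumN (newform_formula q1_gt1 q2_gt1 p1 p2 parity hz hG' _ E') //.
  by rewrite psiN hpsi mulN1r mxE.
Qed.

Lemma newform_sum_indep z z' g : 0 < complex.Im z -> 0 < complex.Im z' ->
  Gamma1 (q1 * q2) g -> S z g = S z' g.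
Proof.
move=> hz hz' hg.
have [[-> c0]|[k [l [k0 -> hkl]]]] := newform_sum_values hz hg;
have [[-> c1]|[k' [l' [k0' -> hkl']]]] := newform_sum_values hz' hg => //.
- by exfalso; move: hkl' k0'; rewrite c0; clear; lia.
- by exfalso; move: hkl k0; rewrite c1; clear; lia.
- suff [-> ->] : k = k' /\ l = l' by [].
  by case: hkl => -[]; case: hkl' => -[] -> -> ea eb; split; move: k0 k0' ea eb; clear; lia.
Qed.

(** f(g h z) - f(z) is the sum of f(g (h z)) - f(h z) and f(h z) - f(z); the first difference
    belongs to g at the point h z, which may be moved to z. *)
Lemma newform_sum_hom z g h : 0 < complex.Im z -> Gamma1 (q1 * q2) g -> Gamma1 (q1 * q2) h ->
  S z (g *m h) = S z g + S z h.
Proof.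
move=> hz hg hh; have dg := Gamma1_det hg; have dh := Gamma1_det hh.
rewrite (newform_sum_indep hz (Im_moebius_gt0 dh hz) hg).
rewrite /newform_dedekind_sum !psi_Gamma1 //; last exact: Gamma1_mul.
by rewrite moebius_mul // !mul1r -mulrDr addrA subrK.
Qed.

End Homomorphism.

(** * Quadratic sums and the autocorrelation of B_1 *)

Section QuadraticSums.
Variable F : numFieldType.

Lemma sum_sqr_exp (x : F) k :
  (x - 1) * (\sum_(m < k) m%:R ^+ 2 * x ^+ m) =
  k%:R ^+ 2 * x ^+ k - x * \sum_(m < k) (2 * m%:R + 1) * x ^+ m.
Proof.
elim: k => [|k IH]; first by rewrite !big_ord0 !mulr0 expr0n mul0r subr0.
rewrite !big_ord_recr /= !mulrDr IH -[k.+1%:R]natr1 [x ^+ k.+1]exprS; ring.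
Qed.

(** For w = e(t/Q) the quotient w/(1 - w)^2 is -1/(4 sin^2(pi t/Q)); this is where the squared
    cosecants originate. *)
Lemma quad_fourier (w : F) Q : w ^+ Q = 1 -> w != 1 ->
  \sum_(m < Q) m%:R * (Q%:R - m%:R) * w ^+ m = 2 * Q%:R * w / (1 - w) ^+ 2.
Proof.
move=> wQ w1; have d1 : w - 1 != 0 by rewrite subr_eq0.
have d2 : 1 - w != 0 by rewrite subr_eq0 eq_sym.
have S0 : \sum_(m < Q) w ^+ m = 0 by rewrite sum_unity // (negPf w1).
have S1 : \sum_(m < Q) m%:R * w ^+ m = Q%:R / (w - 1).
  apply: (mulfI d1); rewrite sum_mul_exp wQ S0 mulr0 subr0 mulr1.
  by rewrite mulrCA divff ?mulr1.
have S2 : \sum_(m < Q) m%:R ^+ 2 * w ^+ m =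
    (Q%:R ^+ 2 - w * (2 * (Q%:R / (w - 1)))) / (w - 1).
  apply: (mulfI d1); rewrite sum_sqr_exp wQ mulr1 mulrCA divff // mulr1.
  congr (_ - w * _); under eq_bigr do rewrite mulrDl mul1r -mulrA.
  by rewrite big_split /= S0 addr0 -mulr_sumr S1.
transitivity (Q%:R * (\sum_(m < Q) m%:R * w ^+ m) - \sum_(m < Q) m%:R ^+ 2 * w ^+ m).
  by rewrite mulr_sumr -sumrB; apply: eq_bigr => m _; ring.
by rewrite S1 S2; field; rewrite d1 d2.
Qed.

Lemma quad_sum Q : \sum_(m < Q) (m%:R * (Q%:R - m%:R) : F) = (Q%:R ^+ 3 - Q%:R) / 6.
Proof.
have S1 : \sum_(m < Q) (m%:R : F) = Q%:R * (Q%:R - 1) / 2.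
  elim: Q => [|n IH]; first by rewrite big_ord0 !mul0r.
  by rewrite big_ord_recr /= IH -[n.+1%:R]natr1; move: (n%:R) => y; field.
have S2 : \sum_(m < Q) (m%:R ^+ 2 : F) = Q%:R * (Q%:R - 1) * (2 * Q%:R - 1) / 6.
  elim: Q {S1} => [|n IH]; first by rewrite big_ord0 !mul0r.
  by rewrite big_ord_recr /= IH -[n.+1%:R]natr1; move: (n%:R) => y; field.
transitivity (Q%:R * (\sum_(m < Q) (m%:R : F)) - \sum_(m < Q) (m%:R ^+ 2 : F)).
  by rewrite mulr_sumr -sumrB; apply: eq_bigr => m _; ring.
by rewrite S1 S2; move: (Q%:R) => y; field.
Qed.

Lemma bern1N k j : (0 < k)%N -> bern1 F (- j) k = - bern1 F j k.
Proof.
move=> k0; have kn : (k%:R : F) != 0 by rewrite pnatr_eq0 -lt0n.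
case: (boolP (k%:Z %| j)%Z) => kj; first by rewrite /bern1 rpredN kj oppr0.
have [d dk dE] := modz_nat_exists j k0.
have d0 : (0 < d)%N.
  by rewrite lt0n; apply: contra kj => /eqP d0; apply/dvdz_mod0P; rewrite dE d0.
have jE : j = (j %/ k%:Z)%Z * k%:Z + d%:Z by rewrite -dE -divz_eq.
have -> : bern1 F j k = bern1 F d%:Z k by apply: bern1_mod; rewrite -dE modz_mod.
have -> : bern1 F (- j) k = bern1 F (k - d)%N%:Z k.
  apply: bern1_mod; apply/eqP; rewrite eqz_mod_dvd -subzn 1?ltnW // jE.
  rewrite (_ : _ - _ = (- (j %/ k%:Z)%Z - 1) * k%:Z); [exact: dvdz_mull|ring].
rewrite !bern1_small ?d0 ?subn_gt0 ?dk //=; last by rewrite ltn_subrL d0.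
rewrite natrB 1?ltnW //; move: (k%:R) kn (d%:R) => a an b; field.
exact: an.
Qed.

(** Use uv = (u^2 + v^2 - (u - v)^2)/2. The two sums of squares agree by periodicity. With d = c mod
    M, the sawtooth being linear with one jump, u - v equals (d - M)/M for d indices and d/M for the
    other M - d, so its squares add up to d (M - d)/M. The condition on j0 keeps every argument away
    from the integers. *)
Lemma bern1_autocorrelation (x M j0 : nat) (c : int) : (0 < j0 < x)%N -> (0 < M)%N ->
  \sum_(i < M) bern1 F (j0%:Z + x%:Z * i%:Z) (x * M) *
     bern1 F (j0%:Z + x%:Z * (i%:Z - c)) (x * M) =
  \sum_(i < M) bern1 F (j0%:Z + x%:Z * i%:Z) (x * M) ^+ 2 -
    (c %% M%:Z)%Z%:~R * (M%:R - (c %% M%:Z)%Z%:~R) / (2 * M%:R).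
Proof.
move=> /andP[j00 j0x] M0.
pose b (i : int) := bern1 F (j0%:Z + x%:Z * i) (x * M).
have per m n : b (m + M%:Z * n) = b m.
  rewrite /b (_ : j0%:Z + x%:Z * (m + M%:Z * n) = j0%:Z + x%:Z * m + (x * M)%N%:Z * n).
    exact: bern1_period.
  by rewrite PoszM; ring.
have MR : (M%:R : F) != 0 by rewrite pnatr_eq0 -lt0n.
have xR : (x%:R : F) != 0 by rewrite pnatr_eq0 -lt0n (ltn_trans j00).
have val (i : nat) : (i < M)%N -> b i%:Z = (j0%:R + x%:R * i%:R) / (x%:R * M%:R) - 2^-1.
  move=> iM; rewrite /b -PoszM -PoszD bern1_small ?natrD ?natrM //.
  rewrite addn_gt0 j00 /= (@leq_trans (x + x * i)) ?ltn_add2r //.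
  by rewrite -mulnS leq_mul2l iM orbT.
have [d dM dE] := modz_nat_exists c M0.
have bc i : b (i - c) = b (i - d%:Z).
  rewrite {1}(divz_eq c M%:Z) dE -(per (i - d%:Z) (- (c %/ M%:Z)%Z)).
  by congr b; ring.
rewrite dE -/(b _); under eq_bigr do rewrite -/(b _) -/(b _) bc.
under [in RHS]eq_bigr do rewrite -/(b _).
have E1 : \sum_(i < M) b (i%:Z - d%:Z) ^+ 2 = \sum_(i < M) b i%:Z ^+ 2.
  rewrite -(isum_period (- d%:Z) (F := fun i => b i ^+ 2)) => [|m n]; last by rewrite per.
  by apply: eq_bigr => i _; rewrite addrC.
have E2 : \sum_(i < M) (b i%:Z - b (i%:Z - d%:Z)) ^+ 2 = d%:R * (M%:R - d%:R) / M%:R.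
  rewrite -(big_mkord xpredT (fun i => (b i%:Z - b (i%:Z - d%:Z)) ^+ 2)).
  rewrite (@big_cat_nat _ _ _ d) //=; last exact: ltnW.
  have -> : \sum_(0 <= i < d) (b i%:Z - b (i%:Z - d%:Z)) ^+ 2 =
      \sum_(0 <= i < d) ((d%:R - M%:R) / M%:R) ^+ 2.
    apply: eq_big_nat => i /andP[_ id]; congr (_ ^+ 2).
    have -> : b (i%:Z - d%:Z) = b (i + (M - d))%N%:Z.
      rewrite -(per _ 1); congr b; rewrite PoszD -subzn ?(ltnW dM) //; ring.
    rewrite !val ?natrD ?natrB ?(ltnW dM) //; [by field; rewrite MR xR| |exact: ltn_trans dM].
    by move: id dM; clear; lia.
  have -> : \sum_(d <= i < M) (b i%:Z - b (i%:Z - d%:Z)) ^+ 2 =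
      \sum_(d <= i < M) (d%:R / M%:R) ^+ 2.
    apply: eq_big_nat => i /andP[id iM]; congr (_ ^+ 2).
    rewrite subzn // !val ?natrB //; first by field; rewrite MR xR.
    by rewrite (leq_ltn_trans (leq_subr _ _)).
  rewrite !sumr_const_nat subn0 -[_ *+ d]mulr_natr -[_ *+ (M - d)]mulr_natr natrB ?(ltnW dM) //.
  by move: (M%:R) MR (d%:R) => y yn v; field.
have E3 : \sum_(i < M) b i%:Z * b (i%:Z - d%:Z) = 2^-1 * (\sum_(i < M) b i%:Z ^+ 2 +
    \sum_(i < M) b (i%:Z - d%:Z) ^+ 2 - \sum_(i < M) (b i%:Z - b (i%:Z - d%:Z)) ^+ 2).
  rewrite -big_split -sumrB mulr_sumr; apply: eq_bigr => i _ /=.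
  by move: (b _) (b _) => u v; field.
rewrite E3 E1 E2 -pmulrn; move: (\sum_(i < M) _) => A; move: (M%:R) MR (d%:R) => y yn v.
by field.
Qed.

End QuadraticSums.

(** * Dedekind sums at parabolic elements *)

Section ParabolicValues.
Variable R : realType.
Variables (q1 q2 : nat) (chi1 chi2 : int -> R[i]).
Hypotheses (q1_gt1 : (1 < q1)%N) (q2_gt1 : (1 < q2)%N).
Hypotheses (p1 : primitive_character q1 chi1) (p2 : primitive_character q2 chi2).
Hypothesis parity : chi1 (-1) * chi2 (-1) = 1.

Let h1 := proj1 p1.
Let h2 := proj1 p2.
Let q1_gt0 : (0 < q1)%N := ltnW q1_gt1.
Let q2_gt0 : (0 < q2)%N := ltnW q2_gt1.
Let N := (q1 * q2)%N.
Let N_gt0 : (0 < N)%N.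
Proof. by rewrite muln_gt0 q1_gt0. Qed.

Let c1 := fun n => (chi1 n)^*.
Let c2 := fun n => (chi2 n)^*.
Let pc1 : primitive_character q1 c1 := primitive_conj p1.
Let pc2 : primitive_character q2 c2 := primitive_conj p2.

(** The sum over t of chi1(t) chi2(t)/sin^2(pi t/N), multiplied by -1/4; the characters vanish at t
    = 0. *)
Definition csc_sum : R[i] :=
  \sum_(t < N) chi1 t%:Z * chi2 t%:Z * (ek R N t%:Z / (1 - ek R N t%:Z) ^+ 2).

Definition parabolic_const : R[i] :=
  - (gauss_sum q1 c1 * gauss_sum q2 c2 * chi1 (-1) * csc_sum / q1%:R).

Definition quad (Q : nat) (m : int) : R[i] :=
  (m %% Q%:Z)%Z%:~R * (Q%:R - (m %% Q%:Z)%Z%:~R).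

Lemma quad_inversion Q m : (0 < Q)%N -> quad Q m =
  Q%:R^-1 * \sum_(t < Q) (\sum_(n < Q) n%:R * (Q%:R - n%:R) * ek R Q (n%:Z * t%:Z)) *
    ek R Q (- m * t%:Z).
Proof.
move=> Q0; have Qn : (Q%:R : R[i]) != 0 by rewrite pnatr_eq0 -lt0n.
have [d dQ dE] := modz_nat_exists m Q0.
apply: (mulfI Qn); rewrite mulVKf // /quad dE -pmulrn.
transitivity (\sum_(n < Q) n%:R * (Q%:R - n%:R) * \sum_(t < Q) ek R Q ((n%:Z - m) * t%:Z)).
  rewrite (bigD1 (Ordinal dQ)) //= [X in _ = _ + X]big1 ?addr0 => [|n nd].
    rewrite sum_ek // -eqz_mod_dvd -dE modz_mod eqxx; ring.
  rewrite sum_ek //; case: ifP; last by rewrite mulr0.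
  rewrite -eqz_mod_dvd dE modz_nat modn_small // eqz_nat => /eqP e.
  by case/eqP: nd; apply/val_inj.
under eq_bigr do rewrite mulr_sumr.
rewrite exchange_big /=; apply: eq_bigr => t _; rewrite mulr_suml; apply: eq_bigr => n _.
by rewrite -[RHS]mulrA -ekD; congr (_ * ek R Q _); ring.
Qed.

Section ParabolicElement.
Variables (u y : nat).
Hypotheses (u_gt0 : (0 < u)%N) (y_gt0 : (0 < y)%N) (cop : coprime u y).

Let x := (q2 * u)%N.
Let Q := (N * u)%N.
Let M := (N * x)%N.
Let k := (x * M)%N.
Let l : int := 1 + (N * x * y)%N%:Z.

Let x_gt0 : (0 < x)%N. Proof. by rewrite muln_gt0 q2_gt0. Qed.
Let Q_gt0 : (0 < Q)%N. Proof. by rewrite muln_gt0 N_gt0. Qed.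
Let M_gt0 : (0 < M)%N. Proof. by rewrite muln_gt0 N_gt0. Qed.

(** The identity plus N times the nilpotent product of the column (-y, x) and the row (x, y); it
    fixes the cusp -y/x. *)
Definition parabolic : 'M[int]_2 :=
  mx2 (1 - (N * x * y)%N%:Z) (- (N * y * y)%N%:Z) k%:Z l.

Lemma parabolic_Gamma1 : Gamma1 N parabolic.
Proof.
apply/Gamma1E; rewrite det_mx2 /parabolic !mx2_entries /k /l; split.
  by rewrite !PoszM; ring.
split; apply/eqP; rewrite eqz_mod_dvd ?subr0.
- by rewrite /M !PoszM dvdz_mull // dvdz_mulr.
- by rewrite addrAC subrr add0r rpredN !PoszM -mulrA dvdz_mulr.
- by rewrite addrAC subrr add0r !PoszM -mulrA dvdz_mulr.
Qed.

(** Write the summation index as j + x i. Since q2 divides x, chi2 sees only j; and l (j + x i)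
    equals j + x i + N x y j modulo k = N x^2. The second argument of B_1 is thus minus the first
    one shifted along the progression by an amount independent of i, and the sum over i is an
    autocorrelation. *)
Lemma dedekind_sum_parabolic : dedekind_sum q1 chi1 chi2 k l =
  q2%:R / (2 * Q%:R) * \sum_(j < x) \sum_(n < q1) c2 j%:Z * c1 n%:Z *
     quad Q (n%:Z * x%:Z - q1%:Z * y%:Z * j%:Z).
Proof.
have Qn : (Q%:R : R[i]) != 0 by rewrite pnatr_eq0 -lt0n.
have q2n : (q2%:R : R[i]) != 0 by rewrite pnatr_eq0 -lt0n.
have kq : (k %/ q1 = x * (q2 * x))%N.
  by rewrite /k /M /N (_ : x * (q1 * q2 * x) = x * (q2 * x) * q1)%N ?mulnK //; ring.
rewrite /dedekind_sum -/k kq.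
pose G (j : nat) := \sum_(n < q1) (chi2 j%:Z)^* * (chi1 n%:Z)^* *
    (bern1 R[i] j%:Z k * bern1 R[i] (n%:Z * (x * (q2 * x))%N%:Z - l * j%:Z) k).
rewrite (big_ord_mul x M G) exchange_big /= mulr_sumr; apply: eq_bigr => j _.
(* Indices divisible by q2, in particular j = 0, contribute nothing because chi2 vanishes there; the
   others satisfy 0 < j < x, as the autocorrelation requires. *)
case: (boolP (q2 %| j)%N) => [q2j|q2j].
  have c0 : chi2 j%:Z = 0 by apply: (chi_dvd q2_gt1 h2); rewrite dvdzE !absz_nat.
  rewrite big1 => [|i _]; last first.
    rewrite /G big1 // => n _; rewrite PoszD PoszM (_ : x%:Z * i%:Z = q2%:Z * (u%:Z * i%:Z)).
      by rewrite (chi_modD h2) c0 conjC0 !mul0r.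
    by rewrite /x PoszM; ring.
  by rewrite big1 ?mulr0 // => n _; rewrite /c2 c0 conjC0 !mul0r.
have j0 : (0 < j)%N by rewrite lt0n; apply: contraNneq q2j => ->; rewrite dvdn0.
pose A := \sum_(i < M) bern1 R[i] (j%:Z + x%:Z * i%:Z) (x * M) ^+ 2.
transitivity (\sum_(n < q1) c2 j%:Z * c1 n%:Z *
    - (A - q2%:R / (2 * Q%:R) * quad Q (n%:Z * x%:Z - q1%:Z * y%:Z * j%:Z))).
  rewrite exchange_big /=; apply: eq_bigr => n _.
  pose c : int := q2%:Z * (n%:Z * x%:Z - q1%:Z * y%:Z * j%:Z).
  have jx : (0 < j < x)%N by rewrite j0 ltn_ord.
  have := @bern1_autocorrelation R[i] x M j c jx M_gt0; rewrite -/A.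
  have -> : (c %% M%:Z)%Z%:~R * (M%:R - (c %% M%:Z)%Z%:~R) / (2 * M%:R) =
      q2%:R / (2 * Q%:R) * quad Q (n%:Z * x%:Z - q1%:Z * y%:Z * j%:Z).
    have -> : M%:Z = q2%:Z * Q%:Z by rewrite /M /Q /x !PoszM; ring.
    have -> : M%:R = q2%:R * Q%:R :> R[i] by rewrite -natrM; congr (_%:R); rewrite /M /Q /x; ring.
    rewrite /c -mulz_modr // intrM -(pmulrn 1 q2) /quad.
    move: (_%:~R) (Q%:R) Qn (q2%:R) q2n => a b bn d dn.
    by field; rewrite bn dn.
  move=> <-; rewrite -sumrN mulr_sumr; apply: eq_bigr => i _.
  rewrite PoszD PoszM; congr (_ * _).
    congr (_^* * _); rewrite (_ : x%:Z * i%:Z = q2%:Z * (u%:Z * i%:Z)) ?(chi_modD h2) //.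
    by rewrite /x PoszM; ring.
  rewrite -[RHS]mulrN; congr (_ * _); rewrite -bern1N; last by rewrite muln_gt0 x_gt0.
  rewrite -(bern1_period _ _ _ (y%:Z * i%:Z)); congr bern1.
  by rewrite /l /c /k /M /N !(PoszD, PoszM); ring.
rewrite mulr_sumr.
(* The sum of squares [A] does not depend on n, so it is annihilated by the vanishing sum of conj
   chi1. *)
have S0 : \sum_(n < q1) c1 n%:Z = 0 by apply: sum_chi.
transitivity (- (c2 j%:Z * A * \sum_(n < q1) c1 n%:Z) + \sum_(n < q1) q2%:R / (2 * Q%:R) *
   (c2 j%:Z * c1 n%:Z * quad Q (n%:Z * x%:Z - q1%:Z * y%:Z * j%:Z))).
  rewrite mulr_sumr -sumrN -big_split /=; apply: eq_bigr => n _; ring.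
by rewrite S0 mulr0 oppr0 add0r.
Qed.

(** Expand [quad] in characters e(t m/Q). The sum over n is a Gauss sum of conj chi1; the sum over
    j, modulo x = q2 u, is an induced Gauss sum that forces u to divide t y, hence t, as u and y are
    coprime. Putting t = s u extracts chi1(u) chi2(y) and leaves a sum over s modulo N. *)
Lemma quad_character_sum :
  \sum_(j < x) \sum_(n < q1) c2 j%:Z * c1 n%:Z *
     quad Q (n%:Z * x%:Z - q1%:Z * y%:Z * j%:Z) =
  2 * u%:R * (gauss_sum q1 c1 * gauss_sum q2 c2 * chi1 (-1) * csc_sum) *
    (chi1 u%:Z * chi2 y%:Z).
Proof.
have Qn : (Q%:R : R[i]) != 0 by rewrite pnatr_eq0 -lt0n.
pose Rt (t : int) : R[i] := \sum_(n < Q) n%:R * (Q%:R - n%:R) * ek R Q (n%:Z * t).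
have E1 : \sum_(j < x) \sum_(n < q1) c2 j%:Z * c1 n%:Z *
     quad Q (n%:Z * x%:Z - q1%:Z * y%:Z * j%:Z) =
   Q%:R^-1 * \sum_(t < Q) Rt t%:Z * ((\sum_(n < q1) c1 n%:Z * ek R q1 (- t%:Z * n%:Z)) *
      (\sum_(j < x) c2 j%:Z * ek R x (t%:Z * y%:Z * j%:Z))).
  transitivity (\sum_(j < x) \sum_(n < q1) \sum_(t < Q) Q%:R^-1 * (Rt t%:Z *
     (c1 n%:Z * ek R q1 (- t%:Z * n%:Z) * (c2 j%:Z * ek R x (t%:Z * y%:Z * j%:Z))))).
    apply: eq_bigr => j _; apply: eq_bigr => n _.
    rewrite quad_inversion // !mulr_sumr; apply: eq_bigr => t _; rewrite -/(Rt _).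
    have -> : ek R Q (- (n%:Z * x%:Z - q1%:Z * y%:Z * j%:Z) * t%:Z) =
        ek R q1 (- t%:Z * n%:Z) * ek R x (t%:Z * y%:Z * j%:Z).
      rewrite -(@ek_mull R q1 x (- t%:Z * n%:Z) x_gt0) -(@ek_mull R x q1 _ q1_gt0).
      have -> : (x * q1 = Q)%N by rewrite /x /Q /N; ring.
      have -> : (q1 * x = Q)%N by rewrite /x /Q /N; ring.
      by rewrite -ekD; congr (ek R Q _); ring.
    ring.
  rewrite exchange_big /=.
  under eq_bigr do rewrite exchange_big /=.
  rewrite exchange_big mulr_sumr /=; apply: eq_bigr => t _.
  rewrite big_distrlr /= !mulr_sumr; apply: eq_bigr => n _.
  by rewrite !mulr_sumr; apply: eq_bigr => j _.
pose F (s : int) := Rt (s * u%:Z) * ((chi1 (- (s * u%:Z)) * gauss_sum q1 c1) *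
   (u%:R * (chi2 (s * y%:Z) * gauss_sum q2 c2))).
have uy : coprimez u%:Z y%:Z by rewrite /coprimez /gcdz !absz_nat; move: cop => /eqP ->.
have E2 : \sum_(t < Q) Rt t%:Z * ((\sum_(n < q1) c1 n%:Z * ek R q1 (- t%:Z * n%:Z)) *
      (\sum_(j < x) c2 j%:Z * ek R x (t%:Z * y%:Z * j%:Z))) = \sum_(s < N) F s%:Z.
  have un : u%:Z != 0 by rewrite eqz_nat -lt0n.
  transitivity (isum (- (u * 0)%N%:Z) (u * N)
    (fun b => if (u%:Z %| b - 0)%Z then F ((b - 0) %/ u%:Z)%Z else 0)).
    rewrite /isum mulnC; apply: eq_bigr => t _; rewrite muln0 oppr0 add0r subr0.
    rewrite (gauss_sum_twist q1_gt1 pc1) (gauss_sum_induced q2_gt1 pc2) // conjCK.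
    have -> : (u%:Z %| t%:Z * y%:Z)%Z = (u%:Z %| t%:Z)%Z by rewrite mulrC Gauss_dvdzr.
    case: ifP => hd; last by rewrite mulr0 mulr0.
    have [s ->] := dvdzP hd; rewrite mulzK // /F conjCK.
    by rewrite (_ : s * u%:Z * y%:Z = s * y%:Z * u%:Z) ?mulzK //; ring.
  rewrite isum_progression // div0z subr0 /isum.
  by apply: eq_bigr => s _; rewrite oppr0 add0r.
rewrite E1 E2 /F /csc_sum; clear F E1 E2; move: (gauss_sum q1 c1) (gauss_sum q2 c2) => G1 G2.
rewrite !mulr_sumr mulr_suml; apply: eq_bigr => s _.
case: (posnP s) => [->|s0].
  by rewrite mul0r oppr0 (chi_dvd q1_gt1 h1) ?dvdz0 // !(mul0r, mulr0).
have -> : Rt (s%:Z * u%:Z) = 2 * Q%:R * ek R N s%:Z / (1 - ek R N s%:Z) ^+ 2.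
  have e : ek R Q (s%:Z * u%:Z) = ek R N s%:Z.
    by rewrite /Q mulnC mulrC ek_mull.
  rewrite -quad_fourier; last 2 first.
  - by rewrite -e -ekM ek_mulk.
  - by rewrite ek_eq1 // dvdzE !absz_nat gtnNdvd.
  by apply: eq_bigr => n _; rewrite -e -ekM mulrC [_ * n%:Z]mulrC mulrC.
rewrite (chiN h1) !(chiM h1) !(chiM h2) -[2 * _ * _ / _]mulrA.
move: (ek R N s%:Z / _) (Q%:R) Qn => W a a0.
by field; exact: a0.
Qed.

Lemma newform_parabolic z : 0 < complex.Im z ->
  newform_dedekind_sum q1 chi1 chi2 z parabolic = parabolic_const * (chi1 u%:Z * chi2 y%:Z).
Proof.
move=> hz; have hG := parabolic_Gamma1.
have k0 : (0 < k)%N by rewrite muln_gt0 x_gt0.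
have [hG0 _ _] := hG.
rewrite (newform_formula q1_gt1 q2_gt1 p1 p2 parity hz hG0 k0); last by rewrite mx2_entries.
rewrite (psi_Gamma1 p1 p2 hG) mulN1r mx2_entries dedekind_sum_parabolic quad_character_sum.
have u0 : (u%:R : R[i]) != 0 by rewrite pnatr_eq0 -lt0n.
have q10 : (q1%:R : R[i]) != 0 by rewrite pnatr_eq0 -lt0n.
have q20 : (q2%:R : R[i]) != 0 by rewrite pnatr_eq0 -lt0n.
rewrite /parabolic_const /Q /N !natrM.
move: (gauss_sum q1 c1 * _ * _ * _) (chi1 u%:Z * _) => P X.
move: (u%:R) u0 (q1%:R) q10 (q2%:R) q20 => a a0 b b0 c c0.
by field; rewrite a0 b0 c0.
Qed.

End ParabolicElement.
End ParabolicValues.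

(** * Nonvanishing of the parabolic constant *)

Section CscSum.
Variable R : realType.

(** At y = pi/8 the bound y cos y <= sin y gives y^2 <= (1 - c)/c with c = cos^2(pi/8). Two
    half-angle formulas give cos(pi/4) >= 7/10 and c >= 85/100, so 64 y^2 <= 64 (15/85) < 12. *)
Lemma pi_sqr_lt12 : (pi : R) ^+ 2 < 12.
Proof.
pose y : R := pi / 8; have p0 := pi_gt0 R.
have y0 : 0 < y by rewrite /y; lra.
have [|h|] := @sin_ge_cos R y; [exact: ltW| |by rewrite /y; lra].
have c0 : 0 <= cos y by apply: cos_ge0_pihalf; rewrite /y; lra.
have d0 : 0 <= cos (pi / 4 : R) by apply: cos_ge0_pihalf; lra.
have e1 := cos_mulr2n (pi / 4 : R); have e2 := cos_mulr2n y.
have y2 : y *+ 2 = pi / 4 by rewrite -mulr_natr /y; field.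
have y4 : (pi / 4 : R) *+ 2 = pi / 2 by rewrite -mulr_natr; field.
rewrite y4 cos_pihalf mulr2n in e1; rewrite y2 mulr2n in e2.
have e3 := cos2Dsin2 y.
have h2 : (y * cos y) ^+ 2 <= sin y ^+ 2.
  have yc : 0 <= y * cos y by rewrite mulr_ge0 // ltW.
  by rewrite ler_sqr ?nnegrE // (le_trans yc).
rewrite exprMn in h2.
have -> : (pi : R) ^+ 2 = 64 * y ^+ 2 by rewrite /y; field.
have d1 : 7 / 10 <= cos (pi / 4 : R) by nra.
have c1 : 85 / 100 <= cos y ^+ 2 by lra.
have : y ^+ 2 * (85 / 100) <= y ^+ 2 * cos y ^+ 2 by rewrite ler_wpM2l ?sqr_ge0.
lra.
Qed.

Lemma sin_le_id (y : R) : 0 <= y -> sin y <= y.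
Proof.
rewrite le0r => /predU1P[->|yp]; first by rewrite sin0.
pose g (t : R) := t - sin t.
have dg (x : R) : is_derive x 1 g (1 - cos x) by apply: is_derive_eq.
have [x|x _] := @MVT _ g (fun x => 1 - cos x) _ _ yp (fun x _ => dg x).
  apply: continuous_subspaceT => {}x; apply/differentiable_continuous.
  by apply/derivable1_diffP; case: (dg x).
by rewrite /g sin0 !subr0 -subr_ge0 => ->; rewrite mulr_ge0 ?(ltW yp) // subr_ge0 cos_le1.
Qed.

Lemma nm_1Bex (t : R) : 0 <= t -> t <= 2^-1 -> nm (1 - ex t%:C%C) <= 2 * pi * t.
Proof.
move=> t0 t1; have p0 := pi_gt0 R.
have y0 : 0 <= pi * t by rewrite mulr_ge0 // ltW.
have y1 : pi * t <= pi by rewrite ger_pMr //; lra.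
have s0 : 0 <= sin (pi * t) by apply: sin_ge0_pi; rewrite y0.
rewrite -(@ler_pXn2r _ 2) ?nnegrE ?nm_ge0 //; last by rewrite -mulrA mulr_ge0.
rewrite nm_sqr ex_realE /=.
have := cos2Dsin2 (2 * pi * t); have := cos_mulr2n (pi * t); have := cos2Dsin2 (pi * t).
rewrite (_ : (pi * t) *+ 2 = 2 * pi * t); last by rewrite -mulr_natr; ring.
rewrite mulr2n => e1 e2 e3.
have h : sin (pi * t) ^+ 2 <= (pi * t) ^+ 2 by rewrite ler_sqr ?nnegrE // sin_le_id.
nra.
Qed.

Lemma nm_ek k t : nm (ek R k t) = 1.
Proof.
rewrite /ek -(rmorph_int (real_complex R)) -(rmorph_nat (real_complex R)) -fmorph_div /=.
by rewrite nm_ex /= mulr0 oppr0 expR0.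
Qed.

(** On the unit circle the conjugate of 1 - w is -(1 - w)/w, so the weights in [csc_sum] are real
    and of constant sign. *)
Lemma nm_1Bek_sqr k t : (0 < k)%N -> ~~ (k%:Z %| t)%Z ->
  - (ek R k t / (1 - ek R k t) ^+ 2) = ((nm (1 - ek R k t) ^- 2)%:C)%C.
Proof.
move=> k0 kt; set w := ek R k t.
have w1 : 1 - w != 0 by rewrite subr_eq0 eq_sym ek_eq1.
have w0 : w != 0 by rewrite -nm_eq0 nm_ek oner_eq0.
have wV : w^* = w^-1.
  by apply: (mulfI w0); rewrite -normCK -nmE nm_ek rmorph1 expr1n divff.
have cw : (1 - w)^* = 1 - w^-1 by rewrite -wV raddfB /= conjC1.
rewrite fmorphV rmorphXn /= nmE normCK cw.
have w2 : w - 1 != 0 by rewrite -opprB oppr_eq0.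
by field; rewrite w0 w1 w2.
Qed.

(** The function m (k - m) vanishes at m = 0, so by inversion its Fourier coefficients add up to 0:
    the coefficient (k^3 - k)/6 at t = 0 balances all the others. *)
Lemma sum_1Bek_sqr k : (0 < k)%N ->
  \sum_(1 <= t < k) nm (1 - ek R k t%:Z) ^- 2 = (k%:R ^+ 2 - 1) / 12.
Proof.
move=> k0; have kn : (k%:R : R[i]) != 0 by rewrite pnatr_eq0 -lt0n.
apply: (@complexI R); rewrite rmorph_sum /=.
pose r t := \sum_(n < k) n%:R * (k%:R - n%:R) * ek R k (n%:Z * t).
have E : \sum_(t < k) r t%:Z = 0.
  have := quad_inversion R 0 k0; rewrite /quad mod0z mul0r => /esym/eqP.
  rewrite mulf_eq0 invr_eq0 (negPf kn) /= => /eqP E; rewrite -[RHS]E.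
  by apply: eq_bigr => t _; rewrite oppr0 mul0r ek0 mulr1.
move: E; rewrite -(big_mkord xpredT (fun t : nat => r t%:Z)) big_ltn //.
have -> : r 0%:Z = (k%:R ^+ 3 - k%:R) / 6.
  by rewrite -quad_sum; apply: eq_bigr => n _; rewrite mulr0 ek0 mulr1.
have -> : \sum_(1 <= t < k) r t%:Z =
   - 2 * k%:R * \sum_(1 <= t < k) ((nm (1 - ek R k t%:Z) ^- 2)%:C)%C.
  rewrite mulr_sumr; apply: eq_big_nat => t /andP[t0 tk].
  have kt : ~~ (k%:Z %| t%:Z)%Z by rewrite dvdzE !absz_nat gtnNdvd.
  rewrite -nm_1Bek_sqr // mulrN !mulNr opprK mulrA -quad_fourier ?ek_eq1 //; last by rewrite -ekM ek_mulk.
  by apply: eq_bigr => n _; rewrite -ekM mulrC [_ * n%:Z]mulrC mulrC.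
rewrite rmorphM rmorphB rmorphXn fmorphV !rmorph_nat rmorph1 /=.
move: (\sum_(1 <= t < k) _) (k%:R) kn => S K Kn e.
apply: (mulfI (_ : 2 * K != 0)); first by rewrite mulf_neq0 ?pnatr_eq0.
have -> : 2 * K * S = (K ^+ 3 - K) / 6 + 0 - ((K ^+ 3 - K) / 6 + - 2 * K * S) by ring.
by rewrite e; field.
Qed.

Variables (q1 q2 : nat) (chi1 chi2 : int -> R[i]).
Hypotheses (q1_gt1 : (1 < q1)%N) (q2_gt1 : (1 < q2)%N).
Hypotheses (p1 : primitive_character q1 chi1) (p2 : primitive_character q2 chi2).
Hypothesis parity : chi1 (-1) * chi2 (-1) = 1.

Let h1 := proj1 p1.
Let h2 := proj1 p2.
Let N := (q1 * q2)%N.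

(* The terms [t = 1] and [t = N - 1] outweigh all the others, as
   [4 / (2 * pi) ^ 2 > 1 / 12]. *)
Lemma csc_sum_neq0 : csc_sum q1 q2 chi1 chi2 != 0.
Proof.
have N4 : (4 <= N)%N by rewrite (@leq_mul 2 2).
have N0 : (0 < N)%N by apply: leq_trans N4.
pose a (t : nat) : R := nm (1 - ek R N t%:Z) ^- 2.
pose rho (t : int) := chi1 t * chi2 t.
have a0 t : 0 <= a t by rewrite invr_ge0 exprn_ge0 // nm_ge0.
have dv t : (0 < t < N)%N -> ~~ (N%:Z %| t%:Z)%Z.
  by move=> /andP[t0 tN]; rewrite dvdzE !absz_nat gtnNdvd.
have e0 : csc_sum q1 q2 chi1 chi2 = - \sum_(1 <= t < N) rho t%:Z * (a t)%:C%C.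
  rewrite /csc_sum -/N -(big_mkord xpredT (fun t : nat => chi1 t%:Z * chi2 t%:Z *
    (ek R N t%:Z / (1 - ek R N t%:Z) ^+ 2))) big_ltn //.
  rewrite (chi_dvd q1_gt1 h1) ?dvdz0 // !mul0r add0r -sumrN.
  by apply: eq_big_nat => t ht; rewrite -nm_1Bek_sqr ?dv // mulrN opprK.
have aN : a N.-1 = a 1%N.
  rewrite /a (_ : N.-1%:Z = - 1%:Z + N%:Z); last by rewrite -[in RHS](prednK N0) -addn1 PoszD; ring.
  rewrite (@ek_mod R N _ (- 1%:Z)) ?modzDr // ekN.
  have w0 : ek R N 1 != 0 by rewrite -nm_eq0 nm_ek oner_eq0.
  rewrite (_ : 1 - (ek R N 1)^-1 = - (1 - ek R N 1) / ek R N 1); last by field.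
  by rewrite nmM nmN nmV nm_ek invr1 mulr1.
have rN : rho N.-1%:Z = 1.
  rewrite /rho (_ : N.-1%:Z = - 1%:Z + N%:Z); last by rewrite -[in RHS](prednK N0) -addn1 PoszD; ring.
  rewrite {1}/N PoszM (chi_modD h1) [q1%:Z * _]mulrC.
  by rewrite (chi_modD h2).
have r1 : rho 1%:Z = 1 by rewrite /rho (chi_one h1) (chi_one h2) mulr1.
have split (V : zmodType) (f : nat -> V) :
    \sum_(1 <= t < N) f t = f 1%N + f N.-1 + \sum_(2 <= t < N.-1) f t.
  rewrite -{1}(prednK N0) big_nat_recr /=; last by rewrite -ltnS prednK // ltnW // ltnW.
  rewrite big_ltn; last by rewrite -ltnS prednK // ltnW.
  by rewrite addrAC.
have rest : nm (\sum_(2 <= t < N.-1) rho t%:Z * (a t)%:C%C) <= \sum_(2 <= t < N.-1) a t.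
  apply: le_trans (nm_sum _ _ _) _; apply: ler_sum => t _.
  rewrite !nmM nm_real ger0_norm ?a0 // -[leRHS]mul1r ler_wpM2r ?a0 //.
  by rewrite mulr_ile1 ?nm_ge0 ?(nm_chi_le q1_gt1 h1) ?(nm_chi_le q2_gt1 h2).
have tot : \sum_(1 <= t < N) a t = (N%:R ^+ 2 - 1) / 12 := sum_1Bek_sqr N0.
rewrite split aN in tot.
rewrite e0 oppr_eq0 split rN r1 aN !mul1r; apply/negP => /eqP z.
have {}z : a 1%N + a 1%N <= \sum_(2 <= t < N.-1) a t.
  apply: le_trans rest; rewrite -nmN; move/eqP: z; rewrite addr_eq0 => /eqP <-.
  by rewrite -rmorphD nm_real ger0_norm // addr_ge0 ?a0.
have NR : (0 : R) < N%:R by rewrite ltr0n.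
have n0 : 0 < nm (1 - ek R N 1) by rewrite nm_gt0 subr_eq0 eq_sym ek_eq1 // dv //= ltnW // ltnW.
have hn : nm (1 - ek R N 1) <= 2 * pi * N%:R^-1.
  have -> : ek R N 1 = ex (N%:R^-1 : R)%:C%C by rewrite /ek mul1r fmorphV rmorph_nat.
  rewrite nm_1Bex ?invr_ge0 ?ler0n // lef_pV2 ?posrE // ?ltr0n // ler_nat.
  by apply: leq_trans N4.
have p0 := pi_gt0 R; have p12 := pi_sqr_lt12.
(* Since |1 - e(1/N)| <= 2 pi/N, [a 1] is at least N^2/(4 pi^2). A vanishing sum would give 4 [a 1]
   <= (N^2 - 1)/12, against this bound. *)
have ha : N%:R ^+ 2 <= 48 * a 1%N.
  rewrite /a ler_pdivlMr ?exprn_gt0 //.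
  have : N%:R * nm (1 - ek R N 1) <= 2 * pi.
    by rewrite mulrC -ler_pdivlMr.
  rewrite -(@ler_pXn2r _ 2) ?nnegrE ?mulr_ge0 ?ler0n ?nm_ge0 ?(ltW p0) // !exprMn.
  lra.
suff : (N%:R : R) ^+ 2 < N%:R ^+ 2 by rewrite ltxx.
lra.
Qed.

Lemma parabolic_const_neq0 : parabolic_const q1 q2 chi1 chi2 != 0.
Proof.
have g1 := gauss_sum_neq0 q1_gt1 (primitive_conj p1).
have g2 := gauss_sum_neq0 q2_gt1 (primitive_conj p2).
have c : chi1 (-1) != 0.
  by apply/eqP => c; move: parity; rewrite c mul0r => /esym/eqP; rewrite oner_eq0.
rewrite /parabolic_const oppr_eq0 !mulf_neq0 // ?csc_sum_neq0 //.
by rewrite invr_eq0 pnatr_eq0 -lt0n ltnW.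
Qed.

End CscSum.

(** * Finitely generated subgroups of a rational vector space *)

Section Lattice.
Variable V : vectType rat.

Lemma common_denominator (m n : nat) (c : 'I_m -> 'I_n -> rat) :
  exists (D : rat) (M : 'M[int]_(m, n)), D != 0 /\ forall i k, c i k = D * (M i k)%:~R.
Proof.
pose P (i : 'I_m) (k : 'I_n) : int := denq (c i k).
pose D : int := \prod_i \prod_k P i k.
have D0 : (D%:~R : rat) != 0.
  rewrite intr_eq0; apply/prodf_neq0 => i _; apply/prodf_neq0 => k _; exact: denq_neq0.
exists (D%:~R)^-1, (\matrix_(i, k) (numq (c i k) *
  ((\prod_(k' | k' != k) P i k') * \prod_(i' | i' != i) \prod_k P i' k))).
rewrite invr_eq0; split=> // i k; rewrite mxE; apply: (mulfI D0); rewrite mulVKf //.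
rewrite intrM numqE -mulrA -intrM [RHS]mulrC; congr (_%:~R * _).
by rewrite /D (bigD1 i) //= (bigD1 k) //= -/(P i k) mulrA.
Qed.

Lemma int_comb_closed (r : nat) (e : 'I_r -> V) (A : V -> Prop) : A 0 ->
  (forall x y, A x -> A y -> A (x - y)) -> (forall i, A (e i)) ->
  forall m, A (int_comb e m).
Proof.
move=> A0 AB Ae m; have AN x : A x -> A (- x) by rewrite -sub0r; exact: AB.
have AD x y : A x -> A y -> A (x + y) by move=> Ax Ay; rewrite -(opprK y); apply/AB/AN.
apply: (big_ind A) => // i _.
have AM n : A (e i *+ n) by elim: n => [|n IH]; rewrite ?mulrS //; apply: AD.
by case: (m i) => n; [exact: AM | apply/AN/AM].
Qed.

(* By the Smith normal form of the integer matrix of coordinates of the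
   generators (after clearing denominators), [W] generates the same group as
   [\dim V] multiples of the vectors of a basis. *)
Lemma lattice_basis (W : seq V) : <<W>>%VS = fullv ->
  exists2 e : 'I_(\dim {:V}) -> V, injective (int_comb e) &
    (forall A : V -> Prop, A 0 -> (forall x y, A x -> A y -> A (x - y)) ->
       (forall x, x \in W -> A x) -> forall i, A (e i)) /\
    (forall x, x \in W -> exists m, x = int_comb e m).
Proof.
move=> spanW; set n := \dim _; pose m := size W; pose b := vbasis {:V}.
have [D [M [D0 DM]]] := common_denominator (fun (i : 'I_m) (k : 'I_n) => coord b k W`_i).
pose vec p (A : 'M[int]_(p, n)) (i : 'I_p) : V := \sum_k (D * (A i k)%:~R) *: b`_k.
have vecM (p q : nat) (B : 'M[int]_(q, p)) (A : 'M[int]_(p, n)) (i : 'I_q) :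
    vec q (B *m A) i = \sum_l vec p A l *~ B i l.
  rewrite /vec; under [RHS]eq_bigr do rewrite -scaler_int scaler_sumr.
  rewrite exchange_big; apply: eq_bigr => k _ /=; rewrite mxE.
  under [RHS]eq_bigr do rewrite scalerA; rewrite -scaler_suml; congr (_ *: _).
  rewrite rmorph_sum mulr_sumr; apply: eq_bigr => l _ /=; rewrite intrM; ring.
have WE (i : 'I_m) : W`_i = vec m M i.
  rewrite {1}(coord_vbasis (memvf W`_i)); apply: eq_bigr => k _; by rewrite DM.
have [L uL [U _ [d _ ME]]] := int_Smith_normal_form M.
pose A := (\matrix_(i < m, j < n) (d`_i *+ (i == j :> nat))) *m U.
have {}ME : M = L *m A by rewrite mulmxA.
have AE : A = invmx L *m M by rewrite ME mulKmx.
have A0 (l : 'I_m) : (n <= l)%N -> vec m A l = 0.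
  move=> nl; rewrite /vec big1 // => k _; rewrite mxE big1 ?mulr0 ?scale0r // => j _.
  by rewrite mxE gtn_eqF ?mul0r // (leq_trans (ltn_ord j)).
(* The sum has at most one term and is empty when j >= m, so [e] is defined without comparing m and
   n; its freeness, shown below, rules that case out. *)
pose e (j : 'I_n) : V := \sum_(l < m | l == j :> nat) vec m A l.
have eA (l : 'I_m) (ln : (l < n)%N) : vec m A l = e (Ordinal ln).
  by rewrite /e (big_pred1 l) // => l' /=; rewrite -val_eqE.
have We x : x \in W -> exists c, x = int_comb e c.
  move=> xW; have xm : (index x W < m)%N by rewrite index_mem.
  pose i := Ordinal xm; have -> : x = W`_i by rewrite /= nth_index.
  pose cl l : {ffun 'I_n -> int} := [ffun j : 'I_n => L i l *+ (l == j :> nat)].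
  exists (\sum_l cl l); rewrite WE ME vecM /int_comb.
  transitivity (\sum_l \sum_j e j *~ cl l j).
    apply: eq_bigr => l _; case: (ltnP l n) => ln.
      rewrite (bigD1 (Ordinal ln)) //= big1 ?addr0 => [|j jl].
        by rewrite ffunE eqxx -eA.
      rewrite ffunE; case: eqP => [h|]; last by rewrite mulr0z.
      by case/eqP: jl; apply/val_inj.
    rewrite A0 // mul0rz big1 // => j _.
    by rewrite ffunE gtn_eqF ?mulr0z // (leq_trans (ltn_ord j)).
  rewrite exchange_big; apply: eq_bigr => j _; rewrite sum_ffunE.
  by rewrite -mulrz_sumr.
pose et := [tuple e j | j < n].
(* The n vectors span a space of dimension n, since the generators are combinations of them, so they
   are independent. *)
have fe : free et.
  apply: (@basis_free _ _ fullv); rewrite basisEdim size_tuple leqnn andbT -spanW.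
  apply/span_subvP => x /We[c ->]; apply: memv_suml => j _; rewrite -scaler_int memvZ //.
  by apply: memv_span; apply/tnthP; exists j; rewrite tnth_mktuple.
exists e.
  move=> c c' h; apply/ffunP => j.
  have /freeP fP := fe; apply/eqP; rewrite -subr_eq0 -(intr_eq0 rat); apply/eqP.
  apply: (fP (fun j => (c j - c' j)%:~R)).
  transitivity (int_comb e c - int_comb e c'); last by rewrite h subrr.
  rewrite /int_comb -sumrB; apply: eq_bigr => i _.
  by rewrite scaler_int mulrzBr (nth_map i) ?size_enum_ord // nth_ord_enum.
split=> // B B0 BB BW j.
have BN x : B x -> B (- x) by rewrite -sub0r; exact: BB.
have BD x y : B x -> B y -> B (x + y) by move=> Bx By; rewrite -(opprK y); apply/BB/BN.
(* [L] is unimodular, so A = L^-1 M writes the new vectors as integer combinations of [W]. *)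
apply: (big_ind B) => // l _; rewrite AE vecM.
have := @int_comb_closed m (vec m M) B B0 BB _ [ffun i => invmx L l i]; rewrite /int_comb.
under eq_bigr do rewrite ffunE; apply=> i.
by rewrite -WE; apply: BW; rewrite mem_nth.
Qed.

End Lattice.

(** * Number fields inside the complex numbers *)

Section NumberField.
Variable R : realType.

(** An annihilating polynomial of least degree is irreducible, so it defines a simple extension that
    embeds by sending the root to z. *)
Lemma exists_number_field (z : R[i]) (p : {poly rat}) : p != 0 ->
  root (map_poly ratr p) z ->
  exists (K : fieldExtType rat) (kappa : {rmorphism K -> R[i]}) (x : K), kappa x = z.
Proof.
move=> p0 pz.
pose P (s : nat) := `[< exists r : {poly rat},
  [/\ r != 0, root (map_poly ratr r) z & size r = s] >].
have exP : exists s, P s by exists (size p); apply/asboolP; exists p.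
have [s /asboolP[r [r0 rz <-]] rmin] := ex_minnP exP.
have irr : irreducible_poly r.
  apply/(subfx_irreducibleP rz r0) => q qz q0; apply: rmin; apply/asboolP.
  by exists q.
exists (SubFieldExtType rz irr), (@subfx_inj _ _ ratr z r), (subfx_root _ z r).
exact: subfx_inj_root.
Qed.

Lemma map_preimage (K : Type) (f : K -> R[i]) (Y : seq R[i]) :
  (forall y, y \in Y -> range f y) -> exists t, [seq f x | x <- t] = Y.
Proof.
elim: Y => [|y Y IH] h; first by exists [::].
have [x _ xy] := h y (mem_head _ _); have [|t tE] := IH.
  by move=> z zY; apply: h; rewrite inE zY orbT.
by exists (x :: t); rewrite /= xy tE.
Qed.

(* The span of a multiplicatively closed set containing 1 is a subfield. *)
Lemma exists_span_field (X : set R[i]) (Y : seq R[i]) (K : fieldExtType rat)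
    (kappa : {rmorphism K -> R[i]}) :
  (forall y, y \in Y -> range kappa y) -> 1 \in Y ->
  (forall x y, x \in Y -> y \in Y -> x * y \in Y) -> (forall x, X x -> x \in Y) ->
  (forall y, y \in Y -> exists a b, [/\ X a, X b & y = a * b]) ->
  exists (F : fieldExtType rat) (iota : {rmorphism F -> R[i]}),
    smallest_number_field X iota /\
    exists2 s : seq F, << s >>%VS = fullv & forall x, x \in s -> iota x \in Y.
Proof.
move=> YK Y1 YM XY YX.
have [t tE] := map_preimage YK.
have tY x : (x \in t) = (kappa x \in Y) by rewrite -tE mem_map //; exact: fmorph_inj.
have asp : is_aspace <<t>>%VS.
  rewrite /is_aspace has_algid1; last by rewrite memv_span // tY rmorph1.
  apply/prodvP => u v ut vt.
  rewrite (@coord_span _ _ _ (in_tuple t) _ ut) (@coord_span _ _ _ (in_tuple t) _ vt).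
  rewrite mulr_suml; apply: memv_suml => i _; rewrite mulr_sumr; apply: memv_suml => j _.
  rewrite -scalerAl -scalerAr !memvZ // memv_span // tY rmorphM YM // -tY mem_nth //.
pose E : {subfield K} := ASpace asp.
pose iota : {rmorphism subvs_of E -> R[i]} := kappa \o vsval.
exists (subvs_of E), iota; split.
  split=> [x Xx|K' kappa' Xk y [x _ <-]].
    have /XY := Xx; rewrite -tE => /mapP[w wt ->].
    by exists (vsproj E w) => //=; rewrite vsprojK // memv_span.
  pose A (c : R[i]) := exists w, kappa' w = c.
  have AM c d : A c -> A d -> A (c * d) by move=> [v <-] [w <-]; exists (v * w); rewrite rmorphM.
  have AD c d : A c -> A d -> A (c + d) by move=> [v <-] [w <-]; exists (v + w); rewrite rmorphD.
  suff [w <-] : A (iota x) by exists w.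
  rewrite /iota /= (@coord_span _ _ _ (in_tuple t) _ (subvsP x)) rmorph_sum /=; apply: (big_ind A) => //.
    by exists 0; rewrite rmorph0.
  move=> i _; rewrite rmorphZ_num; apply: (AM).
    by exists (ratr (coord (in_tuple t) i (vsval x))); rewrite fmorph_rat.
  have /YX[a [c [Xa Xc ->]]] : kappa (in_tuple t)`_i \in Y by rewrite -tY mem_nth.
  by apply: AM; [have [w] := Xk _ Xa|have [w] := Xk _ Xc]; exists w.
exists [seq vsproj E x | x <- t].
  apply/eqP; rewrite eqEsubv subvf /=; apply/subvP => x _.
  suff -> : x = \sum_i coord (in_tuple t) i (vsval x) *: vsproj E t`_i.
    apply: memv_suml => i _; rewrite memvZ // memv_span // map_f // mem_nth //.
  apply: subvs_inj; rewrite linear_sum /= {1}(@coord_span _ _ _ (in_tuple t) _ (subvsP x)); apply: eq_bigr => i _.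
  by rewrite vsprojK // memv_span // mem_nth.
move=> _ /mapP[x xt ->] /=; rewrite vsprojK ?memv_span // -tY //.
Qed.

End NumberField.

(** Add t q, where t is the part of u built from the primes that do not divide y. A prime of u
    outside y divides t q but not y; a prime of u inside y divides neither t nor q, hence not t
    q. *)
Lemma exists_coprime_representative (q u y : nat) : (0 < u)%N -> (0 < y)%N ->
  coprime y q -> exists y', [/\ (0 < y')%N, coprime u y' & (y' = y %[mod q])%N].
Proof.
move=> u0 y0 yq; set t := (u`_(\pi(y)^'))%N; exists (y + t * q)%N.
split; [by rewrite addn_gt0 y0 | | by rewrite addnC modnMDl].
apply/negPn/negP => nc; have g1 : (1 < gcdn u (y + t * q))%N.
  rewrite ltn_neqAle eq_sym gcdn_gt0 u0 andbT; exact: nc.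
have pp := pdiv_prime g1; set p := pdiv _ in pp.
have /andP[pu py] : ((p %| u) && (p %| y + t * q))%N by rewrite -dvdn_gcd pdiv_dvd.
have t0 : (0 < t)%N by apply: part_gt0.
have pt : (p %| t)%N = ~~ (p %| y)%N.
  have := pi_of_part (\pi(y)^')%N u0 p; rewrite !inE /= !mem_primes pp t0 u0 y0 pu /=.
  by move->.
case: (boolP (p %| y)%N) => hy; last by move: py; rewrite dvdn_addl ?(negPf hy) // dvdn_mulr ?pt.
move: py; rewrite dvdn_addr // Euclid_dvdM // pt hy /= => pq.
have : (p %| gcdn y q)%N by rewrite dvdn_gcd hy.
by rewrite (eqP yq) dvdn1 => /eqP p1; rewrite p1 in pp.
Qed.

(** * The image of Gamma_1 as a lattice *)

Section ImageLattice.
Variable R : realType.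
Variables (q1 q2 : nat) (chi1 chi2 : int -> R[i]).
Hypotheses (q1_gt1 : (1 < q1)%N) (q2_gt1 : (1 < q2)%N).
Hypotheses (p1 : primitive_character q1 chi1) (p2 : primitive_character q2 chi2).
Hypothesis parity : chi1 (-1) * chi2 (-1) = 1.

Let h1 := proj1 p1.
Let h2 := proj1 p2.
Let N := (q1 * q2)%N.
Let N_gt0 : (0 < N)%N.
Proof. by rewrite muln_gt0 (ltnW q1_gt1) (ltnW q2_gt1). Qed.

Lemma chi_nat q chi (m : int) : (1 < q)%N -> dirichlet_character q chi ->
  exists2 u : nat, (u < q)%N & chi m = chi u%:Z :> R[i].
Proof.
move=> q_gt1 h; have [d dq dE] := modz_nat_exists m (ltnW q_gt1).
by exists d => //; apply: (chi_mod h); rewrite -dE modz_mod.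
Qed.

Definition products : seq R[i] :=
  [seq chi1 u%:Z * chi2 v%:Z | u <- iota 0 q1, v <- iota 0 q2].

Lemma productsP y : y \in products <-> exists u v : int, y = chi1 u * chi2 v.
Proof.
split=> [/allpairsP[[u v] /= [_ _ ->]]|[u [v ->]]]; first by exists u%:Z, v%:Z.
have [u' uq ->] := chi_nat u q1_gt1 h1; have [v' vq ->] := chi_nat v q2_gt1 h2.
by apply/allpairsP; exists (u', v'); rewrite !mem_iota.
Qed.

Lemma chi_root_of_unity q chi (m : int) n : (1 < q)%N -> dirichlet_character q chi ->
  (totient q %| n)%N -> chi m = 0 \/ chi m ^+ n = 1 :> R[i].
Proof.
move=> q_gt1 h /dvdnP[k ->]; case: (boolP (coprimez m q%:Z)) => c; last by left; apply: (chi_zero h).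
by right; rewrite mulnC exprM (chi_totient q_gt1 h) // expr1n.
Qed.

(** The span needs an ambient number field: nonzero character values are n-th roots of unity for n =
    phi(q1) phi(q2), so Q(e(1/n)) contains them all. The products chi1(u) chi2(v) are closed under
    multiplication and include 1, so their span is a field. *)
Lemma exists_character_field : exists (F : fieldExtType rat) (iota : {rmorphism F -> R[i]}),
  smallest_number_field (range chi1 `|` range chi2) iota /\
  exists2 s : seq F, << s >>%VS = fullv & forall x, x \in s -> iota x \in products.
Proof.
pose n := (totient q1 * totient q2)%N.
have n0 : (0 < n)%N by rewrite muln_gt0 !totient_gt0 (ltnW q1_gt1) (ltnW q2_gt1).
have zP := @ex_prim R n n0; set z := ex _ in zP.
have [||K [kappa [x xz]]] := @exists_number_field R z ('X^n - 1).
- by rewrite -size_poly_gt0 size_XnsubC.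
- by rewrite rmorphB rmorph1 /= map_polyXn rootE !hornerE (prim_expr_order zP) subrr.
have rt w : w = 0 \/ w ^+ n = 1 -> range kappa w.
  case=> [->|/(prim_rootP zP)[i ->]]; first by exists 0; rewrite // rmorph0.
  by exists (x ^+ i); rewrite // rmorphXn xz.
have mM (y w : R[i]) : range kappa y -> range kappa w -> range kappa (y * w).
  by move=> [a _ <-] [b _ <-]; exists (a * b); rewrite // rmorphM.
apply: (exists_span_field (Y := products) (kappa := kappa)).
- move=> y /productsP[u [v ->]]; apply: mM; apply: rt.
    by apply: (chi_root_of_unity _ q1_gt1 h1); rewrite dvdn_mulr.
  by apply: (chi_root_of_unity _ q2_gt1 h2); rewrite dvdn_mull.
- by apply/productsP; exists 1, 1; rewrite (chi_one h1) (chi_one h2) mulr1.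
- move=> y w /productsP[u [v ->]] /productsP[u' [v' ->]]; apply/productsP.
  by exists (u * u'), (v * v'); rewrite (chiM h1) (chiM h2) mulrACA.
- by move=> y [[u _ <-]|[v _ <-]]; apply/productsP; [exists u, 1|exists 1, v];
    rewrite ?(chi_one h1) ?(chi_one h2) ?mulr1 ?mul1r.
- move=> y /productsP[u [v ->]]; exists (chi1 u), (chi2 v).
  by split=> //; [left; exists u|right; exists v].
Qed.

Section Values.
Variables (F : fieldExtType rat) (iota : {rmorphism F -> R[i]}).
Hypothesis chiF : range chi1 `|` range chi2 `<=` range iota.

Lemma dedekind_sum_range k l : range iota (dedekind_sum q1 chi1 chi2 k l).
Proof.
have sumR (I : finType) (f : I -> R[i]) : (forall i, range iota (f i)) ->
    range iota (\sum_i f i).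
  move=> hf; apply: (big_ind (range iota)) => [|y w [a _ <-] [b _ <-]|i _ //].
    by exists 0; rewrite // rmorph0.
  by exists (a + b); rewrite // rmorphD.
have mR (y w : R[i]) : range iota y -> range iota w -> range iota (y * w).
  by move=> [a _ <-] [b _ <-]; exists (a * b); rewrite // rmorphM.
have cR q chi (m : int) : (1 < q)%N -> dirichlet_character q chi -> range iota (chi m) ->
    range iota ((chi m)^*).
  by move=> q_gt1 h [a _ ea]; exists a^-1; rewrite // fmorphV (conj_chi q_gt1 h) ea.
have bR j : range iota (bern1 R[i] j k).
  rewrite /bern1; case: ifP => _; first by exists 0; rewrite // rmorph0.
  exists ((j %% k%:Z)%Z%:~R / k%:R - 2^-1) => //.
  by rewrite rmorphB fmorph_div fmorphV rmorph_int !rmorph_nat.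
apply: (sumR) => j; apply: (sumR) => m; apply: (mR); apply: (mR) => //.
- by apply: (cR _ _ _ q2_gt1 h2); apply: chiF; right; exists j%:Z.
- by apply: (cR _ _ _ q1_gt1 h1); apply: chiF; left; exists m%:Z.
Qed.

Lemma newform_sum_range z g : 0 < complex.Im z -> Gamma1 N g ->
  range iota (newform_dedekind_sum q1 chi1 chi2 z g).
Proof.
move=> hz hg.
have [[-> _]|[k [l [_ -> _]]]] := newform_sum_values q1_gt1 q2_gt1 p1 p2 parity hz hg.
  by exists 0; rewrite // rmorph0.
by have [a _ <-] := dedekind_sum_range k l; exists (- a); rewrite // rmorphN.
Qed.

(** In chi1(u) chi2(v) the arguments need not be coprime; v is replaced by a representative modulo
    q2 that is prime to u. A nonzero product makes v a unit modulo q2, which this replacement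
    requires. *)
Lemma parabolic_product z y : 0 < complex.Im z -> y \in products -> y != 0 ->
  exists2 g, Gamma1 N g &
    newform_dedekind_sum q1 chi1 chi2 z g = parabolic_const q1 q2 chi1 chi2 * y.
Proof.
move=> hz /productsP[u [v ->]].
have [u' uq ->] := chi_nat u q1_gt1 h1; have [v' vq ->] := chi_nat v q2_gt1 h2.
rewrite mulf_eq0 negb_or => /andP[cu cv].
have pos q chi (w : nat) : (1 < q)%N -> dirichlet_character q chi -> chi w%:Z != 0 :> R[i] ->
    (0 < w)%N.
  move=> q_gt1 h; rewrite lt0n; apply: contraNneq => ->.
  by rewrite (chi_dvd q_gt1 h) ?dvdz0.
have u0 := pos _ _ _ q1_gt1 h1 cu; have v0 := pos _ _ _ q2_gt1 h2 cv.
have cvq : coprime v' q2 by move: cv; rewrite (chi_neq0 h2) /coprimez /gcdz !absz_nat.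
have [y' [y0 cop ym]] := exists_coprime_representative u0 v0 cvq.
have -> : chi2 v'%:Z = chi2 y'%:Z.
  by apply: (chi_mod h2); rewrite !modz_nat ym.
exists (parabolic q1 q2 u' y'); first exact: parabolic_Gamma1.
exact: newform_parabolic.
Qed.

Lemma image_full_rank_lattice (s : seq F) z : << s >>%VS = fullv ->
  (forall x, x \in s -> iota x \in products) -> 0 < complex.Im z ->
  full_rank_lattice iota (newform_dedekind_sum q1 chi1 chi2 z @` Gamma1 N).
Proof.
move=> sF sY hz; set S := newform_dedekind_sum q1 chi1 chi2 z.
have hS g h : Gamma1 N g -> Gamma1 N h -> S (g *m h) = S g + S h.
  by move=> hg hh; exact: (newform_sum_hom q1_gt1 q2_gt1 p1 p2 parity hz hg hh).
have SF g : Gamma1 N g -> range iota (S g) by exact: newform_sum_range.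
have [W0 [W0S genW]] := finite_generation N_gt0 hS.
have [W WE] : exists W, [seq iota x | x <- W] = W0.
  by apply: map_preimage => y /W0S[g hg ->]; apply: SF.
have WS x : x \in W -> exists2 g, Gamma1 N g & S g = iota x.
  move=> xW; have /W0S[g hg e] : iota x \in W0 by rewrite -WE map_f.
  by exists g.
have gen (A : F -> Prop) : A 0 -> (forall x y, A x -> A y -> A (x - y)) ->
    (forall x, x \in W -> A x) -> forall g, Gamma1 N g -> exists2 x, A x & iota x = S g.
  move=> A0 AB AW; apply: (genW (fun y => exists2 x, A x & iota x = y)).
  - by exists 0; rewrite // rmorph0.
  - by move=> y w [a Aa <-] [b Ab <-]; exists (a - b); [apply: AB|rewrite rmorphB].
  - by move=> y; rewrite -WE => /mapP[x xW ->]; exists x; first exact: AW.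
have spanS g : Gamma1 N g -> exists2 x, x \in <<W>>%VS & iota x = S g.
  apply: (gen (fun x => x \in <<W>>%VS)); first exact: mem0v.
  - by move=> x y; apply: memvB.
  - by move=> x; apply: memv_span.
have spanW : <<W>>%VS = fullv.
  have C0 := parabolic_const_neq0 q1_gt1 q2_gt1 p1 p2 parity.
  have one : 1 \in products.
    by apply/productsP; exists 1, 1; rewrite (chi_one h1) (chi_one h2) mulr1.
  (* The product 1 realises the constant C itself as a value of S, which places it in F as an
     element [c]. *)
  have [g hg Sg] := parabolic_product hz one (oner_neq0 _).
  have [c cW cE] := spanS g hg; rewrite -/S mulr1 in Sg.
  have c0 : c != 0 by rewrite -(fmorph_eq0 iota) cE Sg.
  have cs y : y \in s -> c * y \in <<W>>%VS.
    move=> ys; case: (eqVneq y 0) => [->|y0]; first by rewrite mulr0 mem0v.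
    have iy0 : iota y != 0 by rewrite fmorph_eq0.
    have [g' hg' Sg'] := parabolic_product hz (sY y ys) iy0.
    have [x xW xE] := spanS g' hg'; suff -> : c * y = x by [].
    by apply: (fmorph_inj iota); rewrite rmorphM /= cE Sg xE.
  apply/eqP; rewrite eqEsubv subvf /=; apply/subvP => x _.
  (* Multiplication by [c] is bijective on F: expanding c^-1 x in [s] writes x through the vectors c
     y with y in [s]. *)
  have -> : x = c * (c^-1 * x) by rewrite mulVKf.
  have : c^-1 * x \in <<in_tuple s>>%VS by rewrite sF memvf.
  move=> /coord_span ->; rewrite mulr_sumr; apply: memv_suml => i _.
  by rewrite -scalerAr memvZ // cs // mem_nth.
have [e einj [eA We]] := lattice_basis spanW.
have combE m : int_comb (fun i => iota (e i)) m = iota (int_comb e m).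
  by rewrite /int_comb rmorph_sum; apply: eq_bigr => i _; rewrite rmorphMz.
pose A (x : F) := exists2 g, Gamma1 N g & S g = iota x.
have SB g h : Gamma1 N g -> Gamma1 N h -> exists2 k, Gamma1 N k & S k = S g - S h.
  move=> hg hh; exists (g *m inv2 h); first by apply: Gamma1_mul => //; apply: Gamma1_inv.
  by rewrite hS ?(homV hS) //; apply: Gamma1_inv.
have S1 : S 1%:M = 0 := hom1 hS.
have A0 : A 0 by exists 1%:M; [apply: Gamma1_1|rewrite S1 rmorph0].
have AB x y : A x -> A y -> A (x - y).
  by move=> [g hg gx] [h hh hy]; have [k hk Sk] := SB _ _ hg hh; exists k; rewrite // Sk gx hy rmorphB.
split.
- by move=> _ [g hg <-]; apply: SF.
- split; first by rewrite inE; exists 1%:M => //; apply: Gamma1_1.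
  move=> x y; rewrite !inE => -[g hg <-] [h hh <-].
  by have [k hk Sk] := SB _ _ hg hh; exists k.
exists (fun i => iota (e i)) => [m m'|].
  by rewrite !combE => /fmorph_inj; apply: einj.
apply/seteqP; split=> y [].
  move=> m _ <-; rewrite combE.
  have [g hg Sg] : A (int_comb e m).
    by apply: int_comb_closed => //; apply: eA.
  by exists g.
move=> g hg <-.
have [||x xW|x [m ->] <-] := @gen (fun x => exists m, x = int_comb e m) _ _ _ g hg.
- by exists [ffun=> 0]; rewrite /int_comb big1 // => i _; rewrite ffunE mulr0z.
- move=> _ _ [m ->] [m' ->]; exists [ffun i => m i - m' i].
  by rewrite /int_comb -sumrB; apply: eq_bigr => i _; rewrite ffunE mulrzBr.
- exact: We.
by exists m; rewrite // combE.
Qed.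

End Values.
End ImageLattice.

Theorem theorem1p5 (R : realType) (q1 q2 : nat) (chi1 chi2 : int -> R[i]) :
  (1 < q1)%N -> (1 < q2)%N ->
  primitive_character q1 chi1 -> primitive_character q2 chi2 ->
  chi1 (-1) * chi2 (-1) = 1 ->
  exists (F : fieldExtType rat) (iota : {rmorphism F -> R[i]}),
    smallest_number_field (range chi1 `|` range chi2) iota /\
    forall z : R[i], 0 < complex.Im z ->
      full_rank_lattice iota
        (newform_dedekind_sum q1 chi1 chi2 z @` Gamma1 (q1 * q2)).
Proof.
move=> q1_gt1 q2_gt1 p1 p2 parity.
have [F [iota [hF [s sF sY]]]] := exists_character_field q1_gt1 q2_gt1 p1 p2.
exists F, iota; split=> // z hz.
exact: (image_full_rank_lattice q1_gt1 q2_gt1 p1 p2 parity (proj1 hF) sF sY hz).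
Qed.
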